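(* Let $d=3$ (so $W$ is a Weyl group of type $A_2$ and $\mathbb{C}[\mathcal{C}]=\mathbb{C}[A]$). The $\mathbb{C}[A]$-algebra $Z$ admits the following presentation: generators $q,r,Q,R,\mathbf{eu},\mathbf{a}_1,\mathbf{a}_2$; relations $$\begin{aligned} \mathbf{eu}\,\mathbf{a}_1&=q\,\mathbf{a}_2+rQ,\\ \mathbf{eu}\,\mathbf{a}_2&=Q\,\mathbf{a}_1+qR,\\ \mathbf{a}_1^2&=4q^2Q+r\,\mathbf{a}_2-q\,\mathbf{eu}^2+9A^2q,\\ \mathbf{a}_1\mathbf{a}_2&=4qQ\,\mathbf{eu}+rR-\mathbf{eu}^3+9A^2\,\mathbf{eu},\\ \mathbf{a}_2^2&=4qQ^2+R\,\mathbf{a}_1-Q\,\mathbf{eu}^2+9A^2Q. \end{aligned}$$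
   Context: Let $d=3$ and let $\zeta$ be a primitive $d$-th root of unity. $V=\mathbb{C}^2$ has canonical basis $(x,y)$, $V^*$ dual basis $(X,Y)$; $\mathbb{C}[V]=\mathbb{C}[X,Y]$, $\mathbb{C}[V^*]=\mathbb{C}[x,y]$. For $i\in\mathbb{Z}/d\mathbb{Z}$, $s_i=\begin{pmatrix}0&\zeta^i\\ \zeta^{-i}&0\end{pmatrix}$, $\alpha_i^\vee=\zeta^ix-y$, $\alpha_i=X-\zeta^iY$; $W=\langle s_0,s_1\rangle$ is dihedral of order $2d$, $\mathrm{Ref}(W)=\{s_i\}$. $\mathcal{C}$ is the space of functions $\mathrm{Ref}(W)\to\mathbb{C}$ constant on conjugacy classes, $C_i\in\mathcal{C}^*$ is evaluation at $s_i$, $A=C_0$ (all $C_i$ are equal to $A$ here). $\mathbf{H}$ (generic rational Cherednik algebra at $t=0$) is the quotient of $\mathbb{C}[\mathcal{C}]\otimes(T(V\oplus V^* )\rtimes W)$ by $[u,u']=[U,U']=0$, $[u,U]=-2\sum_iC_i\frac{\langle u,\alpha_i\rangle\langle\alpha_i^\vee,U\rangle}{\langle\alpha_i^\vee,\alpha_i\rangle}s_i$ ($u,u'\in V$, $U,U'\in V^*$); $Z$ is its centre. Multiplication gives $\mathbb{C}[\mathcal{C}]\otimes\mathbb{C}[V]\otimes\mathbb{C}W\otimes\mathbb{C}[V^*]\cong\mathbf{H}$; $\mathrm{Trunc}:\mathbf{H}\to\mathbb{C}[\mathcal{C}]\otimes\mathbb{C}[V]\otimes\mathbb{C}[V^*]$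 takes the coefficient of $1\in W$ and restricts to a bijection $Z\cong\mathbb{C}[\mathcal{C}\times V\times V^*]^W$. $q=xy$, $r=x^d+y^d$, $Q=XY$, $R=X^d+Y^d$ lie in $Z$; $\mathbf{eu}=\mathrm{Trunc}^{-1}(xX+yY)$ and $\mathbf{a}_i=\mathrm{Trunc}^{-1}(x^{d-i}Y^i+y^{d-i}X^i)$. *)

(* Defs.v *)
From HB Require Import structures.
From mathcomp Require Import all_boot all_order all_algebra.
From mathcomp Require Import ring_quotient boolp reals complex.
From mathcomp Require Import -(notations) monalg.
From mathcomp Require Import mpoly.

Set Implicit Arguments.
Unset Strict Implicit.
Unset Printing Implicit Defensive.

Import GRing.Theory.
Local Open Scope ring_scope.
Local Open Scope quotient_scope.

Lemma malg_scalerAr (R : comNzRingType) (M : monomType) (c : R)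
    (p q : malg M R) : c *: (p * q) = p * (c *: q).
Proof.
apply/monalg.malgP => k; rewrite monalg.mcoeffZ monalg.mcoeffMl.
rewrite (monalg.mcoeffMlw _ (finmap.fsubset_refl _) (monalg.msuppZ_le c q)).
rewrite mulr_sumr; apply: eq_bigr => k1 _; rewrite mulr_sumr.
by apply: eq_bigr => k2 _; rewrite monalg.mcoeffZ mulrnAr mulrCA.
Qed.

(* The free associative R-algebra on I. It needs its own name because the     *)
(* library's algType structure on malg covers commutative monoids only.       *)
Definition free_alg (R : comNzRingType) (I : choiceType) : Type :=
  malg (fmonom I) R.

HB.instance Definition _ (R : comNzRingType) (I : choiceType) :=
  GRing.Lalgebra.copy (free_alg R I) (malg (fmonom I) R).
HB.instance Definition _ (R : comNzRingType) (I : choiceType) :=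
  GRing.Lalgebra_isAlgebra.Build R (free_alg R I)
    (@malg_scalerAr R (fmonom I)).

Definition letter (R : comNzRingType) (I : choiceType) (a : I) :
  free_alg R I := mkmalgU (fmu a) 1.

Section QuotientAlgebra.
Variables (R : comNzRingType) (F : algType R) (S : F -> Prop).

Inductive two_sided_ideal : F -> Prop :=
| Ideal0 : two_sided_ideal 0
| IdealM a s b : S s -> two_sided_ideal (a * s * b)
| IdealD u v : two_sided_ideal u -> two_sided_ideal v ->
    two_sided_ideal (u + v).

Lemma two_sided_idealMl a u : two_sided_ideal u -> two_sided_ideal (a * u).
Proof.
elim=> [|b s c Ss|v w _ IHv _ IHw]; first by rewrite mulr0; constructor.
  by rewrite !mulrA; constructor.
by rewrite mulrDr; constructor.
Qed.

Lemma two_sided_idealMr a u : two_sided_ideal u -> two_sided_ideal (u * a).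
Proof.
elim=> [|b s c Ss|v w _ IHv _ IHw]; first by rewrite mul0r; constructor.
  by rewrite -mulrA; constructor.
by rewrite mulrDl; constructor.
Qed.

Definition in_ideal : {pred F} := [pred u | `[< two_sided_ideal u >]].

Lemma in_ideal_zmod_closed : zmod_closed in_ideal.
Proof.
split=> [|u v /asboolP Iu /asboolP Iv]; apply/asboolP; first by constructor.
by rewrite -mulN1r; constructor=> //; apply: two_sided_idealMl.
Qed.

HB.instance Definition _ := GRing.isZmodClosed.Build F in_ideal
  in_ideal_zmod_closed.

Hypothesis proper : ~ two_sided_ideal 1.

(* F modulo the two-sided ideal generated by S; the proof argument is what    *)
(* makes the quotient a nonzero ring.                                         *)
Definition quot_alg of ~ two_sided_ideal 1 := Quotient.quot in_ideal.
Local Notation Q := (quot_alg proper).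

HB.instance Definition _ := GRing.Zmodule.on Q.

Definition to_quot (u : F) : Q := \pi_(Quotient.quot in_ideal) u.

Lemma to_quotE u v : to_quot u = to_quot v <-> two_sided_ideal (u - v).
Proof.
split=> [/eqP|Iuv]; last apply/eqP; rewrite /to_quot piE.
  by move/asboolP.
exact/asboolP.
Qed.

Lemma to_quotK (z : Q) : to_quot (repr (z : Quotient.quot in_ideal)) = z.
Proof. exact: reprK. Qed.

Lemma to_quot_surj (z : Q) : exists u, to_quot u = z.
Proof. by exists (repr (z : Quotient.quot in_ideal)); apply: to_quotK. Qed.

Lemma to_quot_zmod : zmod_morphism to_quot.
Proof. by move=> u v; rewrite /to_quot !raddfB. Qed.

HB.instance Definition _ := GRing.isZmodMorphism.Build F Q to_quot to_quot_zmod.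

Let rep (z : Q) : F := repr (z : Quotient.quot in_ideal).

Definition quot_mul (z t : Q) : Q := to_quot (rep z * rep t).
Definition quot_scale (c : R) (z : Q) : Q := to_quot (c *: rep z).

Lemma quot_mulE u v : quot_mul (to_quot u) (to_quot v) = to_quot (u * v).
Proof.
have repP w : two_sided_ideal (rep (to_quot w) - w).
  by apply/to_quotE; rewrite to_quotK.
apply/to_quotE; set u' := rep _; set v' := rep _.
have -> : u' * v' - u * v = (u' - u) * v' + u * (v' - v).
  by rewrite mulrBl mulrBr addrA subrK.
apply: IdealD; first by apply: two_sided_idealMr; apply: repP.
by apply: two_sided_idealMl; apply: repP.
Qed.

Lemma quot_scaleE c u : quot_scale c (to_quot u) = to_quot (c *: u).
Proof.
apply/to_quotE; rewrite -scalerBr -[_ - u]mul1r scalerAl.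
by apply: two_sided_idealMl; apply/to_quotE; rewrite to_quotK.
Qed.

Local Ltac lift z := let u := fresh "u" in case: (to_quot_surj z) => u <-.

Lemma quot_mulA : associative quot_mul.
Proof. by move=> z t w; lift z; lift t; lift w; rewrite !quot_mulE mulrA. Qed.
Lemma quot_mul1 : left_id (to_quot 1) quot_mul.
Proof. by move=> z; lift z; rewrite quot_mulE mul1r. Qed.
Lemma quot_mulr1 : right_id (to_quot 1) quot_mul.
Proof. by move=> z; lift z; rewrite quot_mulE mulr1. Qed.
Lemma quot_mulDl : left_distributive quot_mul +%R.
Proof.
move=> z t w; lift z; lift t; lift w.
by rewrite -raddfD !quot_mulE mulrDl raddfD.
Qed.
Lemma quot_mulDr : right_distributive quot_mul +%R.
Proof.
move=> z t w; lift z; lift t; lift w.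
by rewrite -raddfD !quot_mulE mulrDr raddfD.
Qed.
Lemma quot_1neq0 : to_quot 1 != 0.
Proof.
by apply/eqP; rewrite -(raddf0 to_quot) => /to_quotE; rewrite subr0.
Qed.

HB.instance Definition _ := GRing.Zmodule_isNzRing.Build Q
  quot_mulA quot_mul1 quot_mulr1 quot_mulDl quot_mulDr quot_1neq0.

Lemma quot_scaleA a b z : quot_scale a (quot_scale b z) = quot_scale (a * b) z.
Proof. by lift z; rewrite !quot_scaleE scalerA. Qed.
Lemma quot_scale1 : left_id 1 quot_scale.
Proof. by move=> z; lift z; rewrite quot_scaleE scale1r. Qed.
Lemma quot_scaleDr : right_distributive quot_scale +%R.
Proof.
by move=> c z t; lift z; lift t; rewrite -raddfD !quot_scaleE scalerDr raddfD.
Qed.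
Lemma quot_scaleDl z : {morph quot_scale^~ z : a b / a + b}.
Proof.
by move=> a b; lift z; rewrite !quot_scaleE scalerDl raddfD.
Qed.

HB.instance Definition _ := GRing.Zmodule_isLmodule.Build R Q
  quot_scaleA quot_scale1 quot_scaleDr quot_scaleDl.

Lemma quot_scaleAl c (z t : Q) : c *: (z * t) = (c *: z) * t.
Proof.
lift z; lift t; rewrite /GRing.scale /GRing.mul /=.
by rewrite !(quot_mulE, quot_scaleE) scalerAl.
Qed.
HB.instance Definition _ := GRing.Lmodule_isLalgebra.Build R Q quot_scaleAl.

Lemma quot_scaleAr c (z t : Q) : c *: (z * t) = z * (c *: t).
Proof.
lift z; lift t; rewrite /GRing.scale /GRing.mul /=.
by rewrite !(quot_mulE, quot_scaleE) scalerAr.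
Qed.
HB.instance Definition _ := GRing.Lalgebra_isAlgebra.Build R Q quot_scaleAr.

Lemma to_quot_monoid : monoid_morphism to_quot.
Proof. by split=> // u v; rewrite /GRing.mul /= quot_mulE. Qed.
HB.instance Definition _ :=
  GRing.isMonoidMorphism.Build F Q to_quot to_quot_monoid.

Lemma to_quot_scalable : scalable to_quot.
Proof. by move=> c u; rewrite /GRing.scale /= quot_scaleE. Qed.
HB.instance Definition _ :=
  GRing.isScalable.Build R F Q *:%R to_quot to_quot_scalable.

End QuotientAlgebra.

Section Centre.
Variables (R : comNzRingType) (B : algType R).

Definition central : {pred B} := [pred z | `[< forall b, z * b = b * z >]].

Lemma central_subalg_closed : subalg_closed central.
Proof.
split.
- by apply/asboolP => b; rewrite mul1r mulr1.
- move=> c u v /asboolP Cu /asboolP Cv; apply/asboolP => b.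
  by rewrite mulrDl mulrDr -scalerAl -scalerAr Cu Cv.
- move=> u v /asboolP Cu /asboolP Cv; apply/asboolP => b.
  by rewrite -mulrA Cv mulrA Cu mulrA.
Qed.
HB.instance Definition _ :=
  GRing.isSubalgClosed.Build R B central central_subalg_closed.

Record centre := Centre { centre_val :> B; _ : centre_val \in central }.

HB.instance Definition _ := [isSub for centre_val].
HB.instance Definition _ := [Choice of centre by <:].
HB.instance Definition _ := [SubChoice_isSubAlgebra of centre by <:].

Lemma centre_mulC : commutative (@GRing.mul centre).
Proof.
by move=> z t; apply: val_inj; rewrite !rmorphM /=; case: z => z /= /asboolP.
Qed.
HB.instance Definition _ := GRing.PzRing_hasCommutativeMul.Build centre
  centre_mulC.
HB.instance Definition _ := GRing.Lalgebra_isComAlgebra.Build R centre.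

End Centre.

(* Z is generated by g as an R-algebra, and the ideal of relations between    *)
(* the elements of g is the one generated by rels.                            *)
Definition is_presentation (R : comNzRingType) (Z : comAlgType R) (n : nat)
    (g : n.-tuple Z) (rels : seq {mpoly R[n]}) : Prop :=
  let ev : {mpoly R[n]} -> Z := mmap (in_alg Z) (tnth g) in
  (forall z, exists p, ev p = z) /\
  (forall p, ev p = 0 <->
     exists c : 'I_(size rels) -> {mpoly R[n]},
       p = \sum_(i < size rels) c i * rels`_i).

Section Cherednik.
Variables (K : fieldType) (zeta : K).

Local Notation d := 3%N.

Definition mx22 (a b c e : K) : 'M[K]_2 :=
  \matrix_(i, j) nth 0 (nth [::] [:: [:: a; b]; [:: c; e]] i) j.

Definition refl_mx (i : nat) : 'M[K]_2 :=
  mx22 0 (zeta ^+ i) (zeta ^- i) 0.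

Inductive in_W : 'M[K]_2 -> Prop :=
| inW_s0 : in_W (refl_mx 0)
| inW_s1 : in_W (refl_mx 1)
| inW_one : in_W 1%:M
| inW_mul u v : in_W u -> in_W v -> in_W (u *m v)
| inW_inv u : in_W u -> in_W (invmx u).

Record W := MkW { W_val :> 'M[K]_2; _ : `[< in_W W_val >] }.
HB.instance Definition _ := [isSub for W_val].
HB.instance Definition _ := [Choice of W by <:].

Lemma in_WP (w : W) : in_W w.
Proof. by case: w => w /= /asboolP. Qed.

Definition W_one : W := MkW (asboolT inW_one).
Definition W_mul (u v : W) : W := MkW (asboolT (inW_mul (in_WP u) (in_WP v))).

Hypothesis zeta_prim : d.-primitive_root zeta.

Lemma refl_mx_in_W (i : 'I_d) : in_W (refl_mx i).
Proof.
have z0 : zeta != 0.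
  apply/eqP => z0; have := prim_expr_order zeta_prim.
  by rewrite z0 expr0n => /esym/eqP; rewrite oner_eq0.
case: i => [[|[|[|//]]] ?] /=; [exact: inW_s0|exact: inW_s1|].
suff -> : refl_mx 2 = refl_mx 0 *m refl_mx 1 *m refl_mx 0.
  by do 2?apply: inW_mul; constructor.
apply/matrixP => a b; rewrite !mxE !big_ord_recl big_ord0 !mxE.
rewrite !big_ord_recl !big_ord0 !mxE /=.
have z3 : zeta ^+ 2 = zeta^-1.
  by apply: (mulfI z0); rewrite divff // -exprS (prim_expr_order zeta_prim).
have z3' : zeta ^- 2 = zeta by rewrite z3 invrK.
case: a => [[|[|//]] ?]; case: b => [[|[|//]] ?] /=;
  rewrite ?expr0 ?expr1 ?invr1 ?z3 ?z3' ?invrK;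
  by rewrite !(mulr0, mul0r, mulr1, mul1r, addr0, add0r).
Qed.

Definition reflection (i : 'I_d) : W := MkW (asboolT (refl_mx_in_W i)).

(* V is the space of column vectors, V^* the space of row vectors.            *)
Definition pairing (u : 'cV[K]_2) (U : 'rV[K]_2) : K := (U *m u) 0 0.

Definition coroot (i : 'I_d) : 'cV[K]_2 :=
  \col_j (if j == 0 then zeta ^+ i else -1).
Definition root_form (i : 'I_d) : 'rV[K]_2 :=
  \row_j (if j == 0 then 1 else - zeta ^+ i).

(* As d is odd, all the reflections are conjugate: C[\mathcal{C}] = C[A] is   *)
(* {poly K}, all the C_i are equal to A, and A is 'X.                         *)
Local Notation KA := {poly K}.

(* C[\mathcal{C}] (x) C[V] (x) C[V^*]: the first two variables are X, Y and   *)
(* the last two are x, y.                                                     *)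
Definition polVV : Type := {mpoly KA[2 + 2]}.
HB.instance Definition _ := GRing.ComAlgebra.on polVV.

Definition pX : polVV := 'X_(lshift 2 0).
Definition pY : polVV := 'X_(lshift 2 1).
Definition px : polVV := 'X_(rshift 2 0).
Definition py : polVV := 'X_(rshift 2 1).

(* C[\mathcal{C}] (x) C[V] (x) CW (x) C[V^*], as finitely supported functions *)
(* from W to polVV.                                                           *)
Definition pbw_domain : Type := malg W polVV.
HB.instance Definition _ := GRing.Zmodule.on pbw_domain.

Definition pbw_coef (p : pbw_domain) (w : W) : polVV := monalg.mcoeff w p.

Local Notation bracket a b := (a * b - b * a).

(* The defining relations of H, for elements v = (x, y), f = (X, Y) and       *)
(* (g w)_(w in W) of an algebra B.                                            *)
Section Relations.
Variables (B : algType KA) (v f : 'I_2 -> B) (g : W -> B).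

Definition lin_vec (u : 'cV[K]_2) : B := \sum_j (u j 0)%:P *: v j.
Definition lin_form (U : 'rV[K]_2) : B := \sum_j (U 0 j)%:P *: f j.

(* The first four families present C[\mathcal{C}] (x) (T(V + V^* ) >| W).     *)
Inductive cherednik_rel : B -> Prop :=
| Rel_one : cherednik_rel (g W_one - 1)
| Rel_mul w w' : cherednik_rel (g w * g w' - g (W_mul w w'))
| Rel_V (w : W) u : cherednik_rel (g w * lin_vec u - lin_vec (w *m u) * g w)
| Rel_Vdual (w : W) U :
    cherednik_rel (g w * lin_form U - lin_form (U *m invmx w) * g w)
| Rel_VV u u' : cherednik_rel (bracket (lin_vec u) (lin_vec u'))
| Rel_VdualVdual U U' : cherednik_rel (bracket (lin_form U) (lin_form U'))
| Rel_VVdual u U :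
    cherednik_rel
      (bracket (lin_vec u) (lin_form U) -
       (- 2%:R *: \sum_(i < d)
          ('X * (pairing u (root_form i) * pairing (coroot i) U
                 / pairing (coroot i) (root_form i))%:P)
            *: g (reflection i))).

Lemma aug_cherednik_ideal (aug : B -> K) :
    zmod_morphism aug -> monoid_morphism aug ->
    (forall c p, aug (c *: p) = c.[0] * aug p) ->
    (forall j, aug (v j) = 0) -> (forall j, aug (f j) = 0) ->
    (forall w, aug (g w) = 1) ->
  forall p, two_sided_ideal cherednik_rel p -> aug p = 0.
Proof.
move=> augB [aug1 augM] augZ augv augf augg.
have aug0 : aug 0 = 0 by rewrite -(subrr 0) augB subrr.
have augD p q : aug (p + q) = aug p + aug q.
  by rewrite -{1}[q]opprK -(sub0r q) !augB aug0 sub0r opprK.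
have aug_scale (n : nat) (c : 'I_n -> KA) (p : 'I_n -> B) :
    (forall i, (c i).[0] * aug (p i) = 0) -> aug (\sum_(i < n) c i *: p i) = 0.
  move=> cp0; apply: (big_ind (fun p => aug p = 0)) => // [a b a0 b0|i _].
    by rewrite augD a0 b0 addr0.
  by rewrite augZ.
have aug_vec u : aug (lin_vec u) = 0.
  by apply: aug_scale => j; rewrite augv mulr0.
have aug_form U : aug (lin_form U) = 0.
  by apply: aug_scale => j; rewrite augf mulr0.
have aug_rel p : cherednik_rel p -> aug p = 0.
  case=> [|w w'|w u|w U|u u'|U U'|u U].
  - by rewrite augB augg aug1 subrr.
  - by rewrite augB augM !augg mulr1 subrr.
  - by rewrite augB !augM !aug_vec mulr0 mul0r subrr.
  - by rewrite augB !augM !aug_form mulr0 mul0r subrr.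
  - by rewrite augB !augM !aug_vec mulr0 subrr.
  - by rewrite augB !augM !aug_form mulr0 subrr.
  rewrite augB augZ aug_scale => [|i]; last by rewrite hornerM hornerX !mul0r.
  by rewrite mulr0 subr0 augB !augM aug_vec mulr0 mul0r subrr.
move=> p; elim=> [|a b c /aug_rel b0|a b _ a0 _ b0]; first exact: aug0.
  by rewrite !augM b0 mulr0 mul0r.
by rewrite augD a0 b0 addr0.
Qed.

Definition pbw_monomial (w : W) (m : 'X_{1..2 + 2}) : B :=
  (\prod_(j < 2) f j ^+ m (lshift 2 j)) * g w *
  (\prod_(j < 2) v j ^+ m (rshift 2 j)).

(* The multiplication map C[\mathcal{C}] (x) C[V] (x) CW (x) C[V^*] -> B.     *)
Definition pbw (p : pbw_domain) : B :=
  \sum_(w <- finmap.enum_fset (monalg.msupp p))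
    \sum_(m <- msupp (pbw_coef p w)) (pbw_coef p w)@_m *: pbw_monomial w m.

(* In H, pbw is bijective (the PBW theorem): then the default value 0 is      *)
(* never used.                                                                *)
Definition pbw_inv (h : B) : pbw_domain :=
  if pselect (exists p, pbw p = h) is left ex then projT1 (cid ex) else 0.

Definition trunc (h : B) : polVV := pbw_coef (pbw_inv h) W_one.

End Relations.

(* The generators: the bases (x, y) of V and (X, Y) of V^*, and W.            *)
Local Notation gens := ('I_2 + 'I_2 + W)%type.
Local Notation Free := (free_alg KA gens).

Definition free_v (j : 'I_2) : Free := letter KA (inl (inl j) : gens).
Definition free_f (j : 'I_2) : Free := letter KA (inl (inr j) : gens).
Definition free_g (w : W) : Free := letter KA (inr w : gens).

(* The augmentation x, y, X, Y, A |-> 0, w |-> 1 shows that the quotient is   *)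
(* not the zero ring.                                                         *)
Definition aug_word (m : fmonom gens) : K :=
  \prod_(a <- (m : seq _)) (if a is inr _ then 1 else 0).

Lemma aug_word_morph : mmorphism aug_word.
Proof.
by split=> [m1 m2|]; rewrite /aug_word ?fm1 ?big_nil // fmM big_cat.
Qed.
HB.instance Definition _ :=
  isMultiplicative.Build (fmonom gens) K aug_word aug_word_morph.

Lemma cherednik_proper :
  ~ two_sided_ideal (cherednik_rel free_v free_f free_g) 1.
Proof.
pose aug : {rmorphism malg (fmonom gens) KA -> K} :=
  monalg.mmap (horner_eval (0 : K)) aug_word.
have augL (a : gens) : aug (letter KA a) = if a is inr _ then 1 else 0.
  transitivity (horner_eval 0 (1 : KA) * aug_word (fmu a)).
    exact: monalg.mmapU.
  by rewrite /horner_eval hornerE mul1r /aug_word fmuE big_seq1.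
move=> I1; pose augF (p : Free) : K := aug p.
suff: augF 1 = 0 by move/eqP; rewrite /augF rmorph1 oner_eq0.
apply: aug_cherednik_ideal I1 => [|||j|j|w].
- exact: raddfB.
- by split; [exact: rmorph1 | exact: rmorphM].
- by move=> c p; apply: (monalg.mmapZ (f := horner_eval (0 : K))).
- exact: augL.
- exact: augL.
exact: augL.
Qed.

(* The generic rational Cherednik algebra H at t = 0.                         *)
Definition cherednik := quot_alg cherednik_proper.
HB.instance Definition _ := GRing.Algebra.on cherednik.

Definition of_free : Free -> cherednik := to_quot cherednik_proper.
Definition vH (j : 'I_2) : cherednik := of_free (free_v j).
Definition fH (j : 'I_2) : cherednik := of_free (free_f j).
Definition gH (w : W) : cherednik := of_free (free_g w).

Definition xH : cherednik := vH 0.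
Definition yH : cherednik := vH 1.
Definition XH : cherednik := fH 0.
Definition YH : cherednik := fH 1.

Definition Trunc : cherednik -> polVV := trunc vH fH gH.

End Cherednik.

(* Main.v *)
(** The algebra H acts on the C[A]-valued functions on the regular points (a, b) of V x V^*
    (a off the reflection hyperplanes): C[V] by multiplication, W by translation and V by
    Dunkl operators.  At A = 0 the element sum_w p_w w, p_w in C[V x V^*], acts by
    f |-> sum_w p_w(a, b) f((a, b).w), and W permutes the regular points freely.  Hence an
    element that commutes with C[V] and whose truncation, or whose value on the constant
    function 1, vanishes is divisible by A, and, by iteration, is zero.  This gives the PBW
    theorem, the injectivity of Trunc on Z, and reduces the computations in Z to the values
    on 1.

    The seven generators act by multiplication by explicit W-invariant functions lam, and the
    relations are identities of rational functions between them.  Modulo the relations, every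
    polynomial is a combination of 1, eu, eu^2, eu^3, a1, a2 with coefficients in
    C[A][q, r, Q, R]; these six elements are independent as functions, again by division by A,
    because at A = 0 a generic value of (q, r, Q, R) is taken at six points with X, Y fixed.
    Finally, a central z maps 1 to a W-invariant function, hence to its average over W, and
    the average of every X^a Y^b Dx^c Dy^e 1 is a polynomial in lam, by induction on the
    exponents from finitely many cases; so z is a polynomial in the generators. *)

From HB Require Import structures.
Require Import Defs.
From mathcomp Require Import all_boot all_order all_algebra.
From mathcomp Require Import ring zify functions.
From mathcomp Require Import boolp reals complex.
From mathcomp Require Import -(notations) monalg.
From mathcomp Require Import ssrcomplements mpoly.

Set Implicit Arguments.
Unset Strict Implicit.
Unset Printing Implicit Defensive.

Import GRing.Theory Num.Theory.
Local Open Scope ring_scope.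

(** At t = 0 the Dunkl operators contain no derivative: they multiply by a coordinate and add values
    at reflected points divided by the roots. Hence the functions may be arbitrary, without
    regularity, so that indicator functions can separate the points of an orbit, and H acts linearly
    over the W-invariant functions. An identity between operators a priori involves the values at
    all six points of an orbit. On eigenfunctions of the rotation of order 3 only the values at p
    and p.s_0 remain, and [field] decides a rational identity in X, Y, x, y, A. The sums over the
    three roots collapse to 3 X^2, 3 Y^2 or 3 XY over X^3 - Y^3; the square of this 3 is the
    constant 9 of the relations. Values are polynomials in A rather than numbers, so that
    multiplication by A is injective and division by A can be iterated; identities are checked after
    evaluating A at every number a. The elements eu, a_1, a_2 arise by adding to the prescribed
    truncation the reflection terms that cancel the contribution of p.s_0. *)

Section Vanishing.
Variable K : numFieldType.

Lemma poly_eval_eq0 (p : {poly K}) : (forall a, p.[a] = 0) -> p = 0.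
Proof.
move=> p0; apply/eqP; apply: contraT => pn0.
pose s := [seq (i%:R : K) | i <- iota 0 (size p)].
have := max_poly_roots pn0 (_ : all (root p) s) (_ : uniq s).
rewrite size_map size_iota ltnn; apply.
  by apply/allP => a _; apply/eqP.
rewrite map_inj_uniq ?iota_uniq // => i j /eqP.
by rewrite eqr_nat => /eqP.
Qed.

Lemma poly_eval_inj (p q : {poly K}) : (forall a, p.[a] = q.[a]) -> p = q.
Proof.
move=> pq; apply/eqP; rewrite -subr_eq0; apply/eqP/poly_eval_eq0 => a.
by rewrite hornerD hornerN pq subrr.
Qed.

(** Exponents are fixed one variable at a time. [slice k] keeps the monomials whose first k
    exponents are those of [m0]; letting variable k vary gives a one-variable polynomial that
    vanishes everywhere, and its coefficient at [m0 k] is the next slice. At k = n only the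
    coefficient of [m0] is left. *)
Lemma mpoly_eval_eq0 n (p : {mpoly K[n]}) : (forall v, p.@[v] = 0) -> p = 0.
Proof.
move=> p0; apply/mpolyP => m0; rewrite mcoeff0.
pose agree k (m : 'X_{1..n}) := [forall i : 'I_n, (i < k)%N ==> (m i == m0 i)].
have slice k v : (k <= n)%N ->
    \sum_(m <- msupp p | agree k m) p@_m * \prod_(i < n | (k <= i)%N) v i ^+ m i = 0.
  elim: k v => [|k IHk] v lekn.
    rewrite -[RHS](p0 v) mevalE big_mkcond; apply: eq_bigr => m _.
    by rewrite ifT //; apply/forallP.
  pose i0 := Ordinal lekn; pose w t i := if i == i0 then t else v i.
  pose q : {poly K} := \sum_(m <- msupp p | agree k m)
    (p@_m * \prod_(i < n | (k < i)%N) v i ^+ m i) *: 'X^(m i0).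
  have q0 : q = 0.
    apply: poly_eval_eq0 => t; rewrite -[RHS](IHk (w t) (ltnW lekn)).
    rewrite horner_sum; apply: eq_bigr => m _.
    rewrite hornerZ hornerXn -mulrA; congr (_ * _).
    rewrite [RHS](bigD1 i0) //= /w eqxx mulrC; congr (_ * _).
    apply: eq_big => [i|i ltki].
      by rewrite ltn_neqAle andbC eq_sym.
    by rewrite ifN // -val_eqE /= gtn_eqF.
  have := congr1 (fun q : {poly K} => q`_(m0 i0)) q0.
  rewrite coef0 coef_sum => e; apply: etrans e.
  rewrite [LHS]big_mkcond [RHS]big_mkcond.
  apply: eq_bigr => m _; rewrite coefZ coefXn.
  have -> : agree k.+1 m = agree k m && (m i0 == m0 i0).
    apply/forallP/andP => [ag|[/forallP ag /eqP e] i].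
      split; last exact: (implyP (ag i0)).
      by apply/forallP => i; apply/implyP => ltik; apply: (implyP (ag i)); rewrite ltnS ltnW.
    apply/implyP; rewrite ltnS leq_eqVlt => /orP[/eqP ik|]; last exact/implyP/ag.
    by have -> : i = i0 by [apply: val_inj]; rewrite e.
  rewrite [m0 i0 == _]eq_sym; case: (agree k m) => //=.
  by case: eqP => _; rewrite ?mulr1 ?mulr0.
have := slice n (fun=> 0) (leqnn n).
rewrite (eq_bigr (fun m => p@_m)) => [|m _]; last first.
  by rewrite big1 ?mulr1 // => i; rewrite leqNgt ltn_ord.
rewrite (eq_bigl (pred1 m0)) => [|m]; last first.
  apply/forallP/eqP => [ag|-> i]; last exact/implyP.
  by apply/mnmP => i; apply/eqP/(implyP (ag i)).
have [m0p|/memN_msupp_eq0->//] := boolP (m0 \in msupp p).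
by rewrite -big_filter filter_pred1_uniq ?msupp_uniq // big_seq1.
Qed.

End Vanishing.

Lemma malgU_scale (R : comNzRingType) (I : choiceType) (m : fmonom I) (c : R) :
  monalg.mkmalgU m c = c *: monalg.mkmalgU m 1 :> free_alg R I.
Proof.
by apply/monalg.malgP => k; rewrite monalg.mcoeffZ !monalg.mcoeffU mulrnAr mulr1.
Qed.

Lemma malgU_cons (R : comNzRingType) (I : choiceType) (a : I) (s : seq I) :
  monalg.mkmalgU (FMonom (a :: s)) 1 =
  letter R a * monalg.mkmalgU (FMonom s) 1 :> free_alg R I.
Proof.
rewrite /letter monalg.malgM_def monalg.fgmulUU mulr1; congr monalg.mkmalgU.
by apply/eqP; rewrite fmP fmM fmuE.
Qed.

(** * Free algebras acting on functions *)

Section FreeAction.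
Variables (R : comNzRingType) (I : choiceType) (T : Type).
Local Notation Fun := (T -> R^o).
Variable op : I -> Fun -> Fun.
Hypothesis op_linear : forall a, linear (op a).

Definition act_word (m : fmonom I) (phi : Fun) : Fun :=
  foldr op phi (m : seq I).

(** For fixed [phi] and [t] only the additive extension of [m |-> act_word m phi t] is taken, so
    compatibility with products is a separate fact, [act_freeM]. *)
Definition act_free (p : free_alg R I) (phi : Fun) : Fun :=
  fun t => monalg.mmap idfun (fun m => act_word m phi t) p.

Lemma act_word_linear m : linear (act_word m).
Proof.
rewrite /act_word => c phi psi; elim: (m : seq I) => //= a s ->.
exact: op_linear.
Qed.

Lemma act_free_sum (J : Type) (r : seq J) (P : pred J) (F : J -> free_alg R I)
    phi :
  act_free (\sum_(j <- r | P j) F j) phi = \sum_(j <- r | P j) act_free (F j) phi.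
Proof. by apply/funext => t; rewrite fct_sumE /act_free raddf_sum. Qed.

Lemma act_freeD p q phi : act_free (p + q) phi = act_free p phi + act_free q phi.
Proof. by apply/funext => t; rewrite /act_free raddfD. Qed.

Lemma act_freeB p q phi : act_free (p - q) phi = act_free p phi - act_free q phi.
Proof. by apply/funext => t; rewrite /act_free raddfB. Qed.

Lemma act_free0 phi : act_free 0 phi = 0.
Proof. by apply/funext => t; rewrite /act_free raddf0. Qed.

Lemma act_freeU c m phi : act_free (monalg.mkmalgU m c) phi = c *: act_word m phi.
Proof. by apply/funext => t; rewrite /act_free monalg.mmapU. Qed.

Lemma act_free_linear p : linear (act_free p).
Proof.
move=> c phi psi; apply/funext => t.
rewrite -[RHS]/(c * act_free p phi t + act_free p psi t).
rewrite /act_free !monalg.mmapE /= mulr_sumr -big_split /=.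
by apply: eq_bigr => m _; rewrite act_word_linear [in LHS]mulrDr [c * _]mulrCA.
Qed.

HB.instance Definition _ p := GRing.isLinear.Build R Fun Fun *:%R (act_free p)
  (act_free_linear p).

Lemma act_freeZ c p phi : act_free (c *: p) phi = c *: act_free p phi.
Proof.
rewrite [in RHS](monalg.monalgE p) [in LHS](monalg.monalgE p) scaler_sumr.
rewrite !act_free_sum scaler_sumr.
apply: eq_bigr => m _; rewrite act_freeU scalerA -act_freeU; congr act_free.
by apply/monalg.malgP => k; rewrite monalg.mcoeffZ !monalg.mcoeffU mulrnAr.
Qed.

Lemma act_freeM p q phi : act_free (p * q) phi = act_free p (act_free q phi).
Proof.
rewrite [p]monalg.monalgE mulr_suml !act_free_sum; apply: eq_bigr => m _.
rewrite [q]monalg.monalgE mulr_sumr !act_free_sum linear_sum.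
apply: eq_bigr => m' _; rewrite monalg.malgM_def monalg.fgmulUU.
by rewrite !act_freeU linearZ /= act_freeU scalerA mulrC /act_word fmM foldr_cat.
Qed.

Lemma act_free_letter a phi : act_free (letter R a) phi = op a phi.
Proof. by rewrite act_freeU scale1r /act_word fmuE. Qed.

Lemma act_free1 phi : act_free 1 phi = phi.
Proof. by rewrite act_freeU scale1r /act_word fm1. Qed.

End FreeAction.

Lemma big_ord2 (V : nmodType) (F : 'I_2 -> V) : \sum_(i < 2) F i = F 0 + F 1.
Proof. by rewrite big_ord_recl big_ord1; congr (F _ + F _); apply: val_inj. Qed.

Section LinearAction.
Variables (K : fieldType) (I : choiceType) (T : Type).
Local Notation KA := {poly K}.
Local Notation Fun := (T -> KA^o).
Variables (op : I -> Fun -> Fun) (t : 'I_2 -> I).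

Lemma act_lin_vec u phi :
  act_free op (lin_vec (fun j => letter KA (t j)) u) phi =
  (u 0 0)%:P *: op (t 0) phi + (u 1 0)%:P *: op (t 1) phi.
Proof. by rewrite /lin_vec big_ord2 act_freeD; congr (_ + _);
  rewrite act_freeZ act_free_letter. Qed.

Lemma act_lin_form U phi :
  act_free op (lin_form (fun j => letter KA (t j)) U) phi =
  (U 0 0)%:P *: op (t 0) phi + (U 0 1)%:P *: op (t 1) phi.
Proof. by rewrite /lin_form big_ord2 act_freeD; congr (_ + _);
  rewrite act_freeZ act_free_letter. Qed.

End LinearAction.

Lemma prod_ord2 (R : pzSemiRingType) (F : 'I_2 -> R) : \prod_(i < 2) F i = F 0 * F 1.
Proof. by rewrite big_ord_recl big_ord1; congr (F _ * F _); apply: val_inj. Qed.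

Definition hornE := (hornerD, hornerN, hornerM, hornerC, hornerX).

(** Models a polynomial ring in two variables as a module over its dihedral invariants: the product
    of the variables and the sum of their cubes lower the degree, down to the coinvariants 1, X, Y,
    X^2, Y^2, X^3. One cube suffices as a base case, since [stepr] yields the other. *)
Lemma exponent_reduction (P : nat -> nat -> Prop) :
  P 0%N 0%N -> P 1%N 0%N -> P 0%N 1%N -> P 2%N 0%N -> P 0%N 2%N -> P 3%N 0%N ->
  (forall a b, P a b -> P a.+1 b.+1) ->
  (forall a b, P a b -> P a b.+3 -> P a.+3 b) ->
  (forall a b, P a b -> P a.+3 b -> P a b.+3) ->
  forall a b, P a b.
Proof.
move=> P00 P10 P01 P20 P02 P30 step stepl stepr a b.
have [n] := ubnP (a + b); elim: n a b => // n IH [|a] [|b] abn.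
- exact: P00.
- case: b abn => [|[|b]] // abn; apply: stepr; first by apply: IH; lia.
  by case: b abn => [//|b] abn; apply/step/IH; lia.
- case: a abn => [|[|[|a]]] // abn; apply: stepl; first by apply: IH; lia.
  by apply/step/IH; lia.
by apply/step/IH; lia.
Qed.

(** Over an arbitrary ring, so that one list serves both for the variables of the polynomial ring
    and for the functions by which the generators act. *)
Definition relators (S : comPzRingType) (A q r Q R eu a1 a2 : S) : seq S :=
  [:: eu * a1 - (q * a2 + r * Q);
      eu * a2 - (Q * a1 + q * R);
      a1 ^+ 2 - (4%:R * q ^+ 2 * Q + r * a2 - q * eu ^+ 2 + 9%:R * A ^+ 2 * q);
      a1 * a2 - (4%:R * q * Q * eu + r * R - eu ^+ 3 + 9%:R * A ^+ 2 * eu);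
      a2 ^+ 2 - (4%:R * q * Q ^+ 2 + R * a1 - Q * eu ^+ 2 + 9%:R * A ^+ 2 * Q)].

(** * Normal forms modulo the relations *)

Section Reduction.
Variables (S : comNzRingType) (A q r Q R e a1 a2 : S) (B : S -> Prop).
Hypotheses (B1 : B 1) (BA : B A) (Bq : B q) (Br : B r) (BQ : B Q) (BR : B R).
Hypotheses (BN : forall s, B s -> B (- s)) (BD : forall s t, B s -> B t -> B (s + t)).
Hypothesis BM : forall s t, B s -> B t -> B (s * t).

Definition module_basis : seq S := [:: 1; e; e ^+ 2; e ^+ 3; a1; a2].
Local Notation rels := (relators A q r Q R e a1 a2).

(** [B] plays the role of the coefficient ring C[A][q, r, Q, R]. Indices outside the two lists are
    harmless: [nth] then returns 0. *)
Inductive reducible : S -> Prop :=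
| Red_basis i : reducible module_basis`_i
| Red_add x y : reducible x -> reducible y -> reducible (x + y)
| Red_base s x : B s -> reducible x -> reducible (s * x)
| Red_rel c k : reducible (c * rels`_k).

Let red1 : reducible 1 := Red_basis 0.
Let red_e1 : reducible e := Red_basis 1.
Let red_e2 : reducible (e ^+ 2) := Red_basis 2.
Let red_e3 : reducible (e ^+ 3) := Red_basis 3.
Let red_a1 : reducible a1 := Red_basis 4.
Let red_a2 : reducible a2 := Red_basis 5.
Let Bn n : B n%:R.
Proof. by elim: n => [|n IH]; [rewrite mulr0n -(subrr 1); apply: BD => //;
  apply: BN|rewrite mulrS; apply: BD]. Qed.

Let B4 : B 4%:R. Proof. exact: (Bn 4). Qed.
Let B9 : B 9%:R. Proof. exact: (Bn 9). Qed.

Ltac red_solve := repeat (first [assumption | apply: BM | apply: BN | apply: Red_rel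
  | apply: Red_add | apply: Red_base]).

Lemma red_mul_gen g : (forall i, (i < 6)%N -> reducible (g * module_basis`_i)) ->
  forall x, reducible x -> reducible (g * x).
Proof.
move=> gb x; elim=> {x} [i|x y _ IHx _ IHy|s x Bs _ IHx|c k].
- have [i6|i6] := ltnP i 6; first exact: gb.
  by rewrite nth_default // mulr0 -(mul0r 1); apply: Red_base => //; apply: (Bn 0).
- by rewrite mulrDr; apply: Red_add.
- by rewrite mulrCA; apply: Red_base.
by rewrite mulrA; apply: Red_rel.
Qed.

Let mul_e_a1 : e * a1 = q * a2 + r * (Q * 1) + 1 * rels`_0.
Proof. by rewrite /=; ring. Qed.
Let mul_e_a2 : e * a2 = Q * a1 + q * (R * 1) + 1 * rels`_1.
Proof. by rewrite /=; ring. Qed.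
Let mul_a1_a1 : a1 * a1 = 4%:R * (q * q * (Q * 1)) + r * a2 + (- q) * e ^+ 2
  + 9%:R * (A * A) * (q * 1) + 1 * rels`_2.
Proof. by rewrite /=; ring. Qed.
Let mul_a1_a2 : a1 * a2 = 4%:R * (q * (Q * e)) + r * (R * 1) + (- 1) * e ^+ 3
  + 9%:R * (A * A) * e + 1 * rels`_3.
Proof. by rewrite /=; ring. Qed.
Let mul_a2_a2 : a2 * a2 = 4%:R * (q * (Q * (Q * 1))) + R * a1 + (- Q) * e ^+ 2
  + 9%:R * (A * A) * (Q * 1) + 1 * rels`_4.
Proof. by rewrite /=; ring. Qed.

Lemma red_mul_e x : reducible x -> reducible (e * x).
Proof.
apply: red_mul_gen => -[|[|[|[|[|[|//]]]]]] _ /=.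
- by rewrite mulr1.
- by rewrite -expr2.
- by rewrite -exprS.
(* The fourth power has no relator of its own. Multiply the relator of a1 a2 by e, replace e a1 by q
   a2 + r Q, then a2^2 by its own relation. *)
- have -> : e * e ^+ 3 = 4%:R * (q * (Q * e ^+ 2)) + r * (R * e) + 9%:R * (A * A) * e ^+ 2
    + e * rels`_3 + (- (1 : S)) * (q * (4%:R * (q * (Q * (Q * 1))) + R * a1 + (- Q) * e ^+ 2
    + 9%:R * (A * A) * (Q * 1))) + (- q) * rels`_4 + (- (1 : S)) * (r * (Q * a2)) +
      (- a2) * rels`_0.
    by rewrite /=; ring.
  by red_solve.
- by rewrite mul_e_a1; red_solve.
- by rewrite mul_e_a2; red_solve.
Qed.

Lemma red_mul_a1 x : reducible x -> reducible (a1 * x).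
Proof.
apply: red_mul_gen => -[|[|[|[|[|[|//]]]]]] _ /=.
- by rewrite mulr1.
- by rewrite mulrC mul_e_a1; red_solve.
(* The factor a1 is absorbed by one e first; [red_mul_e] takes care of the other powers of e. *)
- have -> : a1 * e ^+ 2 = e * (e * a1) by ring.
  by apply: red_mul_e; rewrite mul_e_a1; red_solve.
- have -> : a1 * e ^+ 3 = e * (e * (e * a1)) by ring.
  by do 2! apply: red_mul_e; rewrite mul_e_a1; red_solve.
- by rewrite mul_a1_a1; red_solve.
- by rewrite mul_a1_a2; red_solve.
Qed.

Lemma red_mul_a2 x : reducible x -> reducible (a2 * x).
Proof.
apply: red_mul_gen => -[|[|[|[|[|[|//]]]]]] _ /=.
- by rewrite mulr1.
- by rewrite mulrC mul_e_a2; red_solve.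
- have -> : a2 * e ^+ 2 = e * (e * a2) by ring.
  by apply: red_mul_e; rewrite mul_e_a2; red_solve.
- have -> : a2 * e ^+ 3 = e * (e * (e * a2)) by ring.
  by do 2! apply: red_mul_e; rewrite mul_e_a2; red_solve.
- by rewrite mulrC mul_a1_a2; red_solve.
- by rewrite mul_a2_a2; red_solve.
Qed.

Lemma reducibleP x : reducible x -> exists (P : 'I_6 -> S) (c : 'I_(size rels) -> S),
  (forall i, B (P i)) /\ x = \sum_(i < 6) P i * module_basis`_i +
    \sum_(k < size rels) c k * rels`_k.
Proof.
elim=> {x} [i|x y _ [P [c [BP ->]]] _ [P' [c' [BP' ->]]]|s x Bs _ [P [c [BP ->]]]|c k].
- exists (fun j => (j == i :> nat)%:R), (fun=> 0); split=> [j|]; first exact: Bn.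
  rewrite [X in _ + X]big1 ?addr0 => [|k _]; last by rewrite mul0r.
  have [i6|i6] := ltnP i 6.
    rewrite (bigD1 (Ordinal i6)) //= eqxx mul1r big1 ?addr0 // => j ji.
    by rewrite (_ : (j == i :> nat) = false) ?mul0r //; apply/negbTE.
  rewrite nth_default // big1 // => j _.
  by rewrite (ltn_eqF (leq_trans (ltn_ord j) i6)) mul0r.
- exists (fun i => P i + P' i), (fun k => c k + c' k); split=> [j|]; first exact: BD.
  rewrite addrACA -!big_split; congr (_ + _); apply: eq_bigr => i _; exact/esym/mulrDl.
- exists (fun i => s * P i), (fun k => s * c k); split=> [j|]; first exact: BM.
  by rewrite mulrDr !mulr_sumr; congr (_ + _); apply: eq_bigr => i _; rewrite mulrA.
exists (fun=> 0), (fun j => if j == k :> nat then c else 0); split=> [j|]; first exact: (Bn 0).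
rewrite big1 ?add0r => [|i _]; last by rewrite mul0r.
have [k6|k6] := ltnP k (size rels).
  rewrite (bigD1 (Ordinal k6)) //= eqxx big1 ?addr0 // => j jk.
  by rewrite ifN ?mul0r.
rewrite nth_default // mulr0 big1 // => j _.
by rewrite ifN ?mul0r // ltn_eqF // (leq_trans (ltn_ord j) k6).
Qed.

End Reduction.

(** Setting A = 0 is a ring morphism on the coefficients, hence commutes with evaluation; this
    carries vanishing questions to polynomials over the field. *)
Lemma meval_horner0 (K : fieldType) n (q : {mpoly {poly K}[n]}) (w : 'I_n -> {poly K}) :
  (q.@[w]).[0] = (map_mpoly (horner_eval (0 : K)) q).@[fun i => (w i).[0]].
Proof.
rewrite mevalE horner_sum /map_mpoly /mmap raddf_sum.
apply: eq_bigr => m _; rewrite /= mevalM mevalC hornerM horner_prod /mmap1 rmorph_prod.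
by congr (_ * _); apply: eq_bigr => i _; rewrite /= rmorphXn /= mevalXU horner_exp.
Qed.

Lemma map_relators (S T : comNzRingType) (h : {rmorphism S -> T}) A q r Q R e a1 a2 :
  map h (relators A q r Q R e a1 a2) =
  relators (h A) (h q) (h r) (h Q) (h R) (h e) (h a1) (h a2).
Proof.
by rewrite /relators /= !(rmorphD, rmorphN, rmorphM) !rmorph1.
Qed.

(** * The dihedral group and its action on regular points *)

Section DihedralAction.
Variables (K : fieldType) (zeta : K).
Hypothesis zeta_prim : 3.-primitive_root zeta.

Local Notation KA := {poly K}.
Local Notation W := (W zeta).
Local Notation s_ := (reflection zeta_prim).
Local Notation s0 := (s_ ord0).

Lemma zeta3 : zeta ^+ 3 = 1.
Proof. exact: prim_expr_order. Qed.

Lemma zeta_neq0 : zeta != 0.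
Proof. by apply/eqP => z0; have /eqP := zeta3; rewrite z0 expr0n /= eq_sym oner_eq0. Qed.

Lemma zetaV : zeta^-1 = zeta ^+ 2.
Proof. by apply: (mulfI zeta_neq0); rewrite divff ?zeta_neq0 // -exprS zeta3. Qed.

Lemma zeta_sum : zeta ^+ 2 = - zeta - 1.
Proof.
have z1 : zeta - 1 != 0.
  by rewrite subr_eq0 (eq_prim_root_expr zeta_prim 1 0).
apply/eqP; rewrite -subr_eq0; apply/eqP/(mulfI z1); rewrite mulr0.
by transitivity (zeta ^+ 3 - 1); [ring | rewrite zeta3 subrr].
Qed.

Lemma mx22P (A B : 'M[K]_2) : A 0 0 = B 0 0 -> A 0 1 = B 0 1 ->
  A 1 0 = B 1 0 -> A 1 1 = B 1 1 -> A = B.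
Proof.
have ord2 (i : 'I_2) : i = 0 \/ i = 1 by case: i => [[|[|//]] ?]; [left|right]; apply: val_inj.
by move=> *; apply/matrixP => i j; case: (ord2 i) => ->; case: (ord2 j) => ->.
Qed.

Lemma cV2P (a b : 'cV[K]_2) : a 0 0 = b 0 0 -> a 1 0 = b 1 0 -> a = b.
Proof.
by move=> *; apply/colP => -[[|[|//]] i2]; [have -> : Ordinal i2 = 0 by apply: val_inj
  |have -> : Ordinal i2 = 1 by apply: val_inj].
Qed.

Lemma rV2P (a b : 'rV[K]_2) : a 0 0 = b 0 0 -> a 0 1 = b 0 1 -> a = b.
Proof.
by move=> *; apply/rowP => -[[|[|//]] i2]; [have -> : Ordinal i2 = 0 by apply: val_inj
  |have -> : Ordinal i2 = 1 by apply: val_inj].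
Qed.

Lemma mulmx2E m n (A : 'M[K]_(m, 2)) (B : 'M[K]_(2, n)) i j :
  (A *m B) i j = A i 0 * B 0 j + A i 1 * B 1 j.
Proof.
by rewrite mxE big_ord_recl big_ord1; congr (_ * B _ _ + A _ _ * B _ _); apply: val_inj.
Qed.

Definition diag_elt (c : K) := mx22 c 0 0 c^-1.
Definition anti_elt (c : K) := mx22 0 c c^-1 0.

Lemma cube1_neq0 (c : K) : c ^+ 3 = 1 -> c != 0.
Proof.
by move=> c3; apply/eqP => c0; move/eqP: c3; rewrite c0 expr0n /= eq_sym oner_eq0.
Qed.

Lemma inW_shape w : in_W zeta w ->
  exists2 c, c ^+ 3 = 1 & w = diag_elt c \/ w = anti_elt c.
Proof.
(* An explicit right inverse: a rotation inverts c, and an antidiagonal element is an involution. It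
   identifies [invmx] in the case of [inW_inv]. *)
have unit_shape w' c : c ^+ 3 = 1 -> w' = diag_elt c \/ w' = anti_elt c ->
    w' *m (if w' == diag_elt c then diag_elt c^-1 else w') = 1%:M.
  move=> c3; have cn0 := cube1_neq0 c3; case: ifP => [/eqP-> _|/eqP wn [//|->]];
    by apply: mx22P; rewrite mulmx2E !mxE /= ?(mulr0,mul0r,addr0,add0r,invrK) ?mulfV ?mulVf.
elim=> {w} [|||u v _ [c c3 uE] _ [c' c3' vE]|u uW [c c3 uE]].
- exists 1; [by rewrite expr1n|right].
  by apply: mx22P; rewrite !mxE /= ?expr0 ?invr1.
- by exists zeta; [exact: zeta3|right]; apply: mx22P; rewrite !mxE /= ?expr1.
- exists 1; [by rewrite expr1n|left].
  by apply: mx22P; rewrite !mxE /= ?invr1.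
- have [cn0 cn0'] := (cube1_neq0 c3, cube1_neq0 c3').
  case: uE vE => -> [] ->.
  + exists (c * c'); first by rewrite exprMn c3 c3' mulr1.
    by left; apply: mx22P; rewrite mulmx2E !mxE /= ?(mulr0,mul0r,addr0,add0r) // invfM.
  + exists (c * c'); first by rewrite exprMn c3 c3' mulr1.
    by right; apply: mx22P; rewrite mulmx2E !mxE /= ?(mulr0,mul0r,addr0,add0r) // invfM.
  + exists (c / c'); first by rewrite expr_div_n c3 c3' divr1.
    by right; apply: mx22P; rewrite mulmx2E !mxE /= ?(mulr0,mul0r,addr0,add0r) // invfM invrK.
  + exists (c / c'); first by rewrite expr_div_n c3 c3' divr1.
    by left; apply: mx22P; rewrite mulmx2E !mxE /= ?(mulr0,mul0r,addr0,add0r) // invfM invrK.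
have uK := unit_shape u c c3 uE.
have invE : invmx u = if u == diag_elt c then diag_elt c^-1 else u.
  have [uu _] := mulmx1_unit uK.
  by rewrite -[LHS]mulmx1 -uK mulKmx.
rewrite invE; case: ifP => [_|/eqP uN].
  by exists c^-1; [rewrite exprVn c3 invr1|left].
by exists c.
Qed.

Lemma W_shape (w : W) :
  exists2 c, c ^+ 3 = 1 & W_val w = diag_elt c \/ W_val w = anti_elt c.
Proof. exact: (inW_shape (in_WP w)). Qed.

Lemma diag_eltV (c : K) : c != 0 -> diag_elt c \in unitmx /\ invmx (diag_elt c) = diag_elt c^-1.
Proof.
move=> c0; have e : diag_elt c *m diag_elt c^-1 = 1%:M.
  by apply: mx22P; rewrite mulmx2E !mxE /= ?(mulr0,mul0r,addr0,add0r,invrK) ?mulfV ?mulVf.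
by have [u _] := mulmx1_unit e; split; rewrite // -[LHS]mulmx1 -e mulKmx.
Qed.

Lemma anti_eltV (c : K) : c != 0 -> anti_elt c \in unitmx /\ invmx (anti_elt c) = anti_elt c.
Proof.
move=> c0; have e : anti_elt c *m anti_elt c = 1%:M.
  by apply: mx22P; rewrite mulmx2E !mxE /= ?(mulr0,mul0r,addr0,add0r,invrK) ?mulfV ?mulVf.
by have [u _] := mulmx1_unit e; split; rewrite // -[LHS]mulmx1 -e mulKmx.
Qed.

Lemma W_unit (w : W) : W_val w \in unitmx.
Proof.
have [c /cube1_neq0 c0 [->|->]] := W_shape w; first by case: (diag_eltV c0).
by case: (anti_eltV c0).
Qed.

(** The product of the three forms X - zeta^i Y, hence nonzero exactly off the reflection
    hyperplanes. *)
Definition disc (a : 'cV[K]_2) : K := a 0 0 ^+ 3 - a 1 0 ^+ 3.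

Lemma disc_act (w : W) a : disc a != 0 -> disc (invmx (W_val w) *m a) != 0.
Proof.
have [c c3 ] := W_shape w; have c0 := cube1_neq0 c3; rewrite /disc => -[->|->].
  have [_ ->] := diag_eltV c0; rewrite !mulmx2E !mxE /= !mul0r addr0 add0r invrK.
  by rewrite !exprMn exprVn c3 invr1 !mul1r.
have [_ ->] := anti_eltV c0; rewrite !mulmx2E !mxE /= !mul0r addr0 add0r.
by rewrite !exprMn exprVn c3 invr1 !mul1r -oppr_eq0 opprB.
Qed.

(* pt_V is a vector of V and pt_Vd a form on V; C[V] is evaluated at the former, C[V^*] at
   the latter. *)
Record point := Point { pt_V : 'cV[K]_2; pt_Vd : 'rV[K]_2; _ : disc pt_V != 0 }.

Lemma point_eq p q : pt_V p = pt_V q -> pt_Vd p = pt_Vd q -> p = q.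
Proof.
case: p q => a b h [a' b' h'] /= ea eb; case: _ / ea h' => h'; case: _ / eb.
by rewrite (bool_irrelevance h h').
Qed.

Lemma pt_disc p : disc (pt_V p) != 0.
Proof. by case: p. Qed.

(** A right action, so that [translate] is a left one; it preserves the pairing of the form with the
    vector. *)
Definition pt_act (p : point) (w : W) : point :=
  @Point (invmx (W_val w) *m pt_V p) (pt_Vd p *m W_val w)
    (disc_act w (pt_disc p)).

Lemma pt_act1 p : pt_act p (W_one zeta) = p.
Proof. by apply: point_eq; rewrite /= ?invmx1 ?mul1mx ?mulmx1. Qed.

Lemma pt_actM p (w w' : W) : pt_act p (W_mul w w') = pt_act (pt_act p w) w'.
Proof.
apply: point_eq; rewrite /= mulmxA //; congr (_ *m _).
have uw := W_unit w; have uw' := W_unit w'.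
have uww' : W_val w *m W_val w' \in unitmx by rewrite unitmx_mul uw uw'.
by apply: (can_inj (mulKmx uww')); rewrite mulmxV // -mulmxA mulKVmx // mulmxV.
Qed.

(** Two elements of the same shape are separated by a nonzero coordinate. If the shapes differ,
    cubing an equality of coordinates gives X^3 = Y^3, which regularity forbids. *)
Lemma pt_act_free p (w w' : W) :
  invmx (W_val w) *m pt_V p = invmx (W_val w') *m pt_V p -> w = w'.
Proof.
move=> e; apply: val_inj; move: e => /= e.
have e0 : (invmx (W_val w) *m pt_V p) 0 0 = (invmx (W_val w') *m pt_V p) 0 0 by rewrite e.
have e1 : (invmx (W_val w) *m pt_V p) 1 0 = (invmx (W_val w') *m pt_V p) 1 0 by rewrite e.
have := pt_disc p; move: e0 e1 {e}; rewrite /disc.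
move: (pt_V p) => a.
have [c c3] := W_shape w; have [c' c3'] := W_shape w'.
have [c0 c0'] := (cube1_neq0 c3, cube1_neq0 c3').
have [_ Dc] := diag_eltV c0; have [_ Dc'] := diag_eltV c0'.
have [_ Ac] := anti_eltV c0; have [_ Ac'] := anti_eltV c0'.
have same : (c^-1 * a 0 0 = c'^-1 * a 0 0 -> c * a 1 0 = c' * a 1 0 ->
    a 0 0 ^+ 3 - a 1 0 ^+ 3 != 0 -> c = c').
  have [->|a0 /(mulIf a0)/invr_inj//] := eqVneq (a 0 0) 0.
  have [->|a1 _ /(mulIf a1)//] := eqVneq (a 1 0) 0.
  by rewrite subrr eqxx.
have diff u v (b e : K) : u ^+ 3 = 1 -> v ^+ 3 = 1 -> u * b = v * e ->
    b ^+ 3 - e ^+ 3 != 0 -> False.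
  move=> u3 v3 /(congr1 (fun t => t ^+ 3)); rewrite !exprMn u3 v3 !mul1r => ->.
  by rewrite subrr eqxx.
have cV3 : c^-1 ^+ 3 = 1 by rewrite exprVn c3 invr1.
have cV3' : c'^-1 ^+ 3 = 1 by rewrite exprVn c3' invr1.
case=> ->; case=> ->; rewrite ?Dc ?Dc' ?Ac ?Ac' !mulmx2E !mxE /=;
  rewrite ?(mul0r, addr0, add0r, invrK) => e0 e1 d0.
- by rewrite (same e0 e1 d0).
- by case: (diff _ _ _ _ cV3' c3 (esym e0) d0).
- by case: (diff _ _ _ _ cV3 c3' e0 d0).
- by rewrite (same e1 e0 d0).
Qed.

Local Notation gens := ('I_2 + 'I_2 + W)%type.
Local Notation Fun := (point -> KA^o).
Local Notation pact := pt_act.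
Local Notation X_ p := (pt_V p 0 0).
Local Notation Y_ p := (pt_V p 1 0).
Local Notation x_ p := (pt_Vd p 0 0).
Local Notation y_ p := (pt_Vd p 0 1).

Definition rho : W := W_mul (s_ ord0) (s_ (inord 1)).

Lemma W_val_s i : W_val (s_ i) = anti_elt (zeta ^+ i).
Proof. by []. Qed.

Lemma W_val_rho : W_val rho = diag_elt zeta^-1.
Proof.
by apply: mx22P; rewrite mulmx2E !mxE /= ?inordK // ?(expr0, expr1, invr1, mul0r, mulr0,
  mul1r, addr0, add0r, invrK).
Qed.

Lemma pact_diag p (w : W) c : W_val w = diag_elt c -> c != 0 ->
  [/\ pt_V (pact p w) 0 0 = c^-1 * pt_V p 0 0, pt_V (pact p w) 1 0 = c * pt_V p 1 0,
      pt_Vd (pact p w) 0 0 = c * pt_Vd p 0 0 & pt_Vd (pact p w) 0 1 = c^-1 * pt_Vd p 0 1].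
Proof.
move=> wc c0; have [_ e] := diag_eltV c0.
split; rewrite /= wc ?e mulmx2E !mxE /= ?(mul0r, mulr0, addr0, add0r, invrK) //; exact: mulrC.
Qed.

Lemma pact_anti p (w : W) c : W_val w = anti_elt c -> c != 0 ->
  [/\ pt_V (pact p w) 0 0 = c * pt_V p 1 0, pt_V (pact p w) 1 0 = c^-1 * pt_V p 0 0,
      pt_Vd (pact p w) 0 0 = c^-1 * pt_Vd p 0 1 & pt_Vd (pact p w) 0 1 = c * pt_Vd p 0 0].
Proof.
move=> wc c0; have [_ e] := anti_eltV c0.
split; rewrite /= wc ?e mulmx2E !mxE /= ?(mul0r, mulr0, addr0, add0r, invrK) //; exact: mulrC.
Qed.

Lemma zetaX_neq0 i : zeta ^+ i != 0.
Proof. by rewrite expf_neq0 // zeta_neq0. Qed.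

Lemma pact_s0 p :
  [/\ pt_V (pact p s0) 0 0 = pt_V p 1 0, pt_V (pact p s0) 1 0 = pt_V p 0 0,
      pt_Vd (pact p s0) 0 0 = pt_Vd p 0 1 & pt_Vd (pact p s0) 0 1 = pt_Vd p 0 0].
Proof.
have [-> -> -> ->] := @pact_anti p s0 1 (W_val_s _) (oner_neq0 _).
by rewrite invr1 !mul1r.
Qed.

Lemma pact_rho p :
  [/\ pt_V (pact p rho) 0 0 = zeta * pt_V p 0 0,
      pt_V (pact p rho) 1 0 = zeta^-1 * pt_V p 1 0,
      pt_Vd (pact p rho) 0 0 = zeta^-1 * pt_Vd p 0 0 &
      pt_Vd (pact p rho) 0 1 = zeta * pt_Vd p 0 1].
Proof.
have zV0 : zeta^-1 != 0 by rewrite invr_eq0 zeta_neq0.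
by have [-> -> -> ->] := pact_diag p W_val_rho zV0; rewrite invrK.
Qed.

Lemma point_coordP (p q : point) : pt_V p 0 0 = pt_V q 0 0 -> pt_V p 1 0 = pt_V q 1 0 ->
  pt_Vd p 0 0 = pt_Vd q 0 0 -> pt_Vd p 0 1 = pt_Vd q 0 1 -> p = q.
Proof. by move=> *; apply: point_eq; [apply: cV2P | apply: rV2P]. Qed.

(** The reflections are the s_0 rho^i, so the values of an eigenfunction of rho at the three
    reflected points differ by powers of zeta. *)
Lemma pact_s p i : pact p (s_ i) = iter i (pact^~ rho) (pact p s0).
Proof.
have [E0 E1 E2 E3] := pact_anti p (W_val_s i) (zetaX_neq0 i).
have itE n (q : point) : [/\ pt_V (iter n (pact^~ rho) q) 0 0 = zeta ^+ n * pt_V q 0 0,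
      pt_V (iter n (pact^~ rho) q) 1 0 = zeta ^- n * pt_V q 1 0,
      pt_Vd (iter n (pact^~ rho) q) 0 0 = zeta ^- n * pt_Vd q 0 0 &
      pt_Vd (iter n (pact^~ rho) q) 0 1 = zeta ^+ n * pt_Vd q 0 1].
  elim: n => [|n [F0 F1 F2 F3]]; first by rewrite /= expr0 invr1 !mul1r.
  rewrite iterS; case: (pact_rho (iter n (pact^~ rho) q)) => -> -> -> ->.
  by rewrite F0 F1 F2 F3 !mulrA -!invfM -!exprS exprSr.
have [F0 F1 F2 F3] := itE i (pact p s0); have [G0 G1 G2 G3] := pact_s0 p.
by apply: point_coordP; rewrite ?E0 ?E1 ?E2 ?E3 ?F0 ?F1 ?F2 ?F3 ?G0 ?G1 ?G2 ?G3.
Qed.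

Lemma pact_rho3 p : pact (pact (pact p rho) rho) rho = p.
Proof.
have [A0 A1 A2 A3] := pact_rho p; have [B0 B1 B2 B3] := pact_rho (pact p rho).
have [C0 C1 C2 C3] := pact_rho (pact (pact p rho) rho).
have V3 : zeta^-1 * zeta^-1 * zeta^-1 = 1.
  by rewrite -expr2 -exprSr exprVn zeta3 ?invr1.
have Z3 : zeta * zeta * zeta = 1 by rewrite -expr2 -exprSr zeta3.
by apply: point_coordP; rewrite ?C0 ?C1 ?C2 ?C3 ?B0 ?B1 ?B2 ?B3 ?A0 ?A1 ?A2 ?A3
  !mulrA ?V3 ?Z3 mul1r.
Qed.

Lemma pact_rho_s0 p : pact (pact (pact p s0) rho) s0 = pact (pact p rho) rho.
Proof.
have [A0 A1 A2 A3] := pact_rho p; have [B0 B1 B2 B3] := pact_rho (pact p rho).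
have [C0 C1 C2 C3] := pact_s0 p; have [D0 D1 D2 D3] := pact_rho (pact p s0).
have [E0 E1 E2 E3] := pact_s0 (pact (pact p s0) rho).
have V : zeta^-1 = zeta * zeta by rewrite zetaV.
have V' : zeta^-1 * zeta^-1 = zeta by rewrite {1}V -mulrA mulfV ?zeta_neq0 ?mulr1.
by apply: point_coordP; rewrite ?E0 ?E1 ?E2 ?E3 ?B0 ?B1 ?B2 ?B3 ?A0 ?A1 ?A2 ?A3
  ?D0 ?D1 ?D2 ?D3 ?C0 ?C1 ?C2 ?C3 !mulrA ?V' -?V.
Qed.

(** Every element is rho^k or rho^k s_0, so no clause for inverses is needed. *)
Lemma W_ind (P : W -> Prop) : P (W_one zeta) -> P s0 -> P rho ->
  (forall u v, P u -> P v -> P (W_mul u v)) -> forall w, P w.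
Proof.
move=> P1 Ps Pr PM; pose rk k := iter k (W_mul rho) (W_one zeta).
have Prk k : P (rk k) by elim: k => //= k; apply: PM.
have rkE k : W_val (rk k) = diag_elt (zeta ^- k).
  elim: k => [|k IH].
    by apply: mx22P; rewrite /= !mxE //= expr0 ?invr1.
  rewrite -[W_val _]/(W_val rho *m W_val (rk k)) IH W_val_rho.
  by apply: mx22P; rewrite mulmx2E !mxE /= ?(mul0r, mulr0, addr0, add0r,
    invrK) // -?invfM -?exprS.
move=> w; have [c c3 wc] := W_shape w.
have /(prim_rootP zeta_prim)[k ck] : (c^-1) ^+ 3 = 1 by rewrite exprVn c3 invr1.
have cE : c = zeta ^- k by rewrite -ck invrK.
case: wc => wc.
  have -> // : w = rk k by apply: val_inj; rewrite /= wc rkE cE.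
have -> : w = W_mul (rk k) s0.
  apply: val_inj; rewrite /= wc rkE cE.
  by apply: mx22P; rewrite mulmx2E !mxE /= ?(mul0r, mulr0, addr0, add0r, invrK, expr0, invr1,
    mulr1).
exact: PM.
Qed.

(* The lock keeps conversion from unfolding iterated operators. *)
Definition Dunkl (u : 'cV[K]_2) (phi : Fun) : Fun := locked (fun p =>
  ((pt_Vd p *m u) 0 0)%:P * phi p +
  'X * \sum_(i < 3) (pairing u (root_form zeta i) / pairing (pt_V p) (root_form zeta i))%:P
                   * phi (pact p (s_ i))).

Definition coord_mul (U : 'rV[K]_2) (phi : Fun) : Fun := locked (fun p =>
  ((U *m pt_V p) 0 0)%:P * phi p).

Lemma Dunkl_funE u phi p : Dunkl u phi p = ((pt_Vd p *m u) 0 0)%:P * phi p +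
  'X * \sum_(i < 3) (pairing u (root_form zeta i) / pairing (pt_V p) (root_form zeta i))%:P
                   * phi (pact p (s_ i)) :> KA.
Proof. by rewrite /Dunkl -lock. Qed.

Lemma coord_mul_funE U phi p : coord_mul U phi p = ((U *m pt_V p) 0 0)%:P * phi p :> KA.
Proof. by rewrite /coord_mul -lock. Qed.

Definition translate (w : W) (phi : Fun) : Fun := fun p => phi (pact p w).

Definition gen_op (g : gens) : Fun -> Fun :=
  match g with
  | inl (inl j) => Dunkl (delta_mx j 0)
  | inl (inr j) => coord_mul (delta_mx 0 j)
  | inr w => translate w
  end.

Lemma Dunkl_linear u : linear (Dunkl u).
Proof.
move=> c phi psi; apply/funext => p.
rewrite -[RHS]/(c * Dunkl u phi p + Dunkl u psi p) !Dunkl_funE.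
rewrite (eq_bigr (fun i : 'I_3 =>
  c * ((pairing u (root_form zeta i) / pairing (pt_V p) (root_form zeta i))%:P
  * phi (pact p (s_ i))) + (pairing u (root_form zeta i) / pairing (pt_V p) (root_form zeta i))%:P
  * psi (pact p (s_ i)))) => [|i _].
  rewrite big_split -mulr_sumr -[(c *: phi + psi) p]/(c * phi p + psi p) /=.
  by move: (\sum_(i < 3) _) (\sum_(i < 3) _) (phi p : KA) (psi p : KA) => S1 S2 f g; ring.
rewrite -[(c *: phi + psi) _]/(c * phi (pact p (s_ i)) + psi (pact p (s_ i))).
by move: (phi _ : KA) (psi _ : KA) => f g; ring.
Qed.

Lemma gen_op_linear g : linear (gen_op g).
Proof.
case: g => [[j|j]|w]; first exact: Dunkl_linear.
  move=> c phi psi; apply/funext => p; rewrite -[RHS]/(c * coord_mul _ phi p + coord_mul _ psi p).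
  by rewrite /= !coord_mul_funE [_ * (_ + _) p]mulrDr mulrCA.
by move=> c phi psi; apply/funext.
Qed.

Definition act := act_free gen_op.

HB.instance Definition _ h := GRing.isLinear.Build KA Fun Fun *:%R (act h)
  (act_free_linear gen_op_linear h).

Lemma inv_cube_root (c X Y : K) : c ^+ 3 = 1 -> X ^+ 3 - Y ^+ 3 != 0 ->
  (X - c * Y)^-1 = (X ^+ 2 + c * X * Y + c ^+ 2 * Y ^+ 2) / (X ^+ 3 - Y ^+ 3).
Proof.
move=> c3 D0.
have e : (X - c * Y) * (X ^+ 2 + c * X * Y + c ^+ 2 * Y ^+ 2) = X ^+ 3 - Y ^+ 3.
  by transitivity (X ^+ 3 - c ^+ 3 * Y ^+ 3); [ring | rewrite c3 mul1r].
have n0 : X - c * Y != 0 by apply: contraNneq D0 => n0; rewrite -e n0 mul0r.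
by apply: (mulfI n0); rewrite mulfV // mulrA e mulfV.
Qed.

(** With 1/(X - cY) = (X^2 + cXY + c^2 Y^2)/(X^3 - Y^3), summing c^k/(X - cY) over the cube roots of
    unity c keeps the one monomial whose total power of c is divisible by 3. *)
Definition wt_poly (k : nat) (X Y : K) : K :=
  match k with 0 => X ^+ 2 | 1 => Y ^+ 2 | _ => X * Y end.

Lemma sum_inv_root k X Y : (k < 3)%N -> X ^+ 3 - Y ^+ 3 != 0 ->
  \sum_(i < 3) (zeta ^+ i) ^+ k / (X - zeta ^+ i * Y) =
  3%:R * wt_poly k X Y / (X ^+ 3 - Y ^+ 3).
Proof.
move=> k3 D0; have z3 := zeta3; have z2 := zeta_sum.
have c3 (i : 'I_3) : (zeta ^+ i) ^+ 3 = 1 by rewrite exprAC z3 expr1n.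
under eq_bigr => i _ do rewrite inv_cube_root // mulrA.
rewrite -mulr_suml; congr (_ / _).
rewrite !big_ord_recl big_ord0 /= /bump /= expr0 expr1.
have z4 : zeta ^+ 4 = zeta by rewrite exprS z3 mulr1.
case: k k3 => [|[|[|//]]] _ /=; rewrite -?exprM ?z4; ring: z2 z4.
Qed.

(* The eigenfunctions of the rotation: on them each Dunkl operator has only two terms, as the
   values at the three reflected points are proportional. *)
Definition has_weight (k : nat) (phi : Fun) :=
  forall p, phi (pact p rho) = (zeta ^+ k)%:P * phi p.

Lemma weight_s k phi p i : has_weight k phi ->
  phi (pact p (s_ i)) = ((zeta ^+ i) ^+ k)%:P * phi (pact p s0).
Proof.
move=> wk; rewrite pact_s; elim: (i : nat) => [|n IH] /=.
  by rewrite expr0 expr1n mul1r.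
by rewrite wk IH mulrA -polyCM -exprMn exprS.
Qed.

Lemma pairing_root (a : 'cV[K]_2) i : pairing a (root_form zeta i) = a 0 0 - zeta ^+ i * a 1 0.
Proof. by rewrite /pairing mulmx2E !mxE /= mul1r mulNr. Qed.

Lemma Dunkl_x k phi p : has_weight k phi -> (k < 3)%N ->
  Dunkl (delta_mx 0 0) phi p = (x_ p)%:P * phi p +
    'X * (3%:R * wt_poly k (X_ p) (Y_ p) / (X_ p ^+ 3 - Y_ p ^+ 3))%:P * phi (pact p s0).
Proof.
move=> wk k3; rewrite Dunkl_funE; congr (_%:P * _ + _).
  by rewrite mulmx2E !mxE /= mulr1 mulr0 addr0.
rewrite -mulrA; congr (_ * _); rewrite -sum_inv_root //; last exact: pt_disc.
rewrite rmorph_sum mulr_suml; apply: eq_bigr => i _.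
rewrite (weight_s _ _ wk) !pairing_root !mxE /= mulr0 subr0 mulrA -polyCM.
by congr (_%:P * _); rewrite mul1r mulrC.
Qed.

(** Since y pairs to -zeta^i with the i-th root, where x pairs to 1, the sign changes and the
    exponent k is shifted by one. *)
Lemma Dunkl_y k phi p : has_weight k phi -> (k < 3)%N ->
  Dunkl (delta_mx 1 0) phi p = (y_ p)%:P * phi p -
    'X * (3%:R * wt_poly (k.+1 %% 3) (X_ p) (Y_ p) / (X_ p ^+ 3 - Y_ p ^+ 3))%:P * phi (pact p
      s0).
Proof.
move=> wk k3; rewrite Dunkl_funE; congr (_%:P * _ + _).
  by rewrite mulmx2E !mxE /= mulr1 mulr0 add0r.
rewrite -mulrA -mulrN; congr (_ * _); rewrite -sum_inv_root ?ltn_mod //; last exact: pt_disc.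
rewrite rmorph_sum mulr_suml -sumrN; apply: eq_bigr => i _.
rewrite (weight_s _ _ wk) !pairing_root !mxE /= mulr1 sub0r mulrA -polyCM.
rewrite -[RHS]mulNr -rmorphN; congr (_%:P * _).
rewrite expr_mod; last by rewrite exprAC zeta3 ?expr1n.
by rewrite exprS; ring.
Qed.

End DihedralAction.

Arguments has_weight {K zeta} zeta_prim k%_N.

(** * PBW monomials *)

Section PbwLinear.
Variables (K : fieldType) (zeta : K).
Local Notation KA := {poly K}.
Local Notation W := (W zeta).
Variables (B : algType KA) (v f : 'I_2 -> B) (g : W -> B).
Local Notation pbw := (pbw v f g).
Local Notation pbw_monomial := (pbw_monomial v f g).

Definition pbw_row (w : W) (q : polVV K) : B :=
  \sum_(m <- msupp q) q@_m *: pbw_monomial w m.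

(** A common degree bound makes sums over different supports comparable, which is what linearity in
    [q] requires. *)
Lemma pbw_rowwE k w (q : polVV K) : (msize q <= k)%N ->
  pbw_row w q = \sum_(m : 'X_{1..(2 + 2) < k}) q@_m *: pbw_monomial w m.
Proof.
move=> lt_pk; pose I : subFinType _ := 'X_{1..(2 + 2) < k}.
rewrite /pbw_row (big_mksub I) //=; first last.
- by move=> x /msize_mdeg_lt /leq_trans; apply.
- by rewrite msupp_uniq.
by rewrite big_rmcond //= => i; move/memN_msupp_eq0 ->; rewrite scale0r.
Qed.

Lemma pbw_rowP w c (q q' : polVV K) :
  pbw_row w (c *: q + q') = c *: pbw_row w q + pbw_row w q'.
Proof.
pose k := maxn (msize (c *: q + q')) (maxn (msize q) (msize q')).
have [k1 k2 k3] : [/\ (msize (c *: q + q') <= k)%N, (msize q <= k)%N & (msize q' <= k)%N].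
  by rewrite /k !leq_max !leqnn !orbT.
rewrite (pbw_rowwE _ k1) (pbw_rowwE _ k2) (pbw_rowwE _ k3) scaler_sumr -big_split.
by apply: eq_bigr => m _; rewrite /= mcoeffD mcoeffZ scalerDl scalerA.
Qed.

Lemma pbw_row0 w : pbw_row w 0 = 0.
Proof. by rewrite /pbw_row msupp0 big_nil. Qed.

Lemma pbw_rowD w q q' : pbw_row w (q + q') = pbw_row w q + pbw_row w q'.
Proof. by have := pbw_rowP w 1 q q'; rewrite !scale1r. Qed.

Lemma pbw_rowZ w c q : pbw_row w (c *: q) = c *: pbw_row w q.
Proof. by have := pbw_rowP w c q 0; rewrite !addr0 pbw_row0 addr0. Qed.

Lemma pbw_rowX w m : pbw_row w 'X_[m] = pbw_monomial w m.
Proof. by rewrite /pbw_row msuppX big_seq1 mcoeffX eqxx scale1r. Qed.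

Lemma pbwEw d (p : pbw_domain zeta) : finmap.fsubset (monalg.msupp p) d ->
  pbw p = \sum_(w <- finmap.enum_fset d) pbw_row w (pbw_coef p w).
Proof.
move=> le; rewrite /Defs.pbw [LHS](finmap.big_fset_incl _ le) // => w _ /monalg.mcoeff_outdom e.
by rewrite -/(pbw_row w _) /pbw_coef e pbw_row0.
Qed.

Lemma pbwD p q : pbw (p + q) = pbw p + pbw q.
Proof.
pose d := finmap.fsetU (finmap.fsetU (monalg.msupp p) (monalg.msupp q)) (monalg.msupp (p + q)).
have dp : finmap.fsubset (monalg.msupp p) d.
  by apply/finmap.fsubsetP => w wp; rewrite /d !finmap.inE wp.
have dq : finmap.fsubset (monalg.msupp q) d.
  by apply/finmap.fsubsetP => w wp; rewrite /d !finmap.inE wp orbT.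
have dpq : finmap.fsubset (monalg.msupp (p + q)) d.
  by apply/finmap.fsubsetP => w wp; rewrite /d !finmap.inE wp !orbT.
rewrite (pbwEw dp) (pbwEw dq) (pbwEw dpq) -big_split; apply: eq_bigr => w _.
by rewrite /pbw_coef monalg.mcoeffD pbw_rowD.
Qed.

Lemma pbwU w q : pbw (monalg.mkmalgU w q) = pbw_row w q.
Proof.
by rewrite (pbwEw monalg.msuppU_le) finmap.big_seq_fset1 /pbw_coef monalg.mcoeffUU.
Qed.

Lemma pbw0 : pbw 0 = 0.
Proof. by rewrite -(monalg.monalgU0 (W_one zeta)) pbwU pbw_row0. Qed.

Lemma pbwN p : pbw (- p) = - pbw p.
Proof. by apply/eqP; rewrite -subr_eq0 opprK -pbwD addNr pbw0. Qed.

Lemma pbwB p q : pbw (p - q) = pbw p - pbw q.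
Proof. by rewrite pbwD pbwN. Qed.

Lemma pbw_sum (J : Type) (r : seq J) (P : pred J) (F : J -> pbw_domain zeta) :
  pbw (\sum_(j <- r | P j) F j) = \sum_(j <- r | P j) pbw (F j).
Proof. exact: (big_morph _ pbwD pbw0). Qed.

End PbwLinear.

Definition mono (K : fieldType) (a b c e : nat) : polVV K :=
  pX K ^+ a * pY K ^+ b * (px K ^+ c * py K ^+ e).

Lemma pbw_row_mono (K : fieldType) (zeta : K) (B : algType {poly K})
    (v f : 'I_2 -> B) (g : W zeta -> B) w a b c e :
  pbw_row v f g w (mono K a b c e) =
  (f 0 ^+ a * f 1 ^+ b) * g w * (v 0 ^+ c * v 1 ^+ e).
Proof.
pose m : 'X_{1..2 + 2} := [multinom [tuple a; b; c; e]].
have -> : mono K a b c e = 'X_[m].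
  rewrite [RHS](mpolyXE_id (n := 2 + 2)) big_split_ord !prod_ord2 !multinomE !(tnth_nth 0%N) /=.
  by rewrite /mono.
by rewrite pbw_rowX /pbw_monomial !prod_ord2 !multinomE !(tnth_nth 0%N).
Qed.

Lemma mcoeff_sumU (T : choiceType) (G : zmodType) (s : seq T) (F : T -> G) t :
  uniq s -> monalg.mcoeff t (\sum_(t' <- s) monalg.mkmalgU t' (F t')) =
            if t \in s then F t else 0.
Proof.
move=> us; rewrite raddf_sum /=; case: ifP => ts.
  rewrite (bigD1_seq t) //= monalg.mcoeffUU big1 ?addr0 // => t' /negbTE ne.
  by rewrite monalg.mcoeffU ne.
rewrite big_seq big1 // => t' t's; rewrite monalg.mcoeffU.
by case: eqP => // e; rewrite -e t's in ts.
Qed.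

(** * Scaling the coefficients and dividing them by A *)

Section CoefficientMap.
Variables (K : fieldType) (zeta : K).
Local Notation KA := {poly K}.
Local Notation W := (W zeta).

(** [h] need not be a ring morphism: it is used for multiplication by a scalar and for
    [drop_poly 1], which removes the constant term and divides by A. *)
Definition mpoly_coef_map n (h : KA -> KA) (q : {mpoly KA[n]}) : {mpoly KA[n]} :=
  \sum_(m <- msupp q) h q@_m *: 'X_[m].

Lemma mcoeff_coef_map n h (q : {mpoly KA[n]}) m : h 0 = 0 ->
  (mpoly_coef_map h q)@_m = h q@_m.
Proof.
move=> h0; rewrite /mpoly_coef_map raddf_sum /=.
have [ms|/memN_msupp_eq0 e] := boolP (m \in msupp q).
  rewrite (bigD1_seq m) ?msupp_uniq //= mcoeffZ mcoeffX eqxx mulr1 big1 ?addr0 // =>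
    m' /negbTE ne.
  by rewrite mcoeffZ mcoeffX ne mulr0.
rewrite e h0 big1_seq // => m' /andP[_ m's]; rewrite mcoeffZ mcoeffX.
by case: eqP => [mm|]; rewrite ?mulr0 // mm (memN_msupp_eq0) ?h0 ?mul0r //; move: m's e;
  rewrite mm mcoeff_msupp => /eqP.
Qed.

Definition pbw_coef_map (h : KA -> KA) (p : pbw_domain zeta) : pbw_domain zeta :=
  \sum_(w <- finmap.enum_fset (monalg.msupp p)) monalg.mkmalgU w (mpoly_coef_map h (pbw_coef p
    w)).

Lemma pbw_coef_mapE h p w m : h 0 = 0 ->
  (pbw_coef (pbw_coef_map h p) w)@_m = h (pbw_coef p w)@_m.
Proof.
move=> h0; rewrite /pbw_coef mcoeff_sumU ?finmap.fset_uniq //; case: ifP => [_|/negbT].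
  exact: mcoeff_coef_map.
by move/monalg.mcoeff_outdom => ->; rewrite !mcoeff0 h0.
Qed.

Lemma pbw_eqP (p q : pbw_domain zeta) :
  (forall w m, (pbw_coef p w)@_m = (pbw_coef q w)@_m) -> p = q.
Proof. by move=> e; apply/monalg.malgP => w; apply/mpolyP => m; apply: e. Qed.

Lemma pbw_coef_scale (B : algType KA) (v f : 'I_2 -> B) (g : W -> B) c p :
  pbw v f g (pbw_coef_map ( *%R c) p) = c *: pbw v f g p.
Proof.
rewrite [in RHS](pbwEw _ _ _ (finmap.fsubset_refl _)) pbw_sum scaler_sumr.
apply: eq_bigr => w _; rewrite pbwU -pbw_rowZ; congr pbw_row.
by apply/mpolyP => m; rewrite mcoeff_coef_map ?mulr0 // mcoeffZ.
Qed.

Lemma drop_polyX (c : KA) : c`_0 = 0 -> 'X * drop_poly 1 c = c.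
Proof.
by move=> c0; apply/polyP => -[|i]; rewrite coefXM //= coef_drop_poly addn1.
Qed.

Lemma pbw_divX (B : algType KA) (v f : 'I_2 -> B) (g : W -> B) p :
  (forall w m, ((pbw_coef p w)@_m)`_0 = 0) ->
  'X *: pbw v f g (pbw_coef_map (drop_poly 1) p) = pbw v f g p.
Proof.
have d0 : drop_poly 1 (0 : KA) = 0 by rewrite raddf0.
move=> p0; rewrite -pbw_coef_scale; congr pbw; apply: pbw_eqP => w m.
by rewrite pbw_coef_mapE ?mulr0 // pbw_coef_mapE // drop_polyX.
Qed.

End CoefficientMap.

(** * PBW monomials span *)

Section Spanning.
Variables (K : fieldType) (zeta : K).
Hypothesis zeta_prim : 3.-primitive_root zeta.
Local Notation KA := {poly K}.
Local Notation W := (W zeta).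
Local Notation s_ := (reflection zeta_prim).
Variables (B : algType KA) (v f : 'I_2 -> B) (g : W -> B).
Hypothesis rel0 : forall b, cherednik_rel zeta_prim v f g b -> b = 0.

Lemma rel_eq a b : cherednik_rel zeta_prim v f g (a - b) -> a = b.
Proof. by move/rel0/eqP; rewrite subr_eq0 => /eqP. Qed.

Lemma lin_vec_delta (t : 'I_2 -> B) j : lin_vec t (delta_mx j 0) = t j.
Proof.
rewrite /lin_vec (bigD1 j) //= big1 ?addr0 => [|i ij]; rewrite !mxE ?eqxx ?scale1r //.
by rewrite (negbTE ij) scale0r.
Qed.

Lemma lin_form_delta (t : 'I_2 -> B) j : lin_form t (delta_mx 0 j) = t j.
Proof.
rewrite /lin_form (bigD1 j) //= big1 ?addr0 => [|i ij]; rewrite !mxE ?eqxx ?scale1r //.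
by rewrite (negbTE ij) scale0r.
Qed.

Lemma rel_1 : g (W_one zeta) = 1. Proof. exact/rel_eq/Rel_one. Qed.
Lemma rel_M w w' : g w * g w' = g (W_mul w w'). Proof. exact/rel_eq/Rel_mul. Qed.
Lemma rel_gv w u : g w * lin_vec v u = lin_vec v (W_val w *m u) * g w.
Proof. exact/rel_eq/Rel_V. Qed.
Lemma rel_gf w U : g w * lin_form f U = lin_form f (U *m invmx (W_val w)) * g w.
Proof. exact/rel_eq/Rel_Vdual. Qed.
Lemma rel_vv i j : v i * v j = v j * v i.
Proof. by have := rel_eq (Rel_VV zeta_prim v f g (delta_mx i 0) (delta_mx j 0));
  rewrite !lin_vec_delta. Qed.
Lemma rel_ff i j : f i * f j = f j * f i.
Proof. by have := rel_eq (Rel_VdualVdual zeta_prim v f g (delta_mx 0 i) (delta_mx 0 j));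
  rewrite !lin_form_delta. Qed.
Lemma rel_vf i j : exists c : 'I_3 -> KA, v i * f j = f j * v i + \sum_(k < 3) c k *: g (s_ k).
Proof.
have := rel_eq (Rel_VVdual zeta_prim v f g (delta_mx i 0) (delta_mx 0 j)).
rewrite lin_vec_delta lin_form_delta scaler_sumr => /eqP; rewrite subr_eq addrC => /eqP->.
eexists; congr (_ + _); apply: eq_bigr => k _; rewrite scalerA; reflexivity.
Qed.

(** Letters are adjoined on the left only, so an induction that moves an element across from the
    left meets one letter at a time. *)
Inductive poly_in (t : 'I_2 -> B) : B -> Prop :=
| Poly_in1 : poly_in t 1
| Poly_inZ c b : poly_in t b -> poly_in t (c *: b)
| Poly_inD a b : poly_in t a -> poly_in t b -> poly_in t (a + b)
| Poly_inM j b : poly_in t b -> poly_in t (t j * b).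

Lemma poly_in0 t : poly_in t 0.
Proof. by rewrite -(scale0r 1); apply/Poly_inZ/Poly_in1. Qed.

Lemma poly_in_sum t (J : Type) (r : seq J) (F : J -> B) :
  (forall j, poly_in t (F j)) -> poly_in t (\sum_(j <- r) F j).
Proof.
move=> pF; elim/big_ind: _ => //; [exact: poly_in0|exact: Poly_inD].
Qed.

Lemma poly_in_vec t u b : poly_in t b -> poly_in t (lin_vec t u * b).
Proof.
move=> tb; rewrite /lin_vec mulr_suml; apply: poly_in_sum => j.
by rewrite -scalerAl; apply/Poly_inZ/Poly_inM.
Qed.

Lemma poly_in_form t U b : poly_in t b -> poly_in t (lin_form t U * b).
Proof.
move=> tb; rewrite /lin_form mulr_suml; apply: poly_in_sum => j.
by rewrite -scalerAl; apply/Poly_inZ/Poly_inM.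
Qed.

Lemma g_poly_f F w : poly_in f F -> exists2 F', poly_in f F' & g w * F = F' * g w.
Proof.
elim=> {F} [|c b _ [b' fb' e]|a b _ [a' fa' ea] _ [b' fb' eb]|j b _ [b' fb' e]].
- by exists 1; [constructor|rewrite mul1r mulr1].
- by exists (c *: b'); [constructor|rewrite -scalerAr e scalerAl].
- by exists (a' + b'); [constructor|rewrite mulrDr mulrDl ea eb].
exists (lin_form f (delta_mx 0 j *m invmx (W_val w)) * b'); first exact: poly_in_form.
by rewrite mulrA -(lin_form_delta f) rel_gf -!mulrA e.
Qed.

(** Crossing one letter creates multiples of the reflections s_k in front of the remaining factor;
    [g_poly_f] moves each s_k to the right of it, which restores the order polynomial, group
    element. *)
Lemma v_poly_f F j : poly_in f F -> exists2 F' : 'I_3 -> B,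
  forall k, poly_in f (F' k) & v j * F = F * v j + \sum_(k < 3) F' k * g (s_ k).
Proof.
elim=> {F} [|c b _ [b' fb' e]|a b _ [a' fa' ea] _ [b' fb' eb]|i b fb [b' fb' e]].
- exists (fun=> 0) => [k|]; first exact: poly_in0.
  by rewrite big1 ?addr0 ?mul1r ?mulr1 // => k _; rewrite mul0r.
- exists (fun k => c *: b' k) => [k|]; first exact: Poly_inZ.
  rewrite -scalerAr e scalerDr scalerAl scaler_sumr; congr (_ + _).
  by apply: eq_bigr => k _; rewrite scalerAl.
- exists (fun k => a' k + b' k) => [k|]; first exact: Poly_inD.
  rewrite mulrDr ea eb mulrDl addrACA -big_split; congr (_ + _).
  by apply: eq_bigr => k _; rewrite /= mulrDl.
have [c vf] := rel_vf j i.
have [b'' fb'' eb''] := all_sig2 (fun k => cid2 (g_poly_f (s_ k) fb)).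
exists (fun k => f i * b' k + c k *: b'' k) => [k|].
  by apply: Poly_inD; [exact: Poly_inM|exact: Poly_inZ].
rewrite mulrA vf mulrDl -mulrA e mulrDr mulrA -addrA; congr (_ + _).
rewrite mulr_suml mulr_sumr -big_split; apply: eq_bigr => k _ /=.
by rewrite mulrDl mulrA -!scalerAl eb''.
Qed.

(** A set that contains 1 and is stable under left multiplication by every generator is everything,
    so only products on the left have to be straightened. *)
Inductive normal_form : B -> Prop :=
| Nf0 : normal_form 0
| NfD a b : normal_form a -> normal_form b -> normal_form (a + b)
| NfM F w G : poly_in f F -> poly_in v G -> normal_form (F * g w * G).

Lemma nf_sum (J : Type) (r : seq J) (F : J -> B) :
  (forall j, normal_form (F j)) -> normal_form (\sum_(j <- r) F j).
Proof. by move=> pF; elim/big_ind: _ => //; [exact: Nf0|exact: NfD]. Qed.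

Lemma nfZ c b : normal_form b -> normal_form (c *: b).
Proof.
elim=> {b} [|a b _ IHa _ IHb|F w G fF vG]; first by rewrite scaler0; constructor.
  by rewrite scalerDr; constructor.
by rewrite !scalerAl; constructor=> //; constructor.
Qed.

Lemma nf_f j b : normal_form b -> normal_form (f j * b).
Proof.
elim=> {b} [|a b _ IHa _ IHb|F w G fF vG]; first by rewrite mulr0; constructor.
  by rewrite mulrDr; constructor.
by rewrite !mulrA; constructor=> //; constructor.
Qed.

Lemma nf_g w b : normal_form b -> normal_form (g w * b).
Proof.
elim=> {b} [|a b _ IHa _ IHb|F w' G fF vG]; first by rewrite mulr0; constructor.
  by rewrite mulrDr; constructor.
have [F' fF' e] := g_poly_f w fF.
by rewrite !mulrA e -(mulrA F') rel_M; constructor.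
Qed.

Lemma nf_v j b : normal_form b -> normal_form (v j * b).
Proof.
elim=> {b} [|a b _ IHa _ IHb|F w G fF vG]; first by rewrite mulr0; constructor.
  by rewrite mulrDr; constructor.
have [F' fF' e] := v_poly_f j fF.
rewrite !mulrA e mulrDl mulrDl; constructor; last first.
  rewrite !mulr_suml; apply: nf_sum => k.
  by rewrite -(mulrA (F' k)) rel_M; constructor.
(* The letter of V passes the group element on its left as the vector w^-1 v, and then joins G. *)
have [u vE] : exists u, v j * g w = g w * lin_vec v u.
  exists (invmx (W_val w) *m delta_mx j 0); rewrite rel_gv.
  by rewrite mulKVmx ?(W_unit zeta_prim) // lin_vec_delta.
by rewrite -(mulrA F) vE mulrA -(mulrA (F * g w)); constructor=> //; apply: poly_in_vec.
Qed.

Lemma nf1 : normal_form 1.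
Proof.
suff: normal_form (1 * g (W_one zeta) * 1) by rewrite rel_1 !mulr1.
by constructor; constructor.
Qed.

Inductive mono_span (t : 'I_2 -> B) : B -> Prop :=
| Mono_span1 a b : mono_span t (t 0 ^+ a * t 1 ^+ b)
| Mono_spanZ c b : mono_span t b -> mono_span t (c *: b)
| Mono_spanD a b : mono_span t a -> mono_span t b -> mono_span t (a + b).

Lemma poly_in_mono (t : 'I_2 -> B) F : t 0 * t 1 = t 1 * t 0 ->
  poly_in t F -> mono_span t F.
Proof.
move=> tC; elim=> {F} [|c b _|a b _ IHa _ IHb|j b _].
- by have := Mono_span1 t 0 0; rewrite !expr0 mulr1.
- exact: Mono_spanZ.
- exact: Mono_spanD.
elim=> {b} [a b|c b _|a b _ IHa _]; last 1 first.
- by rewrite mulrDr; apply: Mono_spanD.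
- have [->|->] : j = 0 \/ j = 1.
    by case: j => [[|[|//]] ?]; [left|right]; apply: val_inj.
    by rewrite mulrA -exprS; constructor.
  have cX : t 1 * t 0 ^+ a = t 0 ^+ a * t 1 by apply: commrX.
  by rewrite mulrA cX -mulrA -exprS; constructor.
by rewrite -scalerAr; apply: Mono_spanZ.
Qed.

Local Notation pbw := (pbw v f g).

Lemma nf_pbw b : normal_form b -> exists p, pbw p = b.
Proof.
elim=> {b} [|a b _ [p <-] _ [q <-]|F w G fF vG]; first by exists 0; rewrite pbw0.
  by exists (p + q); rewrite pbwD.
elim: (poly_in_mono (rel_ff 0 1) fF) => {F fF} [i j|c F _ [p e]|F F' _ [p e] _ [p' e']];
  last 2 first.
- by exists (pbw_coef_map ( *%R c) p); rewrite pbw_coef_scale e !scalerAl.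
- by exists (p + p'); rewrite pbwD !mulrDl e e'.
elim: (poly_in_mono (rel_vv 0 1) vG) => {G vG} [k l|c G _ [p e]|G G' _ [p e] _ [p' e']];
  last 2 first.
- by exists (pbw_coef_map ( *%R c) p); rewrite pbw_coef_scale e scalerAr.
- by exists (p + p'); rewrite pbwD mulrDr e e'.
exists (monalg.mkmalgU w 'X_[[multinom [tuple i; j; k; l]]]).
rewrite pbwU pbw_rowX /pbw_monomial !big_ord_recl !big_ord0 !mulr1.
rewrite !multinomE !(tnth_nth 0%N) /=.
by have -> : lift ord0 ord0 = 1 :> 'I_2 by apply: val_inj.
Qed.

End Spanning.

Lemma pt_disc_eval (K : numClosedFieldType) (p : point K) :
  pt_V p 0 0 ^+ 3 - pt_V p 1 0 ^+ 3 != 0 :> K.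
Proof. exact: pt_disc. Qed.

(** Rewrites the coordinates of p.s_0 as those of p, then generalizes the four coordinates and the
    two values of the function, leaving a rational identity whose only denominator is X^3 - Y^3. *)
Ltac pt_field zeta_prim p phi a :=
  let eX := fresh in let eY := fresh in let ex := fresh in let ey := fresh in
  have [eX eY ex ey] := pact_s0 zeta_prim p; rewrite ?eX ?eY ?ex ?ey {eX eY ex ey};
  have := pt_disc_eval p;
  move: (pt_V p 0 0) (pt_V p 1 0) (pt_Vd p 0 0) (pt_Vd p 0 1)
    (horner (phi p) a) (horner (phi (pt_act zeta_prim p (reflection zeta_prim ord0))) a)
    => ? ? ? ? ? ? ?;
  rewrite /wt_poly /=; field; assumption.

(** * The action of the Cherednik algebra and its centre *)

Section CherednikCentre.
Variables (K : numClosedFieldType) (zeta : K).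
Hypothesis zeta_prim : 3.-primitive_root zeta.
Local Notation KA := {poly K}.
Local Notation W := (W zeta).
Local Notation s_ := (reflection zeta_prim).
Local Notation s0 := (s_ ord0).
Local Notation rho := (rho zeta_prim).
Local Notation point := (point K).
Local Notation Fun := (point -> KA^o).
Local Notation pact := (@pt_act K zeta zeta_prim).
Local Notation Dunkl := (Dunkl zeta_prim).
Local Notation coord_mul := (@coord_mul K).
Local Notation translate := (translate zeta_prim).
Local Notation X_ p := (pt_V p 0 0).
Local Notation Y_ p := (pt_V p 1 0).
Local Notation x_ p := (pt_Vd p 0 0).
Local Notation y_ p := (pt_Vd p 0 1).
Local Notation Dx := (Dunkl (delta_mx 0 0)).
Local Notation Dy := (Dunkl (delta_mx 1 0)).
Local Notation has_weight := (has_weight zeta_prim).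
Local Notation cX := (coord_mul (delta_mx 0 0)).
Local Notation cY := (coord_mul (delta_mx 0 1)).
Local Notation act := (act zeta_prim).
Local Notation gens := ('I_2 + 'I_2 + W)%type.
Local Notation Free := (free_alg KA gens).
Local Notation rel := (cherednik_rel zeta_prim (free_v zeta) (free_f zeta) (@free_g K zeta)).
Local Notation H := (cherednik zeta_prim).
Local Notation Z := (centre H).
Local Notation vH := (@vH K zeta zeta_prim).
Local Notation fH := (@fH K zeta zeta_prim).
Local Notation gH := (@gH K zeta zeta_prim).
Local Notation iota := (@of_free K zeta zeta_prim).
Local Notation pbw := (pbw vH fH gH).
Local Notation pbw_row := (pbw_row vH fH gH).

HB.instance Definition _ u := GRing.isLinear.Build KA Fun Fun *:%R (Dunkl u)
  (Dunkl_linear zeta_prim u).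

Lemma coord_mul_linear U : linear (coord_mul U).
Proof.
move=> c phi psi; apply/funext => p; rewrite -[RHS]/(c * coord_mul _ phi p + coord_mul _ psi p).
by rewrite !coord_mul_funE [_ * (_ + _) p]mulrDr mulrCA.
Qed.
HB.instance Definition _ U := GRing.isLinear.Build KA Fun Fun *:%R (coord_mul U)
  (coord_mul_linear U).

Lemma translate_linear w : linear (translate w).
Proof. by []. Qed.
HB.instance Definition _ w := GRing.isLinear.Build KA Fun Fun *:%R (translate w)
  (translate_linear w).

Definition fun_mul (l : point -> KA) (phi : Fun) : Fun := fun p => l p * phi p.

Lemma fun_mul_linear l : linear (fun_mul l).
Proof.
move=> c phi psi; apply/funext => p; rewrite -[RHS]/(c * fun_mul l phi p + fun_mul l psi p).
by rewrite /fun_mul [_ * (_ + _) p]mulrDr mulrCA.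
Qed.
HB.instance Definition _ l := GRing.isLinear.Build KA Fun Fun *:%R (fun_mul l)
  (fun_mul_linear l).

Lemma DunklD u : {morph Dunkl u : f g / f + g}. Proof. exact: raddfD. Qed.
Lemma DunklZ u c f : Dunkl u (c *: f) = c *: Dunkl u f. Proof. exact: linearZ. Qed.
Lemma coord_mulD U : {morph coord_mul U : f g / f + g}. Proof. exact: raddfD. Qed.
Lemma fun_mulD l : {morph fun_mul l : f g / f + g}. Proof. exact: raddfD. Qed.
Lemma translateD w : {morph translate w : f g / f + g}. Proof. by []. Qed.
Definition opD := (DunklD, coord_mulD, fun_mulD, translateD).

Lemma weight_decomp (phi : Fun) : exists phi0 phi1 phi2 : Fun,
  [/\ has_weight 0%N phi0, has_weight 1%N phi1, has_weight 2%N phi2 &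
      phi = phi0 + phi1 + phi2].
Proof.
pose wproj k : Fun := fun p => (3%:R^-1)%:P *
  (phi p + (zeta ^+ k)%:P * phi (pact p rho)
   + (zeta ^+ k ^+ 2)%:P * phi (pact (pact p rho) rho)).
have z3 := zeta3 zeta_prim; have z2 := zeta_sum zeta_prim.
(* [wproj k] has weight -k modulo 3, hence the exchange of 1 and 2. *)
exists (wproj 0%N), (wproj 2%N), (wproj 1%N); split.
- move=> p; apply: poly_eval_inj => a; rewrite /wproj !hornE pact_rho3.
  by move: (horner _ a) (horner _ a) (horner _ a) => f0 f1 f2; ring: z3.
- move=> p; apply: poly_eval_inj => a; rewrite /wproj !hornE pact_rho3.
  by move: (horner _ a) (horner _ a) (horner _ a) => f0 f1 f2; ring: z3.
- move=> p; apply: poly_eval_inj => a; rewrite /wproj !hornE pact_rho3.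
  by move: (horner _ a) (horner _ a) (horner _ a) => f0 f1 f2; ring: z3.
apply/funext => p; rewrite -[RHS]/(wproj 0%N p + wproj 2%N p + wproj 1%N p : KA).
apply: poly_eval_inj => a; rewrite /wproj !hornE.
have n3 : (3%:R : K) != 0 by rewrite pnatr_eq0.
move: (horner _ a) (horner _ a) (horner _ a) => f0 f1 f2.
by apply: (mulfI n3); rewrite !(mulrDr 3%:R) !(mulVKf n3); ring: z2.
Qed.

(** The three eigenspaces of the rotation span, so additive operators may be compared on
    eigenfunctions, where each Dunkl operator has two terms. *)
Lemma weight_ext (S T : Fun -> Fun) :
  {morph S : f g / f + g} -> {morph T : f g / f + g} ->
  (forall k phi, (k < 3)%N -> has_weight k phi -> S phi = T phi) -> S =1 T.
Proof.
move=> SD TD ST phi; have [phi0 [phi1 [phi2 [w0 w1 w2 ->]]]] := weight_decomp phi.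
by rewrite !SD !TD (ST 0%N phi0) // (ST 1%N phi1) // (ST 2%N phi2).
Qed.

Lemma pact_s0K p : pact (pact p s0) s0 = p.
Proof.
have [A0 A1 A2 A3] := pact_s0 zeta_prim p.
have [B0 B1 B2 B3] := pact_s0 zeta_prim (pact p s0).
by apply: point_coordP; rewrite ?B0 ?B1 ?B2 ?B3.
Qed.

(** Conjugation by s_0 inverts the rotation, so the weight k becomes -k, which is 2k modulo 3. *)
Lemma weight_translate_s0 k phi : has_weight k phi ->
  has_weight (2 * k %% 3) (translate s0 phi).
Proof.
move=> wk p; rewrite /translate; set q := pact (pact p rho) s0.
have <- : pact q rho = pact p s0.
  by rewrite -[in RHS](pact_rho3 zeta_prim p) -(pact_rho_s0 zeta_prim (pact p rho)) pact_s0K.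
rewrite wk mulrA -polyCM -[LHS]mul1r; congr (_%:P * _).
rewrite expr_mod ?(zeta3 zeta_prim) // -exprD -[X in (_ + X)%N]mul1n -mulnDl.
by rewrite exprM (zeta3 zeta_prim) expr1n.
Qed.

(** The coordinate x is multiplied by zeta^-1 under the rotation, so the weight drops by one; adding
    2 keeps it a natural number. The operator for y raises it by one. *)
Lemma weight_Dx k phi : has_weight k phi -> (k < 3)%N ->
  has_weight ((k + 2) %% 3) (Dx phi).
Proof.
move=> wk k3 p; have [eX eY ex ey] := pact_rho zeta_prim p.
have z3 := zeta3 zeta_prim; have D0 := pt_disc p; rewrite /disc in D0.
apply: poly_eval_inj => a; rewrite !(Dunkl_x _ wk k3) !hornE.
have := weight_translate_s0 wk p; rewrite /translate => ->.
rewrite wk !hornE eX eY ex !exprMn z3 (_ : zeta^-1 ^+ 3 =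
  1) ?exprVn ?z3 ?invr1 // !mul1r (zetaV zeta_prim).
move: (horner _ a) (horner _ a) => f g; move: (_ - _)^-1 => d.
by case: k k3 wk => [|[|[|//]]] _ _; rewrite /wt_poly /=; ring: z3.
Qed.

Lemma weight_Dy k phi : has_weight k phi -> (k < 3)%N ->
  has_weight (k.+1 %% 3) (Dy phi).
Proof.
move=> wk k3 p; have [eX eY ex ey] := pact_rho zeta_prim p.
have z3 := zeta3 zeta_prim; have D0 := pt_disc p; rewrite /disc in D0.
apply: poly_eval_inj => a; rewrite !(Dunkl_y _ wk k3) !hornE.
have := weight_translate_s0 wk p; rewrite /translate => ->.
rewrite wk !hornE eX eY ey !exprMn z3 (_ : zeta^-1 ^+ 3 =
  1) ?exprVn ?z3 ?invr1 // !mul1r (zetaV zeta_prim).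
move: (horner _ a) (horner _ a) => f g; move: (_ - _)^-1 => d.
by case: k k3 wk => [|[|[|//]]] _ _; rewrite /wt_poly /=; ring: z3.
Qed.

(** * Operators that act by multiplication *)

Lemma Dx_eval k phi p a : has_weight k phi -> (k < 3)%N ->
  (Dx phi p : KA).[a] = x_ p * (phi p : KA).[a] +
    a * (3%:R * wt_poly k (X_ p) (Y_ p) / (X_ p ^+ 3 - Y_ p ^+ 3)) * (phi (pact p s0) : KA).[a].
Proof. by move=> wk k3; rewrite (Dunkl_x _ wk k3) !hornE. Qed.

Lemma Dy_eval k phi p a : has_weight k phi -> (k < 3)%N ->
  (Dy phi p : KA).[a] = y_ p * (phi p : KA).[a] -
    a * (3%:R * wt_poly (k.+1 %% 3) (X_ p) (Y_ p) / (X_ p ^+ 3 - Y_ p ^+ 3))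
    * (phi (pact p s0) : KA).[a].
Proof. by move=> wk k3; rewrite (Dunkl_y _ wk k3) !hornE. Qed.

Lemma disc_s0 p : X_ (pact p s0) ^+ 3 - Y_ (pact p s0) ^+ 3 = - (X_ p ^+ 3 - Y_ p ^+ 3).
Proof. by have [-> -> _ _] := pact_s0 zeta_prim p; rewrite opprB. Qed.

(* lam_q, lam_r, ... are the functions by which q, r, ... act. *)
Definition lam_q (p : point) : KA :=
  (x_ p * y_ p)%:P + 'X ^+ 2 * (9%:R * (X_ p * Y_ p) ^+ 2 / (X_ p ^+ 3 - Y_ p ^+ 3) ^+ 2)%:P.

Lemma coord_x_eval phi p a :
  (coord_mul (delta_mx 0 0) phi p : KA).[a] = X_ p * (phi p : KA).[a].
Proof. by rewrite coord_mul_funE hornerM hornerC mulmx2E !mxE /= mul1r mul0r addr0. Qed.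

Lemma coord_y_eval phi p a :
  (coord_mul (delta_mx 0 1) phi p : KA).[a] = Y_ p * (phi p : KA).[a].
Proof. by rewrite coord_mul_funE hornerM hornerC mulmx2E !mxE /= mul1r mul0r add0r. Qed.

(** Orthogonality of the characters of the group of cube roots of unity. *)
Lemma sum_reflections k phi p e : has_weight k phi ->
  \sum_(i < 3) (zeta ^+ (e * i))%:P * phi (pact p (s_ i)) =
  (if (3 %| e + k)%N then 3%:R else 0 : K)%:P * phi (pact p s0).
Proof.
move=> wk; have z3 := zeta3 zeta_prim; have z2 := zeta_sum zeta_prim.
rewrite (eq_bigr (fun i : 'I_3 => ((zeta ^+ (e + k)%N) ^+ i)%:P * phi (pact p s0))).
  rewrite -mulr_suml -rmorph_sum; congr (_%:P * _).
  rewrite !big_ord_recl big_ord0 /= /bump /= expr0 expr1 addr0.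
  rewrite -(expr_mod (e + k)%N z3) -[(3 %| _)%N]/(_ == 0%N).
  have := ltn_mod (e + k)%N 3; move: ((e + k) %% 3)%N => [|[|[|//]]] _ /=.
  - by rewrite expr0 expr1n; ring.
  - by rewrite expr1; ring: z2.
  - by rewrite -exprM; ring: z2 z3.
move=> i _; rewrite (weight_s _ _ wk) mulrA -polyCM; congr (_%:P * _).
by rewrite -!exprM [(i * k)%N]mulnC -exprD -mulnDl.
Qed.

Lemma Dx_Dy phi : Dx (Dy phi) = fun_mul lam_q phi.
Proof.
move: phi; apply: weight_ext => [f g|f g|k phi k3 wk]; [by rewrite !opD|by rewrite !opD|].
apply/funext => p; apply: poly_eval_inj => a.
have wD := weight_Dy wk k3; have k3' : (k.+1 %% 3 < 3)%N by rewrite ltn_mod.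
rewrite (Dx_eval _ _ wD) // !(Dy_eval _ _ wk) // disc_s0 pact_s0K /fun_mul /lam_q !hornE.
case: k k3 {wk wD k3'} => [|[|[|//]]] _; pt_field zeta_prim p phi a.
Qed.

(** The function is the same as for the other order; by linearity in the vector this is the whole
    commutation of Dunkl operators. *)
Lemma Dy_Dx phi : Dy (Dx phi) = fun_mul lam_q phi.
Proof.
move: phi; apply: weight_ext => [f g|f g|k phi k3 wk]; [by rewrite !opD|by rewrite !opD|].
apply/funext => p; apply: poly_eval_inj => a.
have wD := weight_Dx wk k3; have k3' : ((k + 2) %% 3 < 3)%N by rewrite ltn_mod.
rewrite (Dy_eval _ _ wD) // !(Dx_eval _ _ wk) // disc_s0 pact_s0K /fun_mul /lam_q !hornE.
case: k k3 {wk wD k3'} => [|[|[|//]]] _; pt_field zeta_prim p phi a.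
Qed.

(** The inner operator at p.s_0 is already written in the coordinates of p; its minus sign reflects
    that X^3 - Y^3 is anti-invariant under s_0. *)
Lemma Dx2_eval k phi p a : has_weight k phi -> (k < 3)%N ->
  (Dx (Dx phi) p : KA).[a] =
    x_ p * (x_ p * (phi p : KA).[a] +
    a * (3%:R * wt_poly k (X_ p) (Y_ p) / (X_ p ^+ 3 - Y_ p ^+ 3)) * (phi (pact p s0) : KA).[a])
    + a * (3%:R * wt_poly ((k + 2) %% 3) (X_ p) (Y_ p) / (X_ p ^+ 3 - Y_ p ^+ 3)) *
    (y_ p * (phi (pact p s0) : KA).[a] -
    a * (3%:R * wt_poly k (Y_ p) (X_ p) / (X_ p ^+ 3 - Y_ p ^+ 3)) * (phi p : KA).[a]).
Proof.
move=> wk k3; rewrite (Dx_eval _ _ (weight_Dx wk k3)) ?ltn_mod // !(Dx_eval _ _ wk) //.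
rewrite disc_s0 pact_s0K; case: (pact_s0 zeta_prim p) => -> -> -> _.
by rewrite invrN; ring.
Qed.

Lemma Dy2_eval k phi p a : has_weight k phi -> (k < 3)%N ->
  (Dy (Dy phi) p : KA).[a] =
    y_ p * (y_ p * (phi p : KA).[a] -
    a * (3%:R * wt_poly (k.+1 %% 3) (X_ p) (Y_ p) / (X_ p ^+ 3 - Y_ p ^+ 3)) * (phi (pact p
      s0) : KA).[a])
    - a * (3%:R * wt_poly ((k.+1 %% 3).+1 %% 3) (X_ p) (Y_ p) / (X_ p ^+ 3 - Y_ p ^+ 3)) *
    (x_ p * (phi (pact p s0) : KA).[a] +
    a * (3%:R * wt_poly (k.+1 %% 3) (Y_ p) (X_ p) / (X_ p ^+ 3 - Y_ p ^+ 3)) * (phi p : KA).[a]).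
Proof.
move=> wk k3; rewrite (Dy_eval _ _ (weight_Dy wk k3)) ?ltn_mod // !(Dy_eval _ _ wk) //.
rewrite disc_s0 pact_s0K; case: (pact_s0 zeta_prim p) => -> -> _ ->.
by rewrite invrN; ring.
Qed.

Definition lam_r (p : point) : KA :=
  (x_ p ^+ 3 + y_ p ^+ 3)%:P - 'X ^+ 2 *
  (9%:R * (x_ p * X_ p * (X_ p ^+ 3 + 2%:R * Y_ p ^+ 3)
           + y_ p * Y_ p * (2%:R * X_ p ^+ 3 + Y_ p ^+ 3))
   / (X_ p ^+ 3 - Y_ p ^+ 3) ^+ 2)%:P.

Lemma Dx3_Dy3 phi : Dx (Dx (Dx phi)) + Dy (Dy (Dy phi)) = fun_mul lam_r phi.
Proof.
move: phi; apply: weight_ext => [f g|f g|k phi k3 wk];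
  [by rewrite !opD addrACA|by rewrite !opD|].
apply/funext => p; apply: poly_eval_inj => a.
rewrite -[(_ + _) p]/(Dx (Dx (Dx phi)) p + Dy (Dy (Dy phi)) p : KA) hornerD.
have m3 i : (i %% 3 < 3)%N by rewrite ltn_mod.
(* Each third power is a second power applied to an eigenfunction, namely [Dx phi] or [Dy phi]. *)
apply: etrans (congr2 +%R (Dx2_eval p a (weight_Dx wk k3) (m3 _))
  (Dy2_eval p a (weight_Dy wk k3) (m3 _))) _.
rewrite !(Dx_eval _ _ wk) // !(Dy_eval _ _ wk) // disc_s0 pact_s0K /fun_mul /lam_r !hornE.
case: k k3 {wk} => [|[|[|//]]] _; pt_field zeta_prim p phi a.
Qed.

Definition lam_Q (p : point) : KA := (X_ p * Y_ p)%:P.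
Definition lam_R (p : point) : KA := (X_ p ^+ 3 + Y_ p ^+ 3)%:P.
Definition lam_eu (p : point) : KA := (x_ p * X_ p + y_ p * Y_ p)%:P.
Definition lam_a2 (p : point) : KA := (x_ p * Y_ p ^+ 2 + y_ p * X_ p ^+ 2)%:P.
Definition lam_a1 (p : point) : KA := (x_ p ^+ 2 * Y_ p + y_ p ^+ 2 * X_ p)%:P
  - 'X ^+ 2 * (9%:R * X_ p * Y_ p * (X_ p ^+ 3 + Y_ p ^+ 3) / (X_ p ^+ 3 - Y_ p ^+ 3) ^+ 2)%:P.

Lemma scale_funE (c : KA) (phi : Fun) p : (c *: phi) p = c * phi p :> KA.
Proof. by []. Qed.

Lemma add_funE (phi psi : Fun) p : (phi + psi) p = phi p + psi p :> KA.
Proof. by []. Qed.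

Lemma opp_funE (phi : Fun) p : (- phi) p = - phi p :> KA.
Proof. by []. Qed.

Lemma sum_translate k phi p e : has_weight k phi ->
  (\sum_(i < 3) (zeta ^+ (e * i))%:P *: translate (s_ i) phi) p =
  (if (3 %| e + k)%N then 3%:R else 0 : K)%:P * phi (pact p s0) :> KA.
Proof. by move=> wk; rewrite -(sum_reflections _ _ wk) fct_sumE. Qed.

Lemma op_sumD e : {morph (fun phi : Fun =>
   \sum_(i < 3) (zeta ^+ (e * i))%:P *: translate (s_ i) phi) : f g / f + g}.
Proof. by move=> f g /=; rewrite -big_split; apply: eq_bigr => i _; rewrite !opD scalerDr. Qed.

Definition refl_sum e (phi : Fun) : Fun :=
  \sum_(i < 3) (zeta ^+ (e * i))%:P *: translate (s_ i) phi.

Lemma refl_sumD e : {morph refl_sum e : f g / f + g}.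
Proof. exact: op_sumD. Qed.

Lemma refl_sum_eval k phi p e a : has_weight k phi ->
  (refl_sum e phi p : KA).[a] = (if (3 %| e + k)%N then 3%:R else 0) * (phi (pact p s0) : KA).[a].
Proof. by move=> wk; rewrite /refl_sum (sum_translate _ _ wk) !hornE. Qed.

(** The corrections cancel the reflection part of the leading terms. In X Dx + Y Dy the i-th
    reflection has coefficient A (X - zeta^i Y)/(X - zeta^i Y) = A. In Y^2 Dx + X^2 Dy it has A (Y^2
    - zeta^i X^2)/(X - zeta^i Y) = -A (zeta^i X + zeta^(2i) Y). The correction of [a1_op] is the
    analogue with x and y. *)
Definition eu_op phi : Fun := cX (Dx phi) + cY (Dy phi) - 'X *: refl_sum 0 phi.
Definition a1_op phi : Fun := cY (Dx (Dx phi)) + cX (Dy (Dy phi))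
  + 'X *: (refl_sum 2 (Dx phi) + refl_sum 1 (Dy phi)).
Definition a2_op phi : Fun := cY (cY (Dx phi)) + cX (cX (Dy phi))
  + 'X *: (cX (refl_sum 1 phi) + cY (refl_sum 2 phi)).

Lemma eu_scalar phi : eu_op phi = fun_mul lam_eu phi.
Proof.
move: phi; apply: weight_ext => [f g|f g|k phi k3 wk].
- rewrite /eu_op refl_sumD !(DunklD _ f) (coord_mulD _ (Dx f)) (coord_mulD _ (Dy f)) scalerDr.
  apply/funext => p; rewrite ?(add_funE, opp_funE).
  by rewrite -/KA; ring.
- by rewrite !opD.
apply/funext => p; apply: poly_eval_inj => a.
have e (u v w : KA) : (u + v - 'X * w).[a] = u.[a] + v.[a] - a * w.[a] by rewrite !hornE.
rewrite -[eu_op phi p]/(cX (Dx phi) p + cY (Dy phi) p - 'X * refl_sum 0 phi p : KA) e.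
rewrite coord_x_eval coord_y_eval.
rewrite (Dx_eval _ _ wk) // (Dy_eval _ _ wk) // (refl_sum_eval _ _ _ wk) /fun_mul /lam_eu !hornE.
case: k k3 {wk} => [|[|[|//]]] _; pt_field zeta_prim p phi a.
Qed.

Lemma regroup_add (A A' B B' C C' D D' : Fun) :
  A + A' + (B + B') + 'X *: (C + C' + (D + D')) =
  A + B + 'X *: (C + D) + (A' + B' + 'X *: (C' + D')).
Proof. by rewrite (addrACA A) (addrACA C) scalerDr; apply: addrACA. Qed.

Lemma a1_scalar phi : a1_op phi = fun_mul lam_a1 phi.
Proof.
move: phi; apply: weight_ext => [f g|f g|k phi k3 wk].
- rewrite /a1_op !(DunklD _ f) (DunklD _ (Dx f)) (DunklD _ (Dy f)).
  rewrite (coord_mulD _ (Dx (Dx f))) (coord_mulD _ (Dy (Dy f))).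
  rewrite (refl_sumD _ (Dx f)) (refl_sumD _ (Dy f)); exact: regroup_add.
- by rewrite !opD.
apply/funext => p; apply: poly_eval_inj => a.
have e (u v w t : KA) : (u + v + 'X * (w + t)).[a] = u.[a] + v.[a] + a * (w.[a] + t.[a]).
  by rewrite !hornE.
rewrite -[a1_op phi p]/(cY (Dx (Dx phi)) p + cX (Dy (Dy phi)) p
  + 'X * (refl_sum 2 (Dx phi) p + refl_sum 1 (Dy phi) p) : KA) e.
rewrite (coord_y_eval (Dx (Dx phi)) p a) (coord_x_eval (Dy (Dy phi)) p a).
rewrite (Dx2_eval _ _ wk) // (Dy2_eval _ _ wk) //.
rewrite (refl_sum_eval _ _ _ (weight_Dx wk k3)) (refl_sum_eval _ _ _ (weight_Dy wk k3)).
rewrite (Dx_eval _ _ wk) // (Dy_eval _ _ wk) // disc_s0 pact_s0K /fun_mul /lam_a1 !hornE.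
case: k k3 {wk} => [|[|[|//]]] _; pt_field zeta_prim p phi a.
Qed.

Lemma a2_scalar phi : a2_op phi = fun_mul lam_a2 phi.
Proof.
move: phi; apply: weight_ext => [f g|f g|k phi k3 wk].
- rewrite /a2_op !(DunklD _ f) !(coord_mulD _ (Dx f)) !(coord_mulD _ (Dy f)).
  rewrite (coord_mulD _ (cY (Dx f))) (coord_mulD _ (cX (Dy f))) !(refl_sumD _ f).
  rewrite !(coord_mulD _ (refl_sum _ f)); exact: regroup_add.
- by rewrite !opD.
apply/funext => p; apply: poly_eval_inj => a.
have e (u v w t : KA) : (u + v + 'X * (w + t)).[a] = u.[a] + v.[a] + a * (w.[a] + t.[a]).
  by rewrite !hornE.
rewrite -[a2_op phi p]/(cY (cY (Dx phi)) p + cX (cX (Dy phi)) p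
  + 'X * (cX (refl_sum 1 phi) p + cY (refl_sum 2 phi) p) : KA) e.
rewrite !coord_x_eval !coord_y_eval.
rewrite !(refl_sum_eval _ _ _ wk).
rewrite (Dx_eval _ _ wk) // (Dy_eval _ _ wk) // /fun_mul /lam_a2 !hornE.
case: k k3 {wk} => [|[|[|//]]] _; pt_field zeta_prim p phi a.
Qed.

(** * The defining relations and the action of H *)

Lemma DunklE u phi :
  Dunkl u phi = (u 0 0)%:P *: Dx phi + (u 1 0)%:P *: Dy phi.
Proof.
apply/funext => p.
rewrite -[RHS]/((u 0 0)%:P * Dx phi p + (u 1 0)%:P * Dy phi p) !Dunkl_funE.
have pu a : pairing u a = u 0 0 * pairing (delta_mx 0 0) a + u 1 0 * pairing (delta_mx 1 0) a.
  by rewrite /pairing !mulmx2E !mxE /=; ring.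
have -> : (pt_Vd p *m u) 0 0 = u 0 0 * (pt_Vd p *m (delta_mx 0 0 : 'cV[K]_2)) 0 0
   + u 1 0 * (pt_Vd p *m (delta_mx 1 0 : 'cV[K]_2)) 0 0.
  by rewrite !mulmx2E !mxE /=; ring.
rewrite (eq_bigr (fun i : 'I_3 => (u 0 0)%:P *
    ((pairing (delta_mx 0 0) (root_form zeta i) / pairing (pt_V p) (root_form zeta i))%:P *
      phi (pact p (s_ i)))
  + (u 1 0)%:P *
    ((pairing (delta_mx 1 0) (root_form zeta i) / pairing (pt_V p) (root_form zeta i))%:P *
      phi (pact p (s_ i))))).
  rewrite big_split -!mulr_sumr polyCD !polyCM /=.
  by move: (\sum_(i < 3) _) (\sum_(i < 3) _) (phi p : KA) => S1 S2 f; ring.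
move=> i _; rewrite pu !mulrA -!polyCM -mulrDl -polyCD.
by congr (_%:P * _); ring.
Qed.

Lemma coord_mulE U phi :
  coord_mul U phi = (U 0 0)%:P *: cX phi + (U 0 1)%:P *: cY phi.
Proof.
apply/funext => p.
rewrite -[RHS]/((U 0 0)%:P * cX phi p + (U 0 1)%:P * cY phi p) !coord_mul_funE.
rewrite !mulmx2E !mxE /= !(mul1r, mul0r, addr0, add0r) polyCD !polyCM.
by move: (phi p : KA) => f; ring.
Qed.

Lemma act_vec u phi : act (lin_vec (free_v zeta) u) phi = Dunkl u phi.
Proof. by rewrite DunklE; apply: act_lin_vec. Qed.

Lemma act_form U phi : act (lin_form (free_f zeta) U) phi = coord_mul U phi.
Proof. by rewrite coord_mulE; apply: act_lin_form. Qed.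

Lemma act_g (w : W) phi : act (free_g w) phi = translate w phi.
Proof. exact: act_free_letter. Qed.

Lemma translateM (u v : W) phi : translate (W_mul u v) phi = translate u (translate v phi).
Proof. by apply/funext => p; rewrite /translate pt_actM. Qed.

Lemma weight_translate_rho k phi : has_weight k phi ->
  translate rho phi = (zeta ^+ k)%:P *: phi.
Proof. by move=> wk; apply/funext => p; rewrite /translate wk. Qed.

(** Equivariance is multiplicative in w, so [W_ind] leaves s_0, which exchanges the two basic
    operators, and rho, for which it is the change of weights. *)
Lemma translate_Dunkl (w : W) u phi :
  translate w (Dunkl u phi) = Dunkl (W_val w *m u) (translate w phi).
Proof.
have z3 := zeta3 zeta_prim; have zV := zetaV zeta_prim.
elim/(W_ind (zeta_prim := zeta_prim)): w u phi => [u phi|u phi|u phi|w w' IH IH' u phi].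
- have e psi : translate (W_one zeta) psi = psi.
    by apply/funext => p; rewrite /translate pt_act1.
  by rewrite !e /= mul1mx.
- have sE : W_val s0 = anti_elt 1 by rewrite W_val_s expr0.
  rewrite DunklE (DunklE (W_val s0 *m u)) sE !mulmx2E !mxE /= invr1 !(mul0r, mul1r, add0r, addr0).
  rewrite translateD addrC; congr (_ + _).
    rewrite -[LHS]/(_ *: translate s0 (Dy phi)); congr (_ *: _).
    move: phi; apply: weight_ext => [f g|f g|k phi k3 wk];
      [by rewrite DunklD translateD|by rewrite translateD DunklD|].
    apply/funext => p; apply: poly_eval_inj => a.
    rewrite (Dx_eval _ _ (weight_translate_s0 wk)) ?ltn_mod // /translate (Dy_eval _ _ wk) //.
    rewrite disc_s0 pact_s0K.
    case: k k3 {wk} => [|[|[|//]]] _; pt_field zeta_prim p phi a.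
  rewrite -[LHS]/(_ *: translate s0 (Dx phi)); congr (_ *: _).
  move: phi; apply: weight_ext => [f g|f g|k phi k3 wk];
    [by rewrite DunklD translateD|by rewrite translateD DunklD|].
  apply/funext => p; apply: poly_eval_inj => a.
  rewrite (Dy_eval _ _ (weight_translate_s0 wk)) ?ltn_mod // /translate (Dx_eval _ _ wk) //.
  rewrite disc_s0 pact_s0K.
  case: k k3 {wk} => [|[|[|//]]] _; pt_field zeta_prim p phi a.
- move: phi; apply: weight_ext => [f g|f g|k phi k3 wk];
    [by rewrite DunklD translateD|by rewrite translateD DunklD|].
  rewrite (weight_translate_rho wk) DunklZ DunklE translateD.
  rewrite -[translate rho (_ *: Dx phi)]/(_ *: translate rho (Dx phi)).
  rewrite -[translate rho (_ *: Dy phi)]/(_ *: translate rho (Dy phi)).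
  rewrite (weight_translate_rho (weight_Dx wk k3)) (weight_translate_rho (weight_Dy wk k3)).
  rewrite (DunklE (W_val rho *m u)) W_val_rho !mulmx2E !mxE /= !(mul0r, add0r,
    addr0) invrK scalerDr !scalerA -!polyCM.
rewrite !expr_mod //; congr (_%:P *: _ + _%:P *: _); last by rewrite exprS; ring.
  by rewrite zV exprD; ring.
by rewrite !translateM IH' IH /= mulmxA.
Qed.

Lemma translate_coord_mul (w : W) U phi :
  translate w (coord_mul U phi) = coord_mul (U *m invmx (W_val w)) (translate w phi).
Proof. by apply/funext => p; rewrite /translate !coord_mul_funE /= mulmxA. Qed.

Lemma Dunkl_comm u u' phi : Dunkl u (Dunkl u' phi) = Dunkl u' (Dunkl u phi).
Proof.
rewrite (DunklE u' phi) (DunklE u phi) (DunklE u) (DunklE u').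
rewrite !DunklD !DunklZ !Dx_Dy !Dy_Dx.
move: (fun_mul _ _) (Dx (Dx _)) (Dy (Dy _)) => F G H.
by apply/funext => p; rewrite !(add_funE, scale_funE); ring.
Qed.

(** Multiplications commute, so each reflection contributes only U(s_i p) - U(p) divided by the root
    at p. This difference is a multiple of the root, and the quotient is the constant -2 <coroot,
    U>/<coroot, root>. *)
Lemma Dunkl_coord_mul u U phi :
  Dunkl u (coord_mul U phi) - coord_mul U (Dunkl u phi) =
  (- 2%:R) *: \sum_(i < 3) ('X * (pairing u (root_form zeta i) * pairing (coroot zeta i) U
      / pairing (coroot zeta i) (root_form zeta i))%:P) *: translate (s_ i) phi.
Proof.
apply/funext => p; rewrite -[LHS]/(Dunkl u (coord_mul U phi) p - coord_mul U (Dunkl u phi) p :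
  KA).
rewrite [in RHS]scale_funE fct_sumE !(Dunkl_funE, coord_mul_funE).
set c := (_ *m _) 0 0; set e := (U *m _) 0 0.
have regroup (f S S' : KA) : c%:P * (e%:P * f) + 'X * S - e%:P * (c%:P * f + 'X * S') =
  'X * (S - e%:P * S').
  by ring.
rewrite regroup !mulr_sumr -sumrB mulr_sumr; apply: eq_bigr => i _.
rewrite [in RHS]scale_funE /translate coord_mul_funE.
have alpha0 : pairing (pt_V p) (root_form zeta i) != 0.
  rewrite pairing_root; have := pt_disc_eval p; apply: contraNneq => /eqP.
  by rewrite subr_eq0 => /eqP ->; rewrite exprMn exprAC (zeta3 zeta_prim) expr1n mul1r subrr.
have z0 := zetaX_neq0 zeta_prim i.
have n2 : (2%:R : K) != 0 by rewrite pnatr_eq0.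
move: (phi (pact p (s_ i)) : KA) => f.
set au := pairing u _; set aa := pairing _ _; set U' := (U *m _) 0 0.
have key : au / aa * U' - e * (au / aa) =
    - 2%:R * (au * pairing (coroot zeta i) U / pairing (coroot zeta i) (root_form zeta i)).
  rewrite /U' /e {U' e regroup} mulmx2E;
    case: (pact_anti zeta_prim p (W_val_s zeta_prim i) z0) => -> -> _ _.
  rewrite mulmx2E; move: alpha0; rewrite /aa !pairing_root !mxE /pairing mulmx2E !mxE /=.
  move: z0; move: (zeta ^+ i) (pt_V p 0 0) (pt_V p 1 0) (U 0 0) (U 0 1) au.
  move=> z X Y U0 U1 b z0 alpha0.
  (* This is the pairing of the coroot with its root, 2 zeta^i. *)
  have -> : z - z * -1 = 2%:R * z by ring.
  by field; rewrite z0 alpha0.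
transitivity ('X * ((au / aa * U' - e * (au / aa))%:P * f)).
  by rewrite polyCB !polyCM; ring.
rewrite key; set v := _ / _.
by rewrite polyCM polyCN polyC_natr; ring.
Qed.

Lemma actB (p q : Free) phi : act (p - q) phi = act p phi - act q phi.
Proof. exact: act_freeB. Qed.

Lemma actM (p q : Free) phi : act (p * q) phi = act p (act q phi).
Proof. exact: (act_freeM (gen_op_linear zeta_prim)). Qed.

Lemma actZ c (p : Free) phi : act (c *: p) phi = c *: act p phi.
Proof. exact: act_freeZ. Qed.

Lemma act1 phi : act (1 : Free) phi = phi.
Proof. exact: act_free1. Qed.

Lemma act_sum (J : Type) (r : seq J) (P : pred J) (F : J -> Free) phi :
  act (\sum_(j <- r | P j) F j) phi = \sum_(j <- r | P j) act (F j) phi.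
Proof. exact: act_free_sum. Qed.

Lemma act_bracket (p q p' q' : Free) phi :
  act (p * q - p' * q') phi = act p (act q phi) - act p' (act q' phi).
Proof. by rewrite actB; congr (_ - _); apply: actM. Qed.

Lemma act_sub0 (p q : Free) phi : act p phi = act q phi -> act (p - q) phi = 0.
Proof. by move=> e; rewrite actB e subrr. Qed.

Lemma act_bracket0 (p q p' q' : Free) S T S' T' phi :
  act p =1 S -> act q =1 T -> act p' =1 S' -> act q' =1 T' ->
  S (T phi) = S' (T' phi) -> act (p * q - p' * q') phi = 0.
Proof. by move=> pS qT pS' qT' e; rewrite act_bracket qT qT' pS pS' e subrr. Qed.

Lemma act_relation (h : Free) : cherednik_rel zeta_prim (free_v zeta) (free_f zeta) (@free_g K
  zeta) h ->
  forall phi, act h phi = 0.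
Proof.
case=> {h} [|w w'|w u|w U|u u'|U U'|u U] phi.
- apply: act_sub0; apply: etrans (act_g _ _) (etrans _ (esym (act1 _))).
  by apply/funext => p; rewrite /translate pt_act1.
- apply: act_sub0; apply: etrans (actM _ _ _) (etrans _ (esym (act_g _ _))).
  apply: etrans (act_g _ _) (etrans _ (esym (translateM _ _ _))).
  by congr (translate _ _); apply: act_g.
- exact: act_bracket0 (act_g w) (act_vec u) (act_vec _) (act_g w) (translate_Dunkl _ _ _).
- exact: act_bracket0 (act_g w) (act_form U) (act_form _) (act_g w) (translate_coord_mul _ _ _).
- exact: act_bracket0 (act_vec _) (act_vec _) (act_vec _) (act_vec _) (Dunkl_comm _ _ _).
- apply: act_bracket0 (act_form _) (act_form _) (act_form _) (act_form _) _.
  by apply/funext => p; rewrite !coord_mul_funE mulrCA.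
apply: act_sub0; apply: etrans (act_bracket _ _ _ _ _) _.
transitivity (Dunkl u (coord_mul U phi) - coord_mul U (Dunkl u phi)).
  congr (_ - _); first exact: etrans (act_vec _ _) (congr1 _ (act_form _ _)).
  exact: etrans (act_form _ _) (congr1 _ (act_vec _ _)).
rewrite Dunkl_coord_mul.
apply: esym; apply: etrans (actZ _ _ _) _; congr (_ *: _).
apply: etrans (act_sum _ _ _ _) _; apply: eq_bigr => i _.
by apply: etrans (actZ _ _ _) _; congr (_ *: _); apply: act_g.
Qed.

Lemma actD (p q : Free) phi : act (p + q) phi = act p phi + act q phi.
Proof. exact: act_freeD. Qed.

Lemma act_ideal (p : Free) : two_sided_ideal rel p -> forall phi, act p phi = 0.
Proof.
elim=> {p} [phi|a s b /act_relation s0' phi|u w _ IHu _ IHw phi].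
- exact: act_free0.
- apply: etrans (actM _ _ _) _; apply: etrans (actM _ _ _) _.
  by rewrite (s0' (act b phi)); apply: raddf0.
- by apply: etrans (actD _ _ _) _; rewrite IHu IHw addr0.
Qed.

Lemma iota_surj (h : H) : exists p, iota p = h.
Proof. exact: to_quot_surj. Qed.

(** A preimage in the free algebra is chosen; [act_ideal] makes the action independent of it, as
    [actH_iota] records. *)
Definition actH (h : H) : Fun -> Fun := act (sval (cid (iota_surj h))).

Lemma actH_iota (p : Free) phi : actH (iota p) phi = act p phi.
Proof.
rewrite /actH; case: cid => /= q e.
have I := iffLR (@to_quotE _ _ _ (@cherednik_proper _ _ zeta_prim) q p) e.
by have := act_ideal I phi; rewrite actB; apply: subr0_eq.
Qed.

Lemma iotaM p q : iota (p * q) = iota p * iota q. Proof. exact: rmorphM. Qed.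
Lemma iotaD p q : iota (p + q) = iota p + iota q. Proof. exact: raddfD. Qed.
Lemma iotaB p q : iota (p - q) = iota p - iota q. Proof. exact: raddfB. Qed.
Lemma iotaZ c p : iota (c *: p) = c *: iota p. Proof. exact: linearZ. Qed.
Lemma iota1 : iota 1 = 1. Proof. exact: rmorph1. Qed.
Lemma iota_sum (J : Type) (r : seq J) (P : pred J) (F : J -> Free) :
  iota (\sum_(j <- r | P j) F j) = \sum_(j <- r | P j) iota (F j).
Proof. exact: raddf_sum. Qed.

Lemma actHM h h' phi : actH (h * h') phi = actH h (actH h' phi).
Proof.
have [p <-] := iota_surj h; have [q <-] := iota_surj h'.
rewrite -iotaM; apply: etrans (actH_iota _ _) _; apply: etrans (actM _ _ _) _.
by apply: esym; apply: etrans (actH_iota _ _) _; congr (act _ _); apply: actH_iota.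
Qed.

Lemma actHD h h' phi : actH (h + h') phi = actH h phi + actH h' phi.
Proof.
have [p <-] := iota_surj h; have [q <-] := iota_surj h'.
rewrite -iotaD !actH_iota; exact: actD.
Qed.

Lemma actHZ c h phi : actH (c *: h) phi = c *: actH h phi.
Proof.
have [p <-] := iota_surj h; rewrite -iotaZ !actH_iota; exact: actZ.
Qed.

Lemma actH1 phi : actH 1 phi = phi.
Proof. by rewrite -iota1; apply: etrans (actH_iota _ _) (act1 _). Qed.

Lemma actH_linear h : linear (actH h).
Proof. exact: (act_free_linear (gen_op_linear zeta_prim)). Qed.
HB.instance Definition _ h := GRing.isLinear.Build KA Fun Fun *:%R (actH h)
  (actH_linear h).

Lemma actHB h h' phi : actH (h - h') phi = actH h phi - actH h' phi.
Proof. by rewrite actHD -scaleN1r actHZ scaleN1r. Qed.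

Lemma actH0 phi : actH 0 phi = 0.
Proof. by rewrite -(subrr 1) actHB subrr. Qed.

Lemma actH_sum (J : Type) (r : seq J) (P : pred J) (F : J -> H) phi :
  actH (\sum_(j <- r | P j) F j) phi = \sum_(j <- r | P j) actH (F j) phi.
Proof. by apply: (big_morph (fun h => actH h phi)) => [h h'|]; rewrite ?actHD ?actH0. Qed.

Lemma actH_v j phi : actH (vH j) phi = Dunkl (delta_mx j 0) phi.
Proof. by apply: etrans (actH_iota _ _) _; apply: act_free_letter. Qed.
Lemma actH_f j phi : actH (fH j) phi = coord_mul (delta_mx 0 j) phi.
Proof. by apply: etrans (actH_iota _ _) _; apply: act_free_letter. Qed.
Lemma actH_g w phi : actH (gH w) phi = translate w phi.
Proof. by apply: etrans (actH_iota _ _) _; apply: act_free_letter. Qed.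

Lemma iota_lin_vec u : iota (lin_vec (free_v zeta) u) = lin_vec vH u.
Proof. by apply: etrans (iota_sum _ _ _) _; apply: eq_bigr => j _; apply: iotaZ. Qed.
Lemma iota_lin_form U : iota (lin_form (free_f zeta) U) = lin_form fH U.
Proof. by apply: etrans (iota_sum _ _ _) _; apply: eq_bigr => j _; apply: iotaZ. Qed.

Lemma iota_rel p : rel p -> iota p = 0.
Proof.
move=> rp; apply: etrans (_ : iota 0 = 0); last exact: raddf0.
apply: (iffRL (@to_quotE _ _ _ (@cherednik_proper _ _ zeta_prim) p 0)).
by rewrite subr0 -[p]mul1r -[_ * p]mulr1; constructor.
Qed.

Lemma H_rel0 b : cherednik_rel zeta_prim vH fH gH b -> b = 0.
Proof.
have subE (a b' c e : H) : a = c -> b' = e -> a - b' = c - e by move=> -> ->.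
have bracketE a b' c e : iota (a * b' - c * e) = iota a * iota b' - iota c * iota e.
  exact: etrans (iotaB _ _) (subE _ _ _ _ (iotaM _ _) (iotaM _ _)).
case=> {b} [|w w'|w u|w U|u u'|U U'|u U].
- by apply: etrans (iota_rel (Rel_one _ _ _ _)); rewrite iotaB iota1.
- apply: etrans (iota_rel (Rel_mul _ _ _ _ w w')).
  exact: esym (etrans (iotaB _ _) (subE _ _ _ _ (iotaM _ _) (erefl _))).
- apply: etrans (iota_rel (Rel_V _ _ _ _ w u)); rewrite -!iota_lin_vec.
  exact/esym/bracketE.
- apply: etrans (iota_rel (Rel_Vdual _ _ _ _ w U)); rewrite -!iota_lin_form.
  exact/esym/bracketE.
- apply: etrans (iota_rel (Rel_VV _ _ _ _ u u')); rewrite -!iota_lin_vec.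
  exact/esym/bracketE.
- apply: etrans (iota_rel (Rel_VdualVdual _ _ _ _ U U')); rewrite -!iota_lin_form.
  exact/esym/bracketE.
apply: etrans (iota_rel (Rel_VVdual _ _ _ _ u U)).
rewrite -iota_lin_vec -iota_lin_form; apply: esym; apply: etrans (iotaB _ _) _.
apply: subE; first exact: bracketE.
apply: etrans (iotaZ _ _) _; congr (_ *: _); apply: etrans (iota_sum _ _ _) _.
by apply: eq_bigr => i _; apply: iotaZ.
Qed.

Lemma H_normal_form h : normal_form vH fH gH h.
Proof.
suff nfM p b : normal_form vH fH gH b -> normal_form vH fH gH (iota p * b).
  have [p <-] := iota_surj h; rewrite -[iota p]mulr1; apply: nfM.
  exact: (nf1 H_rel0).
move=> nb; rewrite [p]monalg.monalgE iota_sum mulr_suml; apply: nf_sum => m.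
rewrite malgU_scale.
rewrite iotaZ -scalerAl; apply: nfZ.
case: m => s; elim: s => [|a s IHs].
  by rewrite (_ : monalg.mkmalgU _ _ = 1 :> Free) ?iota1 ?mul1r // -fmoneE.
rewrite malgU_cons.
rewrite iotaM -mulrA; case: a => [[j|j]|w].
- exact: (nf_v H_rel0).
- exact: nf_f.
- exact: (nf_g H_rel0).
Qed.

Lemma pbw_surj h : exists p, pbw p = h.
Proof. exact: (nf_pbw H_rel0) (H_normal_form h). Qed.

(** * Behaviour at A = 0, the PBW theorem and faithfulness *)

Definition coord4 (a : 'cV[K]_2) (b : 'rV[K]_2) (i : 'I_(2 + 2)) : K :=
  match fintype.split i with inl j => a j 0 | inr j => b 0 j end.

Definition acts0 (h : H) (c : point -> K) := forall phi p,
  (actH h phi p : KA).[0] = c p * (phi p : KA).[0].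

Lemma acts0_1 : acts0 1 (fun=> 1).
Proof. by move=> phi p; rewrite actH1 mul1r. Qed.

Lemma acts0M h h' c c' : acts0 h c -> acts0 h' c' -> acts0 (h * h') (fun p => c p * c' p).
Proof. by move=> hc hc' phi p; rewrite actHM hc hc' mulrA. Qed.

Lemma acts0X h c n : acts0 h c -> acts0 (h ^+ n) (fun p => c p ^+ n).
Proof.
move=> hc; elim: n => [|n IH]; first exact: acts0_1.
by move=> phi p; rewrite !exprS (acts0M hc IH).
Qed.

Lemma acts0_prod (h : 'I_2 -> H) (c : 'I_2 -> point -> K) : (forall j, acts0 (h j) (c j)) ->
  acts0 (\prod_j h j) (fun p => \prod_j c j p).
Proof.
move=> hc phi p; rewrite !big_ord_recl !big_ord0 !mulr1; exact: (acts0M (hc _) (hc _)).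
Qed.

Lemma acts0_f j : acts0 (fH j) (fun p => pt_V p j 0).
Proof.
move=> phi p; rewrite actH_f coord_mul_funE !hornE.
rewrite mxE (bigD1 j) //= big1 ?addr0 => [|i ij]; rewrite mxE eqxx /=;
  first by rewrite eqxx mul1r.
by rewrite (negbTE ij) mul0r.
Qed.

Lemma acts0_v j : acts0 (vH j) (fun p => pt_Vd p 0 j).
Proof.
move=> phi p; rewrite actH_v Dunkl_funE !hornE mul0r addr0.
rewrite mxE (bigD1 j) //= big1 ?addr0 => [|i ij]; rewrite mxE eqxx /= ?andbT;
  first by rewrite ?eqxx mulr1.
by rewrite (negbTE ij) mulr0.
Qed.

Definition eval0 (q : polVV K) (a : 'cV[K]_2) (b : 'rV[K]_2) : K :=
  (q.@[fun i => (coord4 a b i)%:P]).[0].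

(** The letters x, y stand to the right of w, so they are evaluated at the translated point: the
    V-part of p is paired with the V^*-part of p.w. *)
Lemma actH_monomial w m phi p :
  (actH (pbw_monomial vH fH gH w m) phi p : KA).[0] =
  eval0 'X_[m] (pt_V p) (pt_Vd (pact p w)) * (phi (pact p w) : KA).[0].
Proof.
rewrite /pbw_monomial actHM actHM.
rewrite (acts0_prod (fun j => acts0X (m (lshift 2 j)) (acts0_f j))) actH_g /translate.
rewrite (acts0_prod (fun j => acts0X (m (rshift 2 j)) (acts0_v j))) mulrA; congr (_ * _).
rewrite /eval0 mevalX horner_prod big_split_ord /=; congr (_ * _); apply: eq_bigr => j _;
  rewrite /coord4 ?(unsplitK (inl j)) ?(unsplitK (inr j)) horner_exp hornerC //.
Qed.

Lemma eval0_sum (J : Type) (r : seq J) (F : J -> polVV K) a b :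
  eval0 (\sum_(j <- r) F j) a b = \sum_(j <- r) eval0 (F j) a b.
Proof. by rewrite /eval0 raddf_sum horner_sum. Qed.

Lemma actH_row w q phi p :
  (actH (pbw_row w q) phi p : KA).[0] =
  eval0 q (pt_V p) (pt_Vd (pact p w)) * (phi (pact p w) : KA).[0].
Proof.
rewrite {2}[q]mpolyE eval0_sum mulr_suml /pbw_row actH_sum fct_sumE horner_sum.
apply: eq_bigr => m _; rewrite actHZ scale_funE hornerM actH_monomial /eval0.
by rewrite mevalZ hornerM mulrA.
Qed.

Lemma actH_pbw p phi pt :
  (actH (pbw p) phi pt : KA).[0] =
  \sum_(w <- finmap.enum_fset (monalg.msupp p))
     eval0 (pbw_coef p w) (pt_V pt) (pt_Vd (pact pt w)) * (phi (pact pt w) : KA).[0].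
Proof.
rewrite (pbwEw _ _ _ (finmap.fsubset_refl _)) actH_sum fct_sumE horner_sum.
by apply: eq_bigr => w _; apply: actH_row.
Qed.

(** Multiplying by the discriminant D removes the restriction to regular points; then D is cancelled
    in a polynomial ring over a field. *)
Lemma eval0_vanish (q : polVV K) :
  (forall a b, disc a != 0 -> eval0 q a b = 0) -> forall m, (q@_m)`_0 = 0.
Proof.
move=> q0; pose q' := map_mpoly (horner_eval (0 : K)) q.
have q'E v : q'.@[v] = (q.@[fun i => (v i)%:P]).[0].
  by rewrite meval_horner0; apply: meval_eq => i; rewrite hornerC.
pose D : {mpoly K[2 + 2]} := 'X_(lshift 2 0) ^+ 3 - 'X_(lshift 2 1) ^+ 3.
have : q' * D = 0.
  apply: mpoly_eval_eq0 => v; rewrite mevalM.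
  pose a : 'cV[K]_2 := \col_j v (lshift 2 j); pose b : 'rV[K]_2 := \row_j v (rshift 2 j).
  have DE : D.@[v] = disc a by rewrite mevalB !rmorphXn /= !mevalXU /disc !mxE.
  have [d0|d0] := eqVneq (disc a) 0; first by rewrite DE d0 mulr0.
  suff -> : q'.@[v] = eval0 q a b by rewrite q0 ?mul0r.
  rewrite q'E; congr horner; apply: meval_eq => i; rewrite /coord4.
  by case: (splitP i) => j ij; rewrite !mxE; congr (v _)%:P; apply: val_inj.
move/eqP; rewrite mulf_eq0 => /orP[/eqP q'0|/eqP D0] m; last first.
  (* D is nonzero, as it takes the value 1 at X = 1 with the other variables 0. *)
  have := congr1 (fun P : {mpoly K[2 + 2]} => P.@[fun i => (i == lshift 2 0)%:R]) D0.
  rewrite /= mevalB !rmorphXn /= !mevalXU meval0 eqxx /= expr1n expr0n /= subr0.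
  by move/eqP; rewrite oner_eq0.
have := congr1 (fun P : {mpoly K[2 + 2]} => P@_m) q'0.
by rewrite /= mcoeff_map_mpoly mcoeff0 /= /horner_eval horner_coef0.
Qed.

Lemma coord_mulZ U c f : coord_mul U (c *: f) = c *: coord_mul U f.
Proof. exact: linearZ. Qed.

Definition commutes_coord (T : Fun -> Fun) := forall j phi,
  T (coord_mul (delta_mx 0 j) phi) = coord_mul (delta_mx 0 j) (T phi).

Definition const1 : Fun := fun=> 1.

(** At A = 0 the operator is the sum of E_w(p) phi(p.w). Commutation with coordinate j yields E_w(p)
    times the difference of the j-th coordinates of p.w and p, which is 0; for w other than 1
    freeness provides a coordinate that moves. So only E_1 is left, and either alternative kills
    it. *)
Lemma pbw_coef_at0 p : commutes_coord (actH (pbw p)) ->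
  pbw_coef p (W_one zeta) = 0 \/ actH (pbw p) const1 = 0 ->
  forall w m, ((pbw_coef p w)@_m)`_0 = 0.
Proof.
move=> pC p1; set s := finmap.enum_fset (monalg.msupp p).
have us : uniq s := finmap.fset_uniq _.
pose E w pt := eval0 (pbw_coef p w) (pt_V pt) (pt_Vd (pact pt w)).
have TE phi pt : (actH (pbw p) phi pt : KA).[0] =
  \sum_(w <- s) E w pt * (phi (pact pt w) : KA).[0].
  exact: actH_pbw.
have coordE j phi pt : (coord_mul (delta_mx 0 j) phi pt : KA).[0] =
  pt_V pt j 0 * (phi pt : KA).[0].
  by rewrite -actH_f acts0_f.
have E0 w pt : w \in s -> w != W_one zeta -> E w pt = 0.
  (* The indicator function of the V-part of pt.w: as W acts freely on these parts, it selects the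
     single term w. *)
  move=> ws wn1; pose phi : Fun := fun q => (pt_V q == pt_V (pact pt w))%:R.
  have phiE w' : (phi (pact pt w') : KA).[0] = (w' == w)%:R.
    rewrite /phi; have -> : (pt_V (pact pt w') == pt_V (pact pt w)) = (w' == w).
      by apply/eqP/eqP => [/pt_act_free->|->].
    by case: eqP => _; rewrite ?hornerE ?horner0.
  have pick (F : W -> K) : \sum_(w' <- s) F w' * (w' == w)%:R = F w.
    rewrite (bigD1_seq w) //= eqxx mulr1 big1 ?addr0 // => w' /negbTE ->.
    by rewrite mulr0.
  have comm j : E w pt * (pt_V (pact pt w) j 0 - pt_V pt j 0) = 0.
    have := congr1 (fun f : Fun => (f pt : KA).[0]) (pC j phi).
    rewrite /= TE coordE TE; under eq_bigr => w' _ do rewrite coordE phiE mulrA.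
    under [in RHS]eq_bigr => w' _ do rewrite phiE.
    rewrite !pick => e.
    by rewrite mulrBr e mulrC subrr.
  have [j jn] : exists j, pt_V (pact pt w) j 0 != pt_V pt j 0.
    apply/existsP; rewrite -negb_forall; apply: contraNN wn1 => /forallP e.
    apply/eqP/(@pt_act_free K zeta zeta_prim pt).
    rewrite [RHS](_ : _ = pt_V (pact pt (W_one zeta))) // pt_act1.
    by apply/colP => j; apply/eqP.
  by have /eqP := comm j; rewrite mulf_eq0 subr_eq0 (negbTE jn) orbF => /eqP.
have E1 pt : E (W_one zeta) pt = 0.
  case: p1 => [e|e]; first by rewrite /E e /eval0 raddf0 horner0.
  have [ws|ws] := boolP (W_one zeta \in s); last first.
    by rewrite /E /pbw_coef monalg.mcoeff_outdom ?/eval0 ?raddf0 ?horner0.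
  have := congr1 (fun f : Fun => (f pt : KA).[0]) e; rewrite /= TE horner0 => <-.
  rewrite (bigD1_seq _ ws us) /= /const1 hornerE mulr1 big1_seq ?addr0 // => w /andP[wn1 wS].
  by rewrite E0 ?mul0r.
move=> w; have [ws|ws] := boolP (w \in s); last first.
  by move=> m; rewrite /pbw_coef monalg.mcoeff_outdom // mcoeff0 coef0.
apply: eval0_vanish => a b d0.
(* The form b w^-1 is chosen so that the V^*-part of pt.w is b; thus E_w reaches every pair (a, b)
   with a regular. *)
pose pt := @Point K a (b *m invmx (W_val w)) d0.
have -> : b = pt_Vd (pact pt w) by rewrite /= mulmxKV // (W_unit zeta_prim).
have [->|wn1] := eqVneq w (W_one zeta); first exact: E1 pt.
exact: E0 w pt ws wn1.
Qed.

(** Both hypotheses pass from p to p/A because multiplication by A is injective on functions; the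
    n-th coefficient in A is reached after n divisions. *)
Lemma pbw_faithful p : commutes_coord (actH (pbw p)) ->
  pbw_coef p (W_one zeta) = 0 \/ actH (pbw p) const1 = 0 -> p = 0.
Proof.
suff coefs0 n : forall p, commutes_coord (actH (pbw p)) ->
    pbw_coef p (W_one zeta) = 0 \/ actH (pbw p) const1 = 0 ->
    forall w m, ((pbw_coef p w)@_m)`_n = 0.
  move=> pC p1; apply: pbw_eqP => w m; apply/polyP => n.
  by rewrite (coefs0 n p pC p1) /pbw_coef monalg.mcoeff0 mcoeff0 coef0.
elim: n => [|n IH] {}p pC p1 w m; first exact: pbw_coef_at0.
have pE := pbw_divX vH fH gH (pbw_coef_at0 pC p1); move: pE.
set p' := pbw_coef_map _ p => pE.
have TE phi : actH (pbw p) phi = 'X *: actH (pbw p') phi by rewrite -pE actHZ.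
have Xinj : injective (fun phi : Fun => 'X *: phi).
  move=> phi psi e; apply/funext => pt; have := congr1 (fun f : Fun => f pt) e.
  by apply: mulfI; rewrite polyX_eq0.
have d0 : drop_poly 1 (0 : KA) = 0 by rewrite raddf0.
have coefE := pbw_coef_mapE p _ _ d0.
have -> : ((pbw_coef p w)@_m)`_n.+1 = ((pbw_coef p' w)@_m)`_n.
  by rewrite coefE coef_drop_poly addn1.
apply: IH => [j phi|].
  apply: Xinj; apply: etrans (esym (TE _)) (etrans (pC _ _) _).
  by apply: etrans (congr1 _ (TE phi)) _; apply: coord_mulZ.
case: p1 => [p1|p1]; [left|right].
  by apply/mpolyP => m'; rewrite coefE p1 mcoeff0 d0.
by apply: Xinj; apply: etrans (esym (TE _)) (etrans p1 (esym (scaler0 _ _))).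
Qed.

(** An element with image 0 acts by 0, which trivially satisfies the hypotheses of [pbw_faithful].
    With [pbw_surj] this is the PBW theorem. *)
Lemma pbw_inj p q : pbw p = pbw q -> p = q.
Proof.
move=> e; apply/eqP; rewrite -subr_eq0; apply/eqP.
have e0 : pbw (p - q) = 0 by rewrite pbwB e subrr.
have act0 phi : actH (pbw (p - q)) phi = 0 by rewrite e0 actH0.
apply: pbw_faithful; last by right.
by move=> j phi; rewrite !act0 raddf0.
Qed.

Lemma pbw_invK p : pbw_inv vH fH gH (pbw p) = p.
Proof.
rewrite /pbw_inv; case: pselect => [ex|]; last by case; exists p.
by case: cid => /= q /pbw_inj.
Qed.

Lemma Trunc_pbw p : Trunc (pbw p) = pbw_coef p (W_one zeta).
Proof. by rewrite /Trunc /trunc pbw_invK. Qed.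

Lemma TruncB (h h' : H) : Trunc (h - h') = Trunc h - Trunc h'.
Proof.
have [p <-] := pbw_surj h; have [q <-] := pbw_surj h'.
apply: etrans (congr1 (@Trunc _ _ zeta_prim) (esym (pbwB _ _ _ p q))) _.
apply: etrans (Trunc_pbw (p - q)) _.
apply: etrans (monalg.mcoeffB _ _ _) _.
exact: esym (congr2 (fun a b => a - b) (Trunc_pbw p) (Trunc_pbw q)).
Qed.

Lemma actH_eq0 h : (forall phi, actH h phi = 0) -> h = 0.
Proof.
have [p <-] := pbw_surj h => h0.
rewrite (pbw_faithful (p := p)) ?pbw0 //; last by right.
by move=> j phi; rewrite !h0 raddf0.
Qed.

Lemma actH_inj h h' : (forall phi, actH h phi = actH h' phi) -> h = h'.
Proof.
by move=> e; apply: subr0_eq; apply: actH_eq0 => phi; rewrite actHB e subrr.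
Qed.

Lemma central_commutes z : z \in @central _ H -> commutes_coord (actH z).
Proof.
move=> /asboolP zC j phi; rewrite -!actH_f.
by apply: etrans (esym (actHM _ _ _)) (etrans _ (actHM _ _ _)); rewrite zC.
Qed.

Lemma central_Trunc0 z : z \in @central _ H -> Trunc z = 0 -> z = 0.
Proof.
have [p <-] := pbw_surj z => /central_commutes pC; rewrite Trunc_pbw => p1.
by rewrite (pbw_faithful pC) ?pbw0 //; left.
Qed.

Lemma central_act0 z : z \in @central _ H -> actH z const1 = 0 -> z = 0.
Proof.
have [p <-] := pbw_surj z => /central_commutes pC p1.
by rewrite (pbw_faithful pC) ?pbw0 //; right.
Qed.

(** * Central elements and the seven generators *)

Definition W_invariant (l : point -> KA) := forall w p, l (pact p w) = l p.

Lemma W_invariantP l : (forall p, l (pact p s0) = l p) ->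
  (forall p, l (pact p rho) = l p) -> W_invariant l.
Proof.
move=> ls lr; elim/(W_ind (zeta_prim := zeta_prim)) => [p|//|//|u v IHu IHv p].
  by rewrite pt_act1.
by rewrite pt_actM IHv IHu.
Qed.

Definition scalar_op (T : Fun -> Fun) := forall l phi, W_invariant l ->
  T (fun_mul l phi) = fun_mul l (T phi).

(** Every generator combines values of the function on a single W-orbit, where an invariant function
    is constant. *)
Lemma scalar_op_free (p : Free) :
  scalar_op (act p).
Proof.
move=> l phi lW.
have word m : act_word (gen_op zeta_prim) m (fun_mul l phi) =
              fun_mul l (act_word (gen_op zeta_prim) m phi).
  rewrite /act_word; elim: (m : seq _) => //= a s ->; move: (foldr _ _ _) => psi.
  case: a => [[j|j]|w] /=; apply/funext => pt; rewrite /fun_mul.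
  - rewrite !Dunkl_funE mulrDr mulrCA; congr (_ + _); rewrite [RHS]mulrCA [in RHS]mulr_sumr.
    by congr (_ * _); apply: eq_bigr => i _; rewrite lW mulrCA.
  - by rewrite !coord_mul_funE mulrCA.
  - by rewrite /translate lW.
apply/funext => pt; rewrite /fun_mul /act /act_free.
rewrite !monalg.mmapE mulr_sumr; apply: eq_bigr => m _.
by rewrite word /fun_mul mulrCA.
Qed.

Lemma scalar_op_H h : scalar_op (actH h).
Proof. exact: scalar_op_free. Qed.

(** Multiplication by an invariant function commutes with all operators of H, and H acts
    faithfully. *)
Lemma scalar_central h l : W_invariant l -> (forall phi, actH h phi = fun_mul l phi) ->
  h \in @central _ H.
Proof.
move=> lW hl; apply/asboolP => b; apply: actH_inj => phi.
apply: etrans (actHM _ _ _) (etrans _ (esym (actHM _ _ _))).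
apply: etrans (hl _) (etrans (esym (scalar_op_H b phi lW)) _).
by congr (actH b _); rewrite hl.
Qed.

Definition actR w q phi := actH (pbw_row w q) phi.
Definition actP p phi := actH (pbw p) phi.

Lemma actH_exp h T n phi : (forall psi, actH h psi = T psi) -> actH (h ^+ n) phi = iter n T phi.
Proof.
move=> hT; elim: n => [|n IH]; first by rewrite expr0 actH1.
by rewrite exprS actHM hT IH.
Qed.

Lemma actR_mono w a b c e phi : actR w (mono K a b c e) phi =
  iter a cX (iter b cY (translate w (iter c Dx (iter e Dy phi)))).
Proof.
rewrite /actR pbw_row_mono.
apply: etrans (actHM _ _ _) _; apply: etrans (actHM _ _ _) _; apply: etrans (actHM _ _ _) _.
rewrite (actH_exp _ _ (actH_f 0)) (actH_exp _ _ (actH_f 1)) actH_g.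
congr (iter a cX (iter b cY (translate w _))); apply: etrans (actHM _ _ _) _.
by rewrite (actH_exp _ _ (actH_v 0)) (actH_exp _ _ (actH_v 1)).
Qed.

Lemma actRD w q q' phi : actR w (q + q') phi = actR w q phi + actR w q' phi.
Proof. by rewrite /actR pbw_rowD; apply: actHD. Qed.

Lemma actRZ w c q phi : actR w (c *: q) phi = c *: actR w q phi.
Proof. by rewrite /actR pbw_rowZ; apply: actHZ. Qed.

Lemma actPU w q phi : actP (monalg.mkmalgU w q) phi = actR w q phi.
Proof. by rewrite /actP pbwU. Qed.

Lemma actPD p q phi : actP (p + q) phi = actP p phi + actP q phi.
Proof. by rewrite /actP pbwD; apply: actHD. Qed.

Lemma actP_sum (F : 'I_3 -> pbw_domain zeta) phi :
  actP (\sum_(i < 3) F i) phi = \sum_(i < 3) actP (F i) phi.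
Proof. by rewrite /actP pbw_sum; apply: actH_sum. Qed.

Lemma s_neq1 i : s_ i != W_one zeta.
Proof.
apply/eqP => /(congr1 (fun w : W => W_val w 0 0)); rewrite !mxE /= => /eqP.
by rewrite eq_sym oner_eq0.
Qed.

Definition gen_elt (q : polVV K) (F : 'I_3 -> polVV K) : pbw_domain zeta :=
  monalg.mkmalgU (W_one zeta) q + \sum_(i < 3) monalg.mkmalgU (s_ i) (F i).

Lemma Trunc_gen_elt q F : Trunc (pbw (gen_elt q F)) = q.
Proof.
apply: etrans (Trunc_pbw _) _.
rewrite /pbw_coef /gen_elt monalg.mcoeffD monalg.mcoeffUU raddf_sum big1 ?addr0 // => i _.
by rewrite /= monalg.mcoeffU (negbTE (s_neq1 i)).
Qed.

Lemma actP_gen_elt q F phi : actP (gen_elt q F) phi =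
  actR (W_one zeta) q phi + \sum_(i < 3) actR (s_ i) (F i) phi.
Proof.
rewrite /gen_elt actPD actPU actP_sum; congr (_ + _).
by apply: eq_bigr => i _; rewrite actPU.
Qed.

Lemma translate1 phi : translate (W_one zeta) phi = phi.
Proof. by apply/funext => p; rewrite /translate pt_act1. Qed.

(** The PBW coordinates of [eu_op], [a1_op], [a2_op]. The coefficient of the identity is the
    prescribed truncation; factors such as [0 * i] keep the shape of [refl_sum]. *)
Definition eu_elt := gen_elt (mono K 1 0 1 0 + mono K 0 1 0 1)
  (fun i => (- ('X * (zeta ^+ (0 * i))%:P)) *: mono K 0 0 0 0).
Definition a1_elt := gen_elt (mono K 0 1 2 0 + mono K 1 0 0 2)
  (fun i => ('X * (zeta ^+ (2 * i))%:P) *: mono K 0 0 1 0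
          + ('X * (zeta ^+ (1 * i))%:P) *: mono K 0 0 0 1).
Definition a2_elt := gen_elt (mono K 0 2 1 0 + mono K 2 0 0 1)
  (fun i => ('X * (zeta ^+ (1 * i))%:P) *: mono K 1 0 0 0
          + ('X * (zeta ^+ (2 * i))%:P) *: mono K 0 1 0 0).

Lemma eu_act phi : actP eu_elt phi = fun_mul lam_eu phi.
Proof.
rewrite -eu_scalar /eu_op actP_gen_elt actRD !actR_mono /= !translate1.
congr (_ + _); rewrite /refl_sum scaler_sumr -sumrN; apply: eq_bigr => i _.
by rewrite actRZ actR_mono /= scalerA scaleNr.
Qed.

Lemma a1_act phi : actP a1_elt phi = fun_mul lam_a1 phi.
Proof.
rewrite -a1_scalar /a1_op actP_gen_elt actRD !actR_mono /= !translate1.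
congr (_ + _); rewrite /refl_sum -big_split scaler_sumr; apply: eq_bigr => i _.
by rewrite actRD !actRZ !actR_mono /= scalerDr !scalerA.
Qed.

Lemma a2_act phi : actP a2_elt phi = fun_mul lam_a2 phi.
Proof.
rewrite -a2_scalar /a2_op actP_gen_elt actRD !actR_mono /= !translate1.
congr (_ + _); rewrite /refl_sum !raddf_sum -big_split scaler_sumr; apply: eq_bigr => i _.
by rewrite actRD !actRZ !actR_mono /= !coord_mulZ scalerDr !scalerA.
Qed.

Definition lam (p : point) : 7.-tuple KA :=
  [tuple lam_q p; lam_r p; lam_Q p; lam_R p; lam_eu p; lam_a1 p; lam_a2 p].

Lemma lam_relators p : all (pred1 0) (relators 'X (lam_q p) (lam_r p) (lam_Q p) (lam_R p)
  (lam_eu p) (lam_a1 p) (lam_a2 p)).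
Proof.
have sub0 (u v : KA) : u = v -> u - v == 0 by move=> ->; rewrite subrr.
have D0 := pt_disc_eval p.
apply/and5P; split; last rewrite /= andbT; apply: sub0; apply: poly_eval_inj => a;
  rewrite -?polyC_natr /lam_q /lam_r /lam_Q /lam_R /lam_eu /lam_a1 /lam_a2 !(hornE, horner_exp);
  move: D0; move: (X_ p) (Y_ p) (x_ p) (y_ p) => X Y x y D0; field; exact: D0.
Qed.

Lemma lam_s0 p : lam (pact p s0) = lam p.
Proof.
have D0 := pt_disc_eval p; have D0' : Y_ p ^+ 3 - X_ p ^+ 3 != 0.
  by rewrite -oppr_eq0 opprB.
have [eX eY ex ey] := pact_s0 zeta_prim p; apply: val_inj => /=.
rewrite /lam_q /lam_r /lam_Q /lam_R /lam_eu /lam_a1 /lam_a2 eX eY ex ey.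
congr [:: _; _; _; _; _; _; _]; apply: poly_eval_inj => a; rewrite !(hornE, horner_exp);
  move: D0 D0'; move: (X_ p) (Y_ p) (x_ p) (y_ p) => X Y x y D0 D0'; field; by rewrite ?D0 ?D0'.
Qed.

Lemma lam_rho p : lam (pact p rho) = lam p.
Proof.
have D0 := pt_disc_eval p; have z0 := zeta_neq0 zeta_prim.
have [eX eY ex ey] := pact_rho zeta_prim p; apply: val_inj => /=.
have z3 := zeta3 zeta_prim; have z3' : zeta^-1 ^+ 3 = 1 by rewrite exprVn z3 invr1.
have m1 u v : zeta * u * (zeta^-1 * v) = u * v :> K by rewrite mulrACA mulfV ?mul1r.
have m2 u v : zeta^-1 * u * (zeta * v) = u * v :> K by rewrite mulrACA mulVf ?mul1r.
have c1 u : (zeta * u) ^+ 3 = u ^+ 3 by rewrite exprMn z3 mul1r.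
have c2 u : (zeta^-1 * u) ^+ 3 = u ^+ 3 by rewrite exprMn z3' mul1r.
rewrite /lam_q /lam_r /lam_Q /lam_R /lam_eu /lam_a1 /lam_a2 eX eY ex ey.
rewrite -![9%:R * (zeta * _) * _]mulrA !(m1, m2, c1, c2).
have zV := zetaV zeta_prim.
congr [:: _; _; _; _; _; _; _]; apply: poly_eval_inj => a;
  rewrite !(hornE, horner_exp) ?zV; ring: z3.
Qed.

Lemma lam_invariant i : W_invariant (fun p => tnth (lam p) i).
Proof. by apply: W_invariantP => p; rewrite ?lam_s0 ?lam_rho. Qed.

Lemma fun_mul_comp (l l' : point -> KA) phi : fun_mul l (fun_mul l' phi) = fun_mul (fun p =>
  l p * l' p) phi.
Proof. by apply/funext => p; rewrite /fun_mul mulrA. Qed.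

Lemma fun_mulDl (l l' : point -> KA) phi : fun_mul l phi + fun_mul l' phi = fun_mul (fun p =>
  l p + l' p) phi.
Proof. by apply/funext => p; rewrite /fun_mul mulrDl. Qed.

Lemma coord_mul_fun_x phi : coord_mul (delta_mx 0 0) phi = fun_mul (fun p => (X_ p)%:P) phi.
Proof. by apply/funext => p; rewrite coord_mul_funE mulmx2E !mxE /= mul1r mul0r addr0. Qed.

Lemma coord_mul_fun_y phi : coord_mul (delta_mx 0 1) phi = fun_mul (fun p => (Y_ p)%:P) phi.
Proof. by apply/funext => p; rewrite coord_mul_funE mulmx2E !mxE /= mul1r mul0r add0r. Qed.

Definition gen_H : 7.-tuple H :=
  [tuple vH 0 * vH 1; vH 0 ^+ 3 + vH 1 ^+ 3; fH 0 * fH 1; fH 0 ^+ 3 + fH 1 ^+ 3;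
         pbw eu_elt; pbw a1_elt; pbw a2_elt].

Lemma gen_act i phi : actH (tnth gen_H i) phi = fun_mul (fun p => tnth (lam p) i) phi.
Proof.
case: i => [[|[|[|[|[|[|[|//]]]]]]] ?]; rewrite !(tnth_nth 0) /=.
- apply: etrans (actHM _ _ _) _; rewrite !actH_v; exact: Dx_Dy.
- apply: etrans (actHD _ _ _) _.
  apply: etrans (congr2 (fun a b => a + b) (actH_exp 3 phi (actH_v 0))
    (actH_exp 3 phi (actH_v 1))) _.
  exact: Dx3_Dy3.
- apply: etrans (actHM _ _ _) _; rewrite !actH_f coord_mul_fun_x coord_mul_fun_y.
  by rewrite fun_mul_comp; apply/funext => p; rewrite /fun_mul -polyCM.
- apply: etrans (actHD _ _ _) _.
  apply: etrans (congr2 (fun a b => a + b) (actH_exp 3 phi (actH_f 0))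
    (actH_exp 3 phi (actH_f 1))) _ => /=.
  rewrite !(coord_mul_fun_x, coord_mul_fun_y) !fun_mul_comp fun_mulDl.
  apply/funext => p; rewrite -[RHS]/(lam_R p * phi p) /fun_mul /lam_R polyCD !polyC_exp.
  by move: (phi p : KA) => g; ring.
- exact: eu_act.
- exact: a1_act.
- exact: a2_act.
Qed.

Lemma gen_central i : tnth gen_H i \in @central _ H.
Proof. exact: (scalar_central (lam_invariant i) (gen_act i)). Qed.

Definition gen_Z : 7.-tuple Z := [tuple Centre (gen_central i) | i < 7].

Definition evZ : {mpoly KA[7]} -> Z := mmap (in_alg Z) (tnth gen_Z).

Definition acts_by (z : Z) (l : point -> KA) := forall phi, actH (val z) phi = fun_mul l phi.

Lemma acts_byD z z' l l' : acts_by z l -> acts_by z' l' -> acts_by (z + z') (fun p => l p + l' p).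
Proof.
have e : val (z + z') = val z + val z' := raddfD _ z z'.
move=> zl zl' phi; apply: etrans (congr1 (fun h => actH h phi) e) (etrans (actHD _ _ _) _).
exact: etrans (congr2 (fun a b => a + b) (zl phi) (zl' phi)) (fun_mulDl _ _ _).
Qed.

Lemma acts_byM z z' l l' : acts_by z l -> acts_by z' l' -> acts_by (z * z') (fun p => l p * l' p).
Proof.
have e : val (z * z') = val z * val z' := rmorphM _ z z'.
move=> zl zl' phi; apply: etrans (congr1 (fun h => actH h phi) e) (etrans (actHM _ _ _) _).
exact: etrans (congr1 (actH (val z)) (zl' phi)) (etrans (zl _) (fun_mul_comp _ _ _)).
Qed.

Lemma acts_by1 : acts_by 1 (fun=> 1).
Proof.
by move=> phi; apply: etrans (actH1 _) _; apply/funext => p; rewrite /fun_mul mul1r.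
Qed.

Lemma acts_by0 : acts_by 0 (fun=> 0).
Proof.
by move=> phi; apply: etrans (actH0 _) _; apply/funext => p; rewrite /fun_mul mul0r.
Qed.

Lemma acts_byZ c z l : acts_by z l -> acts_by (c *: z) (fun p => c * l p).
Proof.
move=> zl phi; apply: etrans (actHZ _ _ _) _; rewrite zl.
by apply/funext => p; rewrite scale_funE /fun_mul mulrA.
Qed.

Lemma acts_byX z l n : acts_by z l -> acts_by (z ^+ n) (fun p => l p ^+ n).
Proof.
move=> zl; elim: n => [|n IH]; first exact: acts_by1.
move=> phi; rewrite exprS; apply: etrans (acts_byM zl IH phi) _.
by apply/funext => p; rewrite /fun_mul exprS.
Qed.

Lemma acts_by_ext z l l' : l =1 l' -> acts_by z l -> acts_by z l'.
Proof. by move=> e zl phi; rewrite zl; apply/funext => p; rewrite /fun_mul e. Qed.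

Lemma acts_by_prod (I : Type) (r : seq I) (F : I -> Z) (l : I -> point -> KA) :
  (forall i, acts_by (F i) (l i)) ->
  acts_by (\prod_(i <- r) F i) (fun p => \prod_(i <- r) l i p).
Proof.
move=> Fl; elim: r => [|i r IH].
  by rewrite big_nil; apply: acts_by_ext acts_by1 => p; rewrite big_nil.
by rewrite big_cons; apply: acts_by_ext (acts_byM (Fl i) IH) => p; rewrite big_cons.
Qed.

Lemma acts_by_sum (I : Type) (r : seq I) (F : I -> Z) (l : I -> point -> KA) :
  (forall i, acts_by (F i) (l i)) ->
  acts_by (\sum_(i <- r) F i) (fun p => \sum_(i <- r) l i p).
Proof.
move=> Fl; elim: r => [|i r IH].
  by rewrite big_nil; apply: acts_by_ext acts_by0 => p; rewrite big_nil.
by rewrite big_cons; apply: acts_by_ext (acts_byD (Fl i) IH) => p; rewrite big_cons.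
Qed.

Lemma gen_Z_act i : acts_by (tnth gen_Z i) (fun p => tnth (lam p) i).
Proof. by move=> phi; rewrite tnth_mktuple; apply: gen_act. Qed.

Lemma evZ_act p : acts_by (evZ p) (fun pt => p.@[tnth (lam pt)]).
Proof.
apply: (acts_by_ext (l := fun pt => \sum_(m <- msupp p) p@_m * \prod_i tnth (lam pt) i ^+ m i)).
  by move=> pt; rewrite mevalE.
apply: acts_by_sum => m; rewrite /= mulr_algl; apply: acts_byZ.
by apply: acts_by_prod => i; apply/acts_byX/gen_Z_act.
Qed.

(** * The relations between the generators *)

Lemma acts_by_eq0 z : acts_by z (fun=> 0) -> z = 0.
Proof.
move=> z0; apply: val_inj; apply: etrans (actH_eq0 _) (esym (raddf0 _)) => phi.
by rewrite z0; apply/funext => p; rewrite /fun_mul mul0r.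
Qed.

(** Faithfulness gives one direction; applying the element to the constant function 1 recovers the
    function and gives the other. *)
Lemma evZ_eq0 p : evZ p = 0 <-> forall pt, p.@[tnth (lam pt)] = 0.
Proof.
split=> [e pt|e]; last first.
  by apply: acts_by_eq0; apply: acts_by_ext (evZ_act p) => pt; apply: e.
have := congr1 (fun f : Fun => f pt) (evZ_act p (fun=> 1)); rewrite e.
by rewrite [LHS](congr1 (fun f : Fun => f pt) (actH0 _)) /fun_mul mulr1.
Qed.

(* The six points (u, v) over a given (q, r) = (uv, u^3 + v^3) are the images of (x, y) under
   the dihedral group. *)
Lemma independence_at (X Y x y p0 p1 p2 p3 p4 p5 : K) :
  X ^+ 3 - Y ^+ 3 != 0 -> x ^+ 3 - y ^+ 3 != 0 ->
  (forall u v, u * v = x * y -> u ^+ 3 + v ^+ 3 = x ^+ 3 + y ^+ 3 ->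
    p0 + p1 * (u * X + v * Y) + p2 * (u * X + v * Y) ^+ 2 + p3 * (u * X + v * Y) ^+ 3
    + p4 * (u ^+ 2 * Y + v ^+ 2 * X) + p5 * (u * Y ^+ 2 + v * X ^+ 2) = 0) ->
  [/\ [/\ p0 = 0, p1 = 0 & p2 = 0] & [/\ p3 = 0, p4 = 0 & p5 = 0]].
Proof.
move=> D0 d0 E; move: (zeta3 zeta_prim) (zeta_sum zeta_prim).
move: (zeta) => z z3 z2; pose z' := z ^+ 2.
have n3 : (3%:R : K) != 0 by rewrite pnatr_eq0.
have zz' : z * z' = 1 by rewrite /z' -exprS.
have z'3 : z' ^+ 3 = 1 by rewrite /z' -exprM mulnC exprM z3 expr1n.
have cancel (a b : K) : a != 0 -> a * b = 0 -> b = 0.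
  by move=> a0 /eqP; rewrite mulf_eq0 (negbTE a0) => /eqP.
pose e u v := p0 + p1 * (u * X + v * Y) + p2 * (u * X + v * Y) ^+ 2
  + p3 * (u * X + v * Y) ^+ 3 + p4 * (u ^+ 2 * Y + v ^+ 2 * X)
  + p5 * (u * Y ^+ 2 + v * X ^+ 2).
have eP u v : u * v = x * y -> u ^+ 3 + v ^+ 3 = x ^+ 3 + y ^+ 3 -> e u v = 0 by apply: E.
have rot (u v c c' : K) : c * c' = 1 -> c ^+ 3 = 1 -> c' ^+ 3 = 1 ->
    u * v = x * y -> u ^+ 3 + v ^+ 3 = x ^+ 3 + y ^+ 3 -> e (c * u) (c' * v) = 0.
  move=> cc c3 c'3 uv u3v3; apply: eP; first by rewrite mulrACA cc mul1r.
  by rewrite !exprMn c3 c'3 !mul1r.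
have one3 : (1 : K) ^+ 3 = 1 by rewrite expr1n.
have z'z : z' * z = 1 by rewrite mulrC.
have yx := mulrC y x; have y3x3 := addrC (y ^+ 3) (x ^+ 3).
have E0 := rot x y 1 1 (mulr1 _) one3 one3 erefl erefl.
have E1 := rot x y z z' zz' z3 z'3 erefl erefl.
have E2 := rot x y z' z z'z z'3 z3 erefl erefl.
have F0 := rot y x 1 1 (mulr1 _) one3 one3 yx y3x3.
have F1 := rot y x z z' zz' z3 z'3 yx y3x3.
have F2 := rot y x z' z z'z z'3 z3 yx y3x3.
move: E0 E1 E2 F0 F1 F2 {E eP rot}.
set e0 := e (1 * x) _; set e1 := e (z * x) _; set e2 := e (z' * x) _.
set f0 := e (1 * y) _; set f1 := e (z * y) _; set f2 := e (z' * y) _.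
move=> E0 E1 E2 F0 F1 F2.
(* Summing over the rotations keeps weight 0. Of what is left only the cubic term, x^3 X^3 + y^3
   Y^3, changes when x and y are exchanged, and the difference is (X^3 - Y^3)(x^3 - y^3). *)
have p30 : p3 = 0.
  apply: (cancel (3%:R * ((X ^+ 3 - Y ^+ 3) * (x ^+ 3 - y ^+ 3)))); first by rewrite !mulf_neq0.
  transitivity (e0 + e1 + e2 - f0 - f1 - f2); last by rewrite E0 E1 E2 F0 F1 F2 !subr0 !addr0.
  by rewrite /e0 /e1 /e2 /f0 /f1 /f2 /e /z'; ring: z3 z2.
(* Fourier components over the three rotations, of (x, y) for the e's and of (y, x) for the f's:
   each twisted sum keeps the terms of one weight. *)
have w0 : p0 + 2%:R * (x * y * X * Y) * p2 = 0.
  apply: (cancel 3%:R) => //.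
  transitivity (e0 + e1 + e2); last by rewrite E0 E1 E2 !addr0.
  by rewrite /e0 /e1 /e2 /e /z' p30; ring: z3 z2.
have w1 : X * (x * p1 + y ^+ 2 * p4) + Y ^+ 2 * (y ^+ 2 * p2 + x * p5) = 0.
  apply: (cancel 3%:R) => //.
  transitivity (e0 + z ^+ 2 * e1 + z * e2); last by rewrite E0 E1 E2 !mulr0 !addr0.
  by rewrite /e0 /e1 /e2 /e /z' p30; ring: z3 z2.
have w2 : Y * (y * p1 + x ^+ 2 * p4) + X ^+ 2 * (x ^+ 2 * p2 + y * p5) = 0.
  apply: (cancel 3%:R) => //.
  transitivity (e0 + z * e1 + z ^+ 2 * e2); last by rewrite E0 E1 E2 !mulr0 !addr0.
  by rewrite /e0 /e1 /e2 /e /z' p30; ring: z3 z2.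
have w3 : X * (y * p1 + x ^+ 2 * p4) + Y ^+ 2 * (x ^+ 2 * p2 + y * p5) = 0.
  apply: (cancel 3%:R) => //.
  transitivity (f0 + z ^+ 2 * f1 + z * f2); last by rewrite F0 F1 F2 !mulr0 !addr0.
  by rewrite /f0 /f1 /f2 /e /z' p30; ring: z3 z2.
have w4 : Y * (x * p1 + y ^+ 2 * p4) + X ^+ 2 * (y ^+ 2 * p2 + x * p5) = 0.
  apply: (cancel 3%:R) => //.
  transitivity (f0 + z * f1 + z ^+ 2 * f2); last by rewrite F0 F1 F2 !mulr0 !addr0.
  by rewrite /f0 /f1 /f2 /e /z' p30; ring: z3 z2.
(* The equations pair off into 2 x 2 systems of determinant X^3 - Y^3, and their solutions into
   systems of determinant x^3 - y^3. *)
have solve u v : X * u + Y ^+ 2 * v = 0 -> Y * u + X ^+ 2 * v = 0 -> u = 0 /\ v = 0.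
  move=> h1 h2; split; apply: (cancel _ _ D0).
    transitivity (X ^+ 2 * (X * u + Y ^+ 2 * v) - Y ^+ 2 * (Y * u + X ^+ 2 * v)); first by ring.
    by rewrite h1 h2 !mulr0 subr0.
  transitivity (X * (Y * u + X ^+ 2 * v) - Y * (X * u + Y ^+ 2 * v)); first by ring.
  by rewrite h1 h2 !mulr0 subr0.
have [u0 v0] := solve _ _ w1 w4; have [u0' v0'] := solve _ _ w3 w2.
have solve' a b : x * a + y ^+ 2 * b = 0 -> y * a + x ^+ 2 * b = 0 -> a = 0 /\ b = 0.
  move=> h1 h2; split; apply: (cancel _ _ d0).
    transitivity (x ^+ 2 * (x * a + y ^+ 2 * b) - y ^+ 2 * (y * a + x ^+ 2 * b)); first by ring.
    by rewrite h1 h2 !mulr0 subr0.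
  transitivity (x * (y * a + x ^+ 2 * b) - y * (x * a + y ^+ 2 * b)); first by ring.
  by rewrite h1 h2 !mulr0 subr0.
have [p10 p40] := solve' _ _ u0 u0'.
have [p50 p20] := solve' p5 p2 (etrans (addrC _ _) v0) (etrans (addrC _ _) v0').
by move: w0; rewrite p20 mulr0 addr0.
Qed.

(** The cubes of x and y are to be the roots of T^2 - r T + q^3. Take t one root, x a cube root of
    it and y = q/x; if t = 0 then q = 0, and x = 0 works. *)
Lemma sum_cubes_surj (q r : K) : exists x y, x * y = q /\ x ^+ 3 + y ^+ 3 = r.
Proof.
pose t := (r + sqrtC (r ^+ 2 - 4%:R * q ^+ 3)) / 2%:R.
have n2 : (2%:R : K) != 0 by rewrite pnatr_eq0.
have tE : t * (r - t) = q ^+ 3.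
  have s2 := sqrtCK (r ^+ 2 - 4%:R * q ^+ 3); rewrite /t; move: (sqrtC _) s2 => s s2.
  have -> : (r + s) / 2%:R * (r - (r + s) / 2%:R) = (r ^+ 2 - s ^+ 2) / (2%:R * 2%:R) by field.
  by rewrite s2; field.
have [t0|t0] := eqVneq t 0.
  move: tE; rewrite t0 mul0r => /esym/eqP; rewrite expf_eq0 /= => /eqP q0.
  by exists 0, (3.-root r); rewrite mul0r q0 rootCK // expr0n add0r.
have x0 : 3.-root t != 0 by rewrite rootC_eq0.
exists (3.-root t), (q / 3.-root t); split; first by rewrite mulrCA mulfV ?mulr1.
by rewrite expr_div_n rootCK // -tE mulrAC mulfV // mul1r addrC subrK.
Qed.

Local Notation basis_at pt := (module_basis ((lam pt)`_4) ((lam pt)`_5) ((lam pt)`_6)).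

Definition point_of (X Y x y : K) (D0 : X ^+ 3 - Y ^+ 3 != 0) : point.
Proof.
refine (@Point K (\col_j (if j == 0 then X else Y)) (\row_j (if j == 0 then x else y)) _).
by rewrite /disc !mxE.
Defined.

(** At A = 0 a value v of (q, r, Q, R) fixes the six coefficients as numbers, while every (u, w)
    with the prescribed q and r gives a point above v with X, Y unchanged; [independence_at] then
    applies. The factor D excludes the degenerate values. *)
Lemma basis_indep0 (P : 'I_6 -> {mpoly KA[4]}) :
  (forall pt, \sum_(i < 6) (P i).@[fun j : 'I_4 => (lam pt)`_j] * (basis_at pt)`_i = 0) ->
  forall i m, ((P i)@_m)`_0 = 0.
Proof.
move=> P0; pose P' i := map_mpoly (horner_eval (0 : K)) (P i).
(* The two discriminants r^2 - 4 q^3 = (x^3 - y^3)^2 and R^2 - 4 Q^3 = (X^3 - Y^3)^2. *)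
pose D : {mpoly K[4]} := ('X_(inord 1) ^+ 2 - 4%:R * 'X_(inord 0) ^+ 3)
   * ('X_(inord 3) ^+ 2 - 4%:R * 'X_(inord 2) ^+ 3).
have DE v : D.@[v] = (v (inord 1) ^+ 2 - 4%:R * v (inord 0) ^+ 3)
   * (v (inord 3) ^+ 2 - 4%:R * v (inord 2) ^+ 3).
  by rewrite /D !(mevalM, mevalB, rmorphXn, rmorph_nat) /= !mevalXU.
have PD i : P' i * D = 0.
  apply: mpoly_eval_eq0 => v; rewrite mevalM DE.
  have [x [y [xy x3y3]]] := sum_cubes_surj (v (inord 0)) (v (inord 1)).
  have [X [Y [XY X3Y3]]] := sum_cubes_surj (v (inord 2)) (v (inord 3)).
  have discE (a b : K) : (a ^+ 3 + b ^+ 3) ^+ 2 - 4%:R * (a * b) ^+ 3 = (a ^+ 3 - b ^+ 3) ^+ 2.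
    by ring.
  rewrite -xy -x3y3 -XY -X3Y3 !discE.
  have [d0|d0] := eqVneq (x ^+ 3 - y ^+ 3) 0; first by rewrite d0 expr0n /= mul0r mulr0.
  have [D0|D0] := eqVneq (X ^+ 3 - Y ^+ 3) 0; first by rewrite D0 expr0n /= !mulr0.
  suff : forall j, (P' j).@[v] = 0 by move=> ->; rewrite mul0r.
  pose p k := (P' (inord k)).@[v].
  have E u w : u * w = x * y -> u ^+ 3 + w ^+ 3 = x ^+ 3 + y ^+ 3 ->
    p 0%N + p 1%N * (u * X + w * Y) + p 2%N * (u * X + w * Y) ^+ 2 + p 3%N * (u * X + w * Y) ^+ 3
    + p 4%N * (u ^+ 2 * Y + w ^+ 2 * X) + p 5%N * (u * Y ^+ 2 + w * X ^+ 2) = 0.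
    move=> uw u3w3; pose pt := point_of u w D0.
    have cE : [/\ X_ pt = X, Y_ pt = Y, x_ pt = u & y_ pt = w] by split; rewrite !mxE.
    have lam0 j : ((lam pt)`_(j : 'I_4)).[0] = v j.
      case: cE => eX eY ex ey; case: j => [[|[|[|[|//]]]] j4] /=;
        rewrite /lam_q /lam_r /lam_Q /lam_R ?eX ?eY ?ex ?ey !(hornE,
          horner_exp) ?expr0n /= ?mul0r ?subr0 ?addr0
        ?uw ?u3w3 ?xy ?x3y3 ?XY ?X3Y3; congr v; apply: val_inj; rewrite /= inordK //.
    have PE i' : (((P i').@[fun j : 'I_4 => (lam pt)`_j]) : KA).[0] = (P' i').@[v].
      by rewrite meval_horner0; apply: meval_eq.
    have := congr1 (fun q : KA => q.[0]) (P0 pt); rewrite horner_sum horner0 => <-.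
    rewrite (eq_bigr (fun i' : 'I_6 => p i' * ((basis_at pt)`_i').[0])) => [|i' _]; last first.
      by rewrite hornerM PE /p inord_val.
    rewrite !big_ord_recl big_ord0 /= /bump /= !add1n.
    case: cE => eX eY ex ey; rewrite /lam_eu /lam_a1 /lam_a2 eX eY ex ey.
    rewrite !(hornE, horner_exp) ?horner1.
    by move: (p 0%N) (p 1%N) (p 2%N) (p 3%N) (p 4%N) (p 5%N) => *; ring.
  have [[q0 q1 q2] [q3 q4 q5]] := independence_at D0 d0 E.
  suff p_0 : forall j : 'I_6, p j = 0 by move=> j; rewrite -(p_0 j) /p inord_val.
  move: (p) q0 q1 q2 q3 q4 q5 => g q0 q1 q2 q3 q4 q5.
  by case=> [[|[|[|[|[|[|//]]]]]] ?].
move=> i m; have /eqP := PD i; rewrite mulf_eq0 => /orP[/eqP Pi0|/eqP D0].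
  have := congr1 (fun q : {mpoly K[4]} => q@_m) Pi0.
  by rewrite /= mcoeff_map_mpoly mcoeff0 /= /horner_eval horner_coef0.
(* D is nonzero: it equals 1 at q = Q = 0, r = R = 1. *)
have := DE (fun j => (j == inord 1)%:R + (j == inord 3)%:R).
rewrite D0 meval0 -!val_eqE /= !inordK //= !(addr0, add0r) !(expr1n, expr0n) /= !(mulr0,
  subr0, mulr1).
by move/eqP; rewrite eq_sym oner_eq0.
Qed.

Lemma basis_indep (P : 'I_6 -> {mpoly KA[4]}) :
  (forall pt, \sum_(i < 6) (P i).@[fun j : 'I_4 => (lam pt)`_j] * (basis_at pt)`_i = 0) ->
  forall i, P i = 0.
Proof.
move=> P0 i; apply/mpolyP => m; rewrite mcoeff0; apply/polyP => n; rewrite coef0.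
elim: n P P0 i m => [|n IH] P P0 i m; first exact: basis_indep0.
have c0 := basis_indep0 P0.
have d0 : drop_poly 1 (0 : KA) = 0 by rewrite raddf0.
pose P' i := mpoly_coef_map (drop_poly 1) (P i).
have PE j : P j = 'X *: P' j.
  by apply/mpolyP => m'; rewrite mcoeffZ mcoeff_coef_map // drop_polyX.
have -> : ((P i)@_m)`_n.+1 = ((P' i)@_m)`_n by rewrite mcoeff_coef_map // coef_drop_poly addn1.
apply: IH => pt; apply: (mulfI (_ : 'X != 0 :> KA)); first by rewrite polyX_eq0.
rewrite mulr0 -[RHS](P0 pt) mulr_sumr; apply: eq_bigr => j _.
by rewrite PE mevalZ mulrA.
Qed.

Local Notation x7 k := ('X_(inord k) : {mpoly KA[7]}).
Local Notation rels7 := (relators ('X : KA)%:MP_[7] (x7 0%N) (x7 1%N) (x7 2%N) (x7 3%N) (x7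
  4%N) (x7 5%N) (x7 6%N)).

Lemma rels7_eval pt k : (rels7`_k).@[tnth (lam pt)] = 0.
Proof.
have [k5|k5] := ltnP k (size rels7); last by rewrite nth_default // meval0.
rewrite -(nth_map 0 0 (meval (tnth (lam pt)))) // map_relators /= mevalC !mevalXU !(tnth_nth
  0) !inordK //.
have /allP/(_ ((relators ('X : KA) (lam_q pt) (lam_r pt) (lam_Q pt) (lam_R pt)
  (lam_eu pt) (lam_a1 pt) (lam_a2 pt))`_k)) := lam_relators pt.
by move=> /(_ (mem_nth _ _))/eqP; apply.
Qed.

Definition base_embed (P : {mpoly KA[4]}) : {mpoly KA[7]} :=
  P \mPo [tuple x7 i | i < 4].

(** Reduce p to its normal form modulo the relators. These vanish at every [lam pt], so the normal
    form vanishes there too, and independence makes its six coefficients zero; what remains of p is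
    a combination of relators. *)
Lemma eval_kernel (p : {mpoly KA[7]}) :
  (forall pt, p.@[tnth (lam pt)] = 0) <->
  exists c : 'I_(size rels7) -> {mpoly KA[7]}, p = \sum_(i < size rels7) c i * rels7`_i.
Proof.
split=> [p0|[c ->] pt]; last first.
  rewrite (big_morph (meval (tnth (lam pt))) (mevalD _) (meval0 _)) big1 // => i _.
  by rewrite mevalM rels7_eval mulr0.
(* The constants supply A, so this image of the polynomials in q, r, Q, R is the coefficient ring of
   the reduction. *)
pose B s := exists P, s = base_embed P.
have Bsub : [/\ B 1, forall s, B s -> B (- s), forall s t, B s -> B t -> B (s + t)
    & forall s t, B s -> B t -> B (s * t)].
  split; first by exists 1; rewrite /base_embed rmorph1.
  - by move=> _ [P ->]; exists (- P); rewrite /base_embed rmorphN.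
  - by move=> _ _ [P ->] [P' ->]; exists (P + P'); rewrite /base_embed rmorphD.
  - by move=> _ _ [P ->] [P' ->]; exists (P * P'); rewrite /base_embed rmorphM.
have BC c : B c%:MP by exists c%:MP; rewrite /base_embed comp_mpolyC.
have BX k : (k < 4)%N -> B (x7 k).
  move=> k4; exists 'X_(Ordinal k4).
  by rewrite /base_embed comp_mpolyXU -tnth_nth tnth_mktuple.
have [B1 BN BD BM] := Bsub.
have BA := BC 'X; have Bq := BX 0%N isT; have Br := BX 1%N isT.
have BQ := BX 2%N isT; have BR := BX 3%N isT.
pose red := reducible ('X : KA)%:MP_[7] (x7 0%N) (x7 1%N) (x7 2%N) (x7 3%N)
  (x7 4%N) (x7 5%N) (x7 6%N) B.
have red_var i x : red x -> red ('X_i * x).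
  have base k : (k < 4)%N -> red x -> red (x7 k * x) by move=> k4; apply/Red_base/BX.
  have -> : i = inord i by rewrite inord_val.
  case: i => [[|[|[|[|[|[|[|//]]]]]]] i7] /=; try exact: base.
  - by move=> rx; apply: red_mul_e.
  - by move=> rx; apply: red_mul_a1.
  by move=> rx; apply: red_mul_a2.
have red_exp i n x : red x -> red ('X_i ^+ n * x).
  move=> rx; elim: n => [|n IH]; first by rewrite expr0 mul1r.
  by rewrite exprS -mulrA; apply: red_var.
have red_mono m (r : seq 'I_7) : red (\prod_(i <- r) 'X_i ^+ m i).
  elim: r => [|i r IH]; first by rewrite big_nil; apply: (Red_basis _ _ _ _ _ _ _ _ _ 0).
  by rewrite big_cons; apply: red_exp.
have red_p : red p.
  rewrite [p]mpolyE; elim/big_ind: _ => [||m _].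
  - by rewrite -[0](mul0r 1) -mpolyC0; apply: Red_base (BC 0) _;
    apply: (Red_basis _ _ _ _ _ _ _ _ _ 0).
  - exact: Red_add.
  by rewrite -mul_mpolyC mpolyXE_id; apply: Red_base (BC _) (red_mono _ _).
have [P [c [BP pE]]] := reducibleP B1 BN BD BM red_p.
have /fin_all_exists[P' P'E] : forall i, exists P', P i = base_embed P' by exact: BP.
have P'0 : forall i, P' i = 0.
  apply: basis_indep => pt; have := p0 pt; rewrite pE mevalD.
  rewrite [X in _ + X](big_morph (meval (tnth (lam pt))) (mevalD _) (meval0 _)).
  rewrite [X in _ + X]big1 ?addr0 => [|k _]; last by rewrite mevalM rels7_eval mulr0.
  rewrite (big_morph (meval (tnth (lam pt))) (mevalD _) (meval0 _)) => e.
  rewrite -[RHS]e; apply: eq_bigr => i _; rewrite mevalM P'E; congr (_ * _).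
    rewrite /base_embed comp_mpoly_meval; apply: meval_eq => j.
    rewrite tnth_mktuple mevalXU (tnth_nth 0) inordK //.
    by apply: leq_trans (ltn_ord j) _.
  rewrite -(nth_map 0 0 (meval (tnth (lam pt)))) //.
  by rewrite /module_basis /= meval1 !rmorphXn /= !mevalXU !(tnth_nth 0) !inordK.
by exists c; rewrite pE big1 ?add0r // => i _; rewrite P'E P'0 /base_embed rmorph0 mul0r.
Qed.

(** * Generation of Z by averaging over W *)

Definition average (psi : Fun) : Fun := fun p => (6%:R^-1)%:P *
  (psi p + psi (pact p rho) + psi (pact (pact p rho) rho)
   + (psi (pact p s0) + psi (pact (pact p s0) rho) + psi (pact (pact (pact p s0) rho) rho))).

Definition is_poly (l : point -> KA) := exists P : {mpoly KA[7]}, forall p, l p =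
  P.@[tnth (lam p)].

Definition avg_poly (psi : Fun) := is_poly (average psi).

Lemma is_polyD l l' : is_poly l -> is_poly l' -> is_poly (fun p => l p + l' p).
Proof. by move=> [P e] [P' e']; exists (P + P') => p; rewrite mevalD e e'. Qed.
Lemma is_polyM l l' : is_poly l -> is_poly l' -> is_poly (fun p => l p * l' p).
Proof. by move=> [P e] [P' e']; exists (P * P') => p; rewrite mevalM e e'. Qed.
Lemma is_polyN l : is_poly l -> is_poly (fun p => - l p).
Proof. by move=> [P e]; exists (- P) => p; rewrite mevalN e. Qed.
Lemma is_polyC c : is_poly (fun=> c).
Proof. by exists c%:MP => p; rewrite mevalC. Qed.
Lemma is_poly_lam i : is_poly (fun p => tnth (lam p) i).
Proof. by exists 'X_i => p; rewrite mevalXU. Qed.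
Lemma is_poly_ext l l' : l =1 l' -> is_poly l -> is_poly l'.
Proof. by move=> e [P eP]; exists P => p; rewrite -e. Qed.

Lemma lamE i p (i7 : (i < 7)%N) : tnth (lam p) (Ordinal i7) = (lam p)`_i.
Proof. by rewrite (tnth_nth 0). Qed.

Lemma is_poly_lamn i : (i < 7)%N -> is_poly (fun p => (lam p)`_i).
Proof. by move=> i7; apply: is_poly_ext (is_poly_lam (Ordinal i7)) => p; rewrite lamE. Qed.

Lemma avg_polyD psi psi' : avg_poly psi -> avg_poly psi' -> avg_poly (psi + psi').
Proof.
move=> h h'; apply: is_poly_ext (is_polyD h h') => p.
by rewrite /average !add_funE; ring.
Qed.

Lemma avg_poly_mul l psi : W_invariant l -> is_poly l -> avg_poly psi -> avg_poly (fun_mul l psi).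
Proof.
move=> lW lp h; apply: is_poly_ext (is_polyM lp h) => p.
by rewrite /average /fun_mul !lW; ring.
Qed.

Lemma avg_polyZ c psi : avg_poly psi -> avg_poly (c *: psi).
Proof. by move=> h; apply: (avg_poly_mul (l := fun=> c)) h; [|exact: is_polyC]. Qed.

Lemma avg_poly0 : avg_poly 0.
Proof.
by apply: is_poly_ext (is_polyC 0) => p;
  rewrite /average -[(0 : Fun) _]/(0 : KA) -[(0 : Fun) _]/(0 : KA) !addr0 mulr0.
Qed.

(** For k = 1, 2 the sum 1 + zeta^k + zeta^(2k) vanishes, so the average is 0. *)
Lemma weight_average_eq0 k psi : (0 < k < 3)%N -> has_weight k psi -> avg_poly psi.
Proof.
move=> /andP[k0 k3] wk; apply: is_poly_ext (is_polyC 0) => p; apply: poly_eval_inj => a.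
have z2 := zeta_sum zeta_prim; have z3 := zeta3 zeta_prim.
rewrite /average !wk !hornE; case: k k0 k3 wk => [|[|[|//]]] // _ _ _;
  by rewrite ?horner0; move: (horner _ a) (horner _ a) => f g; ring: z3 z2.
Qed.

(** For weight 0 the six terms are two values, each taken three times, so the explicit cases involve
    only p and p.s_0. *)
Lemma weight0_average psi l : has_weight 0 psi -> is_poly l ->
  (forall p a, (psi p : KA).[a] + (psi (pact p s0) : KA).[a] = (l p).[a]) -> avg_poly psi.
Proof.
move=> w0 lp e; apply: is_poly_ext (is_polyM (is_polyC (2%:R^-1)%:P) lp) => p.
apply: poly_eval_inj => a; rewrite /average !w0 expr0 !hornE -e.
have n2 : (2%:R : K) != 0 by rewrite pnatr_eq0.
move: (horner _ a) (horner _ a) => f g; field.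
by rewrite ?pnatr_eq0.
Qed.

Definition coord_mono (a b : nat) : point -> KA := fun p => (X_ p ^+ a * Y_ p ^+ b)%:P.

Definition dunkl_mono (c e : nat) : Fun := iter c Dx (iter e Dy const1).

(* A record, so that comparing two instances never unfolds the averages. *)
Record averageable (a b c e : nat) : Prop :=
  Averageable { averageableP : avg_poly (fun_mul (coord_mono a b) (dunkl_mono c e)) }.

Lemma weight_const1 : has_weight 0 const1.
Proof. by move=> p; rewrite expr0 mul1r. Qed.

Lemma weight_dunkl_mono c e : has_weight ((2 * c + e) %% 3) (dunkl_mono c e).
Proof.
rewrite /dunkl_mono; elim: c => [|c IH] /=; last first.
  have -> : ((2 * c.+1 + e) %% 3 = ((2 * c + e) %% 3 + 2) %% 3)%N by lia.
  by apply: weight_Dx; rewrite ?ltn_mod.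
elim: e => [|e IH] /=; first exact: weight_const1.
have -> : ((2 * 0 + e.+1) %% 3 = ((2 * 0 + e) %% 3).+1 %% 3)%N by lia.
by apply: weight_Dy; rewrite ?ltn_mod.
Qed.

Lemma weight_coord_mono k a b psi : has_weight k psi ->
  has_weight ((k + a + 2 * b) %% 3) (fun_mul (coord_mono a b) psi).
Proof.
move=> wk p; have [eX eY _ _] := pact_rho zeta_prim p.
have z3 := zeta3 zeta_prim.
rewrite /fun_mul wk /coord_mono eX eY (zetaV zeta_prim) !exprMn mulrCA mulrA [RHS]mulrA -!polyCM.
congr (_%:P * _); rewrite expr_mod // (_ : 2 * b = b + b)%N ?exprD; last by lia.
by ring.
Qed.

(** X and the operator of y have weight 1, Y and the operator of x weight 2; outside total weight 0
    the average vanishes. *)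
Lemma averageable_weight a b c e : ((2 * c + e + a + 2 * b) %% 3 != 0)%N -> averageable a b c e.
Proof.
move=> n0; apply: Averageable;
  apply: weight_average_eq0 (weight_coord_mono a b (weight_dunkl_mono c e)).
by lia.
Qed.

Lemma averageable_weight0 a b c e l : is_poly l -> ((2 * c + e + a + 2 * b) %% 3 = 0)%N ->
  (forall p s, X_ p ^+ a * Y_ p ^+ b * (dunkl_mono c e p : KA).[s]
    + Y_ p ^+ a * X_ p ^+ b * (dunkl_mono c e (pact p s0) : KA).[s] = (l p).[s]) ->
  averageable a b c e.
Proof.
move=> lp w0 e0; apply: Averageable; apply: (weight0_average (l := l)) => // [|p s].
  have := weight_coord_mono a b (weight_dunkl_mono c e).
  by have -> : (((2 * c + e) %% 3 + a + 2 * b) %% 3 = 0)%N by lia.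
have [eX eY _ _] := pact_s0 zeta_prim p.
by rewrite -e0 /fun_mul !hornerM /coord_mono eX eY !hornerC.
Qed.

Lemma const1_eval p s : (const1 p : KA).[s] = 1.
Proof. by rewrite hornerC. Qed.

Lemma Dx_const1_eval p s : (Dx const1 p : KA).[s] =
  x_ p + s * (3%:R * X_ p ^+ 2 / (X_ p ^+ 3 - Y_ p ^+ 3)).
Proof. by rewrite (Dx_eval _ _ weight_const1) // !const1_eval !mulr1. Qed.

Lemma Dy_const1_eval p s : (Dy const1 p : KA).[s] =
  y_ p - s * (3%:R * Y_ p ^+ 2 / (X_ p ^+ 3 - Y_ p ^+ 3)).
Proof. by rewrite (Dy_eval _ _ weight_const1) // !const1_eval !mulr1. Qed.

Lemma Dx2_const1_eval p s : (Dx (Dx const1) p : KA).[s] =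
  x_ p * (Dx const1 p : KA).[s] + s * (3%:R * (X_ p * Y_ p) / (X_ p ^+ 3 - Y_ p ^+ 3))
    * (Dx const1 (pact p s0) : KA).[s].
Proof. exact: Dx_eval (weight_dunkl_mono 1 0) _. Qed.

Lemma Dy2_const1_eval p s : (Dy (Dy const1) p : KA).[s] =
  y_ p * (Dy const1 p : KA).[s] - s * (3%:R * (X_ p * Y_ p) / (X_ p ^+ 3 - Y_ p ^+ 3))
    * (Dy const1 (pact p s0) : KA).[s].
Proof. exact: Dy_eval (weight_dunkl_mono 0 1) _. Qed.

Lemma Dx3_const1_eval p s : (Dx (Dx (Dx const1)) p : KA).[s] =
  x_ p * (Dx (Dx const1) p : KA).[s] + s * (3%:R * Y_ p ^+ 2 / (X_ p ^+ 3 - Y_ p ^+ 3))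
    * (Dx (Dx const1) (pact p s0) : KA).[s].
Proof. exact: Dx_eval (weight_dunkl_mono 2 0) _. Qed.

Ltac averageable_field zeta_prim p :=
  let eX := fresh in let eY := fresh in let ex := fresh in let ey := fresh in
  have [eX eY ex ey] := pact_s0 zeta_prim p;
  rewrite /dunkl_mono /= ?Dx3_const1_eval ?Dx2_const1_eval ?Dy2_const1_eval ?Dx_const1_eval
    ?Dy_const1_eval ?const1_eval
    ?pact_s0K ?eX ?eY ?ex ?ey {eX eY ex ey};
  rewrite /lam_q /lam_r /lam_Q /lam_R /lam_eu /lam_a1 /lam_a2
    ?(hornE, horner_exp) ?expr0;
  have := pt_disc_eval p;
  move: (pt_V p 0 0) (pt_V p 1 0) (pt_Vd p 0 0) (pt_Vd p 0 1);
  let X := fresh in let Y := fresh in let x := fresh in let y := fresh in let D0 := fresh in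
  let D1 := fresh in move=> X Y x y D0;
    (have D1 : Y ^+ 3 - X ^+ 3 != 0 by rewrite -oppr_eq0 opprB);
  field; rewrite ?D0 ?D1 //.

Let poly_q : is_poly lam_q := @is_poly_lamn 0 isT.
Let poly_r : is_poly lam_r := @is_poly_lamn 1 isT.
Let poly_Q : is_poly lam_Q := @is_poly_lamn 2 isT.
Let poly_R : is_poly lam_R := @is_poly_lamn 3 isT.
Let poly_eu : is_poly lam_eu := @is_poly_lamn 4 isT.
Let poly_a1 : is_poly lam_a1 := @is_poly_lamn 5 isT.
Let poly_a2 : is_poly lam_a2 := @is_poly_lamn 6 isT.

Ltac poly_solve := repeat (first [assumption | apply: is_polyC | apply: is_polyN
  | apply: is_polyM | apply: is_polyD]).

(** With (a, b) and (c, e) each among the six base exponents there are 36 cases. Exactly twelve have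
    total weight 0: this one and the eleven that follow. *)
Lemma averageable_0000 : averageable 0 0 0 0.
Proof.
apply: (averageable_weight0 (l := fun=> 2%:R%:P)) => //; first by poly_solve.
by move=> p s; rewrite /dunkl_mono /= !const1_eval hornerC !expr0 !mulr1.
Qed.

Lemma averageable_0030 : averageable 0 0 3 0.
Proof.
apply: (averageable_weight0 (l := lam_r)) => //.
by move=> p s; averageable_field zeta_prim p.
Qed.

Lemma averageable_3000 : averageable 3 0 0 0.
Proof.
apply: (averageable_weight0 (l := lam_R)) => //.
by move=> p s; averageable_field zeta_prim p.
Qed.

(** Beyond xX + yY, the reflections contribute 3A (X^3 - Y^3)/(X^3 - Y^3) = 3A. *)
Lemma averageable_1010 : averageable 1 0 1 0.
Proof.
apply: (averageable_weight0 (l := fun p => lam_eu p + 3%:R%:P * 'X)) => //; first by poly_solve.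
by move=> p s; averageable_field zeta_prim p.
Qed.

Lemma averageable_0101 : averageable 0 1 0 1.
Proof.
apply: (averageable_weight0 (l := fun p => lam_eu p + 3%:R%:P * 'X)) => //; first by poly_solve.
by move=> p s; averageable_field zeta_prim p.
Qed.

Lemma averageable_0120 : averageable 0 1 2 0.
Proof.
apply: (averageable_weight0 (l := lam_a1)) => //.
by move=> p s; averageable_field zeta_prim p.
Qed.

Lemma averageable_1002 : averageable 1 0 0 2.
Proof.
apply: (averageable_weight0 (l := lam_a1)) => //.
by move=> p s; averageable_field zeta_prim p.
Qed.

Lemma averageable_2001 : averageable 2 0 0 1.
Proof.
apply: (averageable_weight0 (l := lam_a2)) => //.
by move=> p s; averageable_field zeta_prim p.
Qed.

Lemma averageable_0210 : averageable 0 2 1 0.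
Proof.
apply: (averageable_weight0 (l := lam_a2)) => //.
by move=> p s; averageable_field zeta_prim p.
Qed.

(** At A = 0 this is Newton's identity for the power sum of xX and yY, whose elementary symmetric
    functions are eu and qQ; the term in A is the reflection correction. The cubic case below has
    the same origin. *)
Lemma averageable_2020 : averageable 2 0 2 0.
Proof.
apply: (averageable_weight0 (l := fun p => lam_eu p * lam_eu p + - (2%:R%:P * (lam_q p * lam_Q p))
  + 3%:R%:P * 'X * lam_eu p)) => //; first by poly_solve.
by move=> p s; averageable_field zeta_prim p.
Qed.

Lemma averageable_0202 : averageable 0 2 0 2.
Proof.
apply: (averageable_weight0 (l := fun p => lam_eu p * lam_eu p + - (2%:R%:P * (lam_q p * lam_Q p))
  + 3%:R%:P * 'X * lam_eu p)) => //; first by poly_solve.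
by move=> p s; averageable_field zeta_prim p.
Qed.

Lemma averageable_3030 : averageable 3 0 3 0.
Proof.
apply: (averageable_weight0 (l := fun p => lam_eu p * (lam_eu p * lam_eu p)
  + - (3%:R%:P * (lam_q p * lam_Q p * lam_eu p)) + 3%:R%:P * 'X * (lam_eu p * lam_eu p)
  + - (3%:R%:P * 'X * (lam_q p * lam_Q p)))) => //; first by poly_solve.
by move=> p s; averageable_field zeta_prim p.
Qed.

Lemma fun_mul_funE (l : point -> KA) (phi : Fun) p : fun_mul l phi p = l p * phi p :> KA.
Proof. by []. Qed.

Lemma lam_inv i (i7 : (i < 7)%N) : W_invariant (fun p => (lam p)`_i).
Proof. by move=> w p; have := lam_invariant (Ordinal i7) w p; rewrite !lamE. Qed.

Lemma avg_poly_lam i psi : (i < 7)%N -> avg_poly psi -> avg_poly (fun_mul (fun p =>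
  (lam p)`_i) psi).
Proof. by move=> i7; apply: avg_poly_mul; [exact: lam_inv|exact: is_poly_lamn]. Qed.

Lemma avg_polyB psi psi' : avg_poly psi -> avg_poly psi' -> avg_poly (psi - psi').
Proof. by move=> h h'; rewrite -scaleN1r; apply: avg_polyD h (avg_polyZ _ h'). Qed.

Lemma Dunkl_fun_mul j l phi : W_invariant l ->
  Dunkl (delta_mx j 0) (fun_mul l phi) = fun_mul l (Dunkl (delta_mx j 0) phi).
Proof. by move=> lW; rewrite -!actH_v; apply: scalar_op_H. Qed.

Lemma iter_fun_mul j n l phi : W_invariant l ->
  iter n (Dunkl (delta_mx j 0)) (fun_mul l phi) = fun_mul l (iter n (Dunkl (delta_mx j 0)) phi).
Proof. by move=> lW; elim: n => //= n ->; rewrite Dunkl_fun_mul. Qed.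

Lemma iter_DunklD j n f g : iter n (Dunkl (delta_mx j 0)) (f + g) =
  iter n (Dunkl (delta_mx j 0)) f + iter n (Dunkl (delta_mx j 0)) g.
Proof. by elim: n => //= n ->; rewrite DunklD. Qed.

Lemma iter_DunklZ u n c f : iter n (Dunkl u) (c *: f) = c *: iter n (Dunkl u) f.
Proof. by elim: n => //= n ->; rewrite DunklZ. Qed.

(** The function [lam_q] is invariant and so passes through all remaining operators; this lowers
    both exponents at once, as [dunkl_mono_3] trades cubes through [lam_r]. *)
Lemma dunkl_mono_SS c e : dunkl_mono c.+1 e.+1 = fun_mul lam_q (dunkl_mono c e).
Proof. by rewrite /dunkl_mono iterSr [iter e.+1 _ _]iterS Dx_Dy (iter_fun_mul _ _ _ (lam_inv
  (i := 0) isT)). Qed.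

Lemma dunkl_mono_3 c e : dunkl_mono c.+3 e + dunkl_mono c e.+3 = fun_mul lam_r (dunkl_mono c e).
Proof.
rewrite /dunkl_mono [iter e.+3 _ _]/(Dy (Dy (Dy (iter e Dy const1)))) !(iterSr _ Dx).
by rewrite -iter_DunklD Dx3_Dy3 (iter_fun_mul _ _ _ (lam_inv (i := 1) isT)).
Qed.

Lemma averageable_XY a b c e : averageable a b c e -> averageable a.+1 b.+1 c e.
Proof.
move=> /averageableP /(avg_poly_lam (i := 2) isT) h; apply: Averageable; move: h;
  congr (avg_poly _); apply/funext => p; apply: esym.
rewrite !fun_mul_funE /coord_mono /= /lam_Q [RHS]mulrA -polyCM.
by congr (_%:P * _); rewrite !exprS; ring.
Qed.

Lemma coord_mono_3 a b c e : fun_mul (coord_mono a.+3 b) (dunkl_mono c e)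
   + fun_mul (coord_mono a b.+3) (dunkl_mono c e) =
  fun_mul (fun p => (lam p)`_3) (fun_mul (coord_mono a b) (dunkl_mono c e)).
Proof.
apply/funext => p; rewrite add_funE !fun_mul_funE /coord_mono /= /lam_R [RHS]mulrA -mulrDl
  -polyCM -polyCD.
by congr (_%:P * _); rewrite -[a.+3]addn3 -[b.+3]addn3 !exprD; ring.
Qed.

Lemma averageable_X3 a b c e : averageable a b c e -> averageable a b.+3 c e ->
  averageable a.+3 b c e.
Proof.
move=> /averageableP /(avg_poly_lam (i := 3) isT) h /averageableP h'; apply: Averageable;
  have := avg_polyB h h'.
by rewrite -coord_mono_3 addrK.
Qed.

Lemma averageable_Y3 a b c e : averageable a b c e -> averageable a.+3 b c e ->
  averageable a b.+3 c e.
Proof.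
move=> /averageableP /(avg_poly_lam (i := 3) isT) h /averageableP h'; apply: Averageable;
  have := avg_polyB h h'.
by rewrite -coord_mono_3 addrC addKr.
Qed.

Lemma fun_mulC (l l' : point -> KA) phi : fun_mul l (fun_mul l' phi) = fun_mul l' (fun_mul l phi).
Proof. by apply/funext => p; rewrite !fun_mul_funE mulrCA. Qed.

Lemma averageable_xy a b c e : averageable a b c e -> averageable a b c.+1 e.+1.
Proof.
by move=> /averageableP /(avg_poly_lam (i := 0) isT) h; apply: Averageable;
  rewrite dunkl_mono_SS fun_mulC.
Qed.

Lemma averageable_x3 a b c e : averageable a b c e -> averageable a b c e.+3 ->
  averageable a b c.+3 e.
Proof.
move=> /averageableP /(avg_poly_lam (i := 1) isT) h /averageableP h'; apply: Averageable;
  have := avg_polyB h h'.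
by rewrite fun_mulC -dunkl_mono_3 fun_mulD addrK.
Qed.

Lemma averageable_y3 a b c e : averageable a b c e -> averageable a b c.+3 e ->
  averageable a b c e.+3.
Proof.
move=> /averageableP /(avg_poly_lam (i := 1) isT) h /averageableP h'; apply: Averageable;
  have := avg_polyB h h'.
by rewrite fun_mulC -dunkl_mono_3 fun_mulD addrC addKr.
Qed.

(** Two nested exponent reductions: the outer one, on (a, b), uses multiplication by Q and R, the
    inner one, on (c, e), uses q and r. The base cases are the twelve explicit ones and those
    excluded by weight. *)
Lemma averageable_all a b c e : averageable a b c e.
Proof.
have g0000 := averageable_0000; have g0030 := averageable_0030; have g3000 := averageable_3000.
have g1010 := averageable_1010; have g0101 := averageable_0101; have g0120 := averageable_0120.
have g1002 := averageable_1002; have g2001 := averageable_2001; have g0210 := averageable_0210.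
have g2020 := averageable_2020; have g0202 := averageable_0202; have g3030 := averageable_3030.
have base i j : averageable i j 0 0 -> averageable i j 1 0 -> averageable i j 0 1 ->
  averageable i j 2 0 -> averageable i j 0 2 ->
    averageable i j 3 0 -> forall k l, averageable i j k l.
  move=> *; apply: (@exponent_reduction (averageable i j)) => // [k l|k l|k l].
  - exact: averageable_xy.
  - exact: averageable_x3.
  - exact: averageable_y3.
move: a b c e; apply: (@exponent_reduction (fun a b => forall c e, averageable a b c e))
    => [||||||i j h k l|i j h h' k l|i j h h' k l].
7: exact: averageable_XY.
7: exact: averageable_X3.
7: exact: averageable_Y3.
all: apply: base; first [assumption|exact: averageable_weight].
Qed.

Lemma iter_translate (w : W) j j' (k : KA) n psi :
  (forall f, translate w (Dunkl (delta_mx j 0) f) = k *: Dunkl (delta_mx j' 0) (translate w f)) ->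
  translate w (iter n (Dunkl (delta_mx j 0)) psi) =
    k ^+ n *: iter n (Dunkl (delta_mx j' 0)) (translate w psi).
Proof.
move=> h; elim: n => [|n IH]; first by rewrite expr0 scale1r.
by rewrite !iterS h IH DunklZ scalerA -exprS.
Qed.

Lemma iter_Dunkl_comm n m u u' psi :
  iter n (Dunkl u) (iter m (Dunkl u') psi) = iter m (Dunkl u') (iter n (Dunkl u) psi).
Proof.
elim: n => //= n ->; move: (iter n _ _) => {}psi.
by elim: m => //= m IH; rewrite -IH Dunkl_comm.
Qed.

Lemma translate_dunkl_mono w c e : exists k : KA,
  translate w (dunkl_mono c e) = k *: dunkl_mono c e \/ translate w (dunkl_mono c e) =
    k *: dunkl_mono e c.
Proof.
have [z z3 wE] := W_shape zeta_prim w.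
have DE u f : Dunkl u f = (u 0 0)%:P *: Dx f + (u 1 0)%:P *: Dy f by apply: DunklE.
case: wE => wE.
  have hx f : translate w (Dx f) = z%:P *: Dx (translate w f).
    by rewrite translate_Dunkl wE DE !mulmx2E !mxE /= !(mulr1, mulr0, mul0r, addr0, scale0r).
  have hy f : translate w (Dy f) = z^-1%:P *: Dy (translate w f).
    by rewrite translate_Dunkl wE DE !mulmx2E !mxE /= !(mulr1, mulr0, mul0r, add0r, scale0r).
  exists (z%:P ^+ c * z^-1%:P ^+ e); left.
  by rewrite /dunkl_mono (iter_translate _ _ hx) (iter_translate _ _ hy) iter_DunklZ scalerA.
have hx f : translate w (Dx f) = z^-1%:P *: Dy (translate w f).
  by rewrite translate_Dunkl wE DE !mulmx2E !mxE /= !(mulr1, mulr0, mul0r, add0r, addr0, scale0r).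
have hy f : translate w (Dy f) = z%:P *: Dx (translate w f).
  by rewrite translate_Dunkl wE DE !mulmx2E !mxE /= !(mulr1, mulr0, mul0r, add0r, addr0, scale0r).
exists (z^-1%:P ^+ c * z%:P ^+ e); right.
rewrite /dunkl_mono (iter_translate _ _ hx) (iter_translate _ _ hy) iter_DunklZ scalerA.
by rewrite iter_Dunkl_comm.
Qed.

Lemma iter_coord_mul a b psi :
  iter a (coord_mul (delta_mx 0 0)) (iter b (coord_mul (delta_mx 0 1)) psi) =
    fun_mul (coord_mono a b) psi.
Proof.
apply/funext => p; rewrite fun_mul_funE /coord_mono polyCM -mulrA.
elim: a => [|a IH].
  rewrite mul1r /=; elim: b => [|b IH]; first by rewrite mul1r.
  by rewrite iterS coord_mul_fun_y fun_mul_funE IH mulrA -polyCM exprS.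
by rewrite iterS coord_mul_fun_x fun_mul_funE IH mulrA -polyCM exprS.
Qed.

Lemma fun_mulZ l (k : KA) (phi : Fun) : fun_mul l (k *: phi) = k *: fun_mul l phi.
Proof. exact: linearZ. Qed.

Lemma avg_poly_mono w a b c e : avg_poly (actR w (mono K a b c e) const1).
Proof.
rewrite actR_mono iter_coord_mul -/(dunkl_mono c e).
by have [k [->|->]] := translate_dunkl_mono w c e; rewrite fun_mulZ;
  apply/avg_polyZ/averageableP/averageable_all.
Qed.

Lemma pbw_monomial_mono w (m : 'X_{1..2 + 2}) : pbw_monomial vH fH gH w m =
  pbw_row w (mono K (m (lshift 2 0)) (m (lshift 2 1)) (m (rshift 2 0)) (m (rshift 2 1))).
Proof. by rewrite pbw_row_mono /pbw_monomial !prod_ord2. Qed.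

Lemma avg_poly_H h : avg_poly (actH h const1).
Proof.
have [p <-] := pbw_surj h; rewrite /Defs.pbw.
have P0 : avg_poly (actH 0 const1) by rewrite actH0; apply: avg_poly0.
have PD u v : avg_poly (actH u const1) -> avg_poly (actH v const1) ->
  avg_poly (actH (u + v) const1).
  by move=> hu hv; rewrite actHD; apply: avg_polyD.
apply: (big_ind (fun u => avg_poly (actH u const1)) P0 PD) => w _.
apply: (big_ind (fun u => avg_poly (actH u const1)) P0 PD) => m _.
by rewrite actHZ; apply: avg_polyZ; rewrite pbw_monomial_mono; apply: avg_poly_mono.
Qed.

Lemma gen_Z_generates (z : centre H) : exists P, evZ P = z.
Proof.
have [P eP] := avg_poly_H (val z).
(* As z is central, w z 1 = z w 1, and w fixes the constant 1; so z 1 is invariant and equals its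
   average. *)
have trz w p : (actH (val z) const1 : Fun) (pact p w) = actH (val z) const1 p.
  rewrite -[LHS]/(translate w (actH (val z) const1) p).
  apply: (congr1 (fun f : Fun => f p)).
  have /asboolP zC := valP z.
  apply: etrans (esym (actH_g w _)) _; apply: etrans (esym (actHM _ _ _)) _.
  apply: etrans (congr1 (fun h => actH h const1) (esym (zC _))) _.
  by apply: etrans (actHM _ _ _) _; congr (actH _ _); apply: actH_g.
have Pz : actH (val z) const1 = actH (val (evZ P)) const1.
  rewrite (evZ_act P const1); apply/funext => p; rewrite fun_mul_funE mulr1 -eP /average !trz.
  apply: poly_eval_inj => a; rewrite !hornE; have n6 : (6%:R : K) != 0 by rewrite pnatr_eq0.
  by move: (horner _ a) => f; field.
exists P; apply: subr0_eq; apply: val_inj;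
  apply: etrans (central_act0 (valP _) _) (esym (raddf0 _)).
apply: etrans (congr1 (fun h => actH h const1) (raddfB _ _ _)) _; apply: etrans (actHB _ _ _) _.
by rewrite Pz subrr.
Qed.

(** * Truncations and the presentation *)

Lemma gen_Z_val i : val (tnth gen_Z i) = tnth gen_H i.
Proof. by rewrite tnth_mktuple. Qed.

Lemma Trunc_centre_inj (z z' : centre H) : Trunc (val z) = Trunc (val z') -> z = z'.
Proof.
move=> e; apply: subr0_eq; apply: val_inj;
  apply: etrans (central_Trunc0 (valP _) _) (esym (raddf0 _)).
apply: etrans (congr1 (@Trunc _ _ zeta_prim) (raddfB _ _ _)) _; apply: etrans (TruncB _ _) _.
by rewrite e subrr.
Qed.

Lemma unique_Trunc (z : centre H) f : Trunc (val z) = f -> unique (fun z : centre H =>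
  Trunc (val z) = f) z.
Proof. by move=> zf; split=> // z' e; apply: Trunc_centre_inj; apply: etrans zf (esym e). Qed.

Lemma gen_Z_presentation : is_presentation gen_Z
  (relators ('X : {poly K})%:MP_[7] 'X_(inord 0) 'X_(inord 1) 'X_(inord 2) 'X_(inord 3)
    'X_(inord 4) 'X_(inord 5) 'X_(inord 6)).
Proof.
split=> [z|p]; first exact: gen_Z_generates.
exact: (iff_trans (evZ_eq0 p) (eval_kernel p)).
Qed.

Lemma Trunc_eu : Trunc (pbw eu_elt) =
  px K * pX K + py K * pY K.
Proof.
apply: etrans (Trunc_gen_elt _ _) _; rewrite /mono.
by rewrite !expr0 !expr1 !mulr1 !mul1r; congr (_ + _); rewrite mulrC.
Qed.
Lemma Trunc_a1 : Trunc (pbw a1_elt) =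
  px K ^+ 2 * pY K + py K ^+ 2 * pX K.
Proof.
apply: etrans (Trunc_gen_elt _ _) _; rewrite /mono.
by rewrite !expr0 !expr1 !mulr1 !mul1r; congr (_ + _); rewrite mulrC.
Qed.
Lemma Trunc_a2 : Trunc (pbw a2_elt) =
  px K * pY K ^+ 2 + py K * pX K ^+ 2.
Proof.
apply: etrans (Trunc_gen_elt _ _) _; rewrite /mono.
by rewrite !expr0 !expr1 !mulr1 !mul1r; congr (_ + _); rewrite mulrC.
Qed.

End CherednikCentre.

Theorem proposition8p1 (RR : realType) (zeta : RR[i])
    (hzeta : 3%N.-primitive_root zeta) :
  let x := xH hzeta in let y := yH hzeta in
  let X := XH hzeta in let Y := YH hzeta in
  let X' := pX RR[i] in let Y' := pY RR[i] in
  let x' := px RR[i] in let y' := py RR[i] in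
  let isTruncInv (z : centre (cherednik hzeta)) (f : polVV RR[i]) :=
    unique (fun z : centre (cherednik hzeta) => Trunc (val z) = f) z in
  let presented_relations (q r Q R eu a1 a2 : {mpoly {poly RR[i]}[7]}) :=
    let A := ('X : {poly RR[i]})%:MP_[7] in
    [:: eu * a1 - (q * a2 + r * Q);
        eu * a2 - (Q * a1 + q * R);
        a1 ^+ 2 - (4%:R * q ^+ 2 * Q + r * a2 - q * eu ^+ 2
                   + 9%:R * A ^+ 2 * q);
        a1 * a2 - (4%:R * q * Q * eu + r * R - eu ^+ 3
                   + 9%:R * A ^+ 2 * eu);
        a2 ^+ 2 - (4%:R * q * Q ^+ 2 + R * a1 - Q * eu ^+ 2
                   + 9%:R * A ^+ 2 * Q)] in
  exists q r Q R eu a1 a2 : centre (cherednik hzeta),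
    [/\ val q = x * y, val r = x ^+ 3 + y ^+ 3,
        val Q = X * Y & val R = X ^+ 3 + Y ^+ 3] /\
    [/\ isTruncInv eu (x' * X' + y' * Y'),
        isTruncInv a1 (x' ^+ 2 * Y' + y' ^+ 2 * X') &
        isTruncInv a2 (x' * Y' ^+ 2 + y' * X' ^+ 2)] /\
    is_presentation [tuple q; r; Q; R; eu; a1; a2]
      (presented_relations 'X_(inord 0) 'X_(inord 1) 'X_(inord 2)
         'X_(inord 3) 'X_(inord 4) 'X_(inord 5) 'X_(inord 6)).
Proof.
move=> x y X Y X' Y' x' y' isTruncInv presented_relations.
pose g i := tnth (gen_Z hzeta) (inord i).
exists (g 0), (g 1), (g 2), (g 3), (g 4), (g 5), (g 6).
have gE i : (i < 7)%N -> val (g i) = (gen_H hzeta)`_i.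
  by move=> i7; apply: etrans (gen_Z_val _ _) _; rewrite (tnth_nth 0) inordK.
split; first by split; apply: gE.
split.
  split; apply: unique_Trunc.
  - exact: etrans (congr1 (@Trunc _ _ hzeta) (gE 4 isT)) (Trunc_eu hzeta).
  - exact: etrans (congr1 (@Trunc _ _ hzeta) (gE 5 isT)) (Trunc_a1 hzeta).
  - exact: etrans (congr1 (@Trunc _ _ hzeta) (gE 6 isT)) (Trunc_a2 hzeta).
have -> : [tuple g 0; g 1; g 2; g 3; g 4; g 5; g 6] = gen_Z hzeta.
  apply: eq_from_tnth => i; rewrite (tnth_nth 0) -[in RHS](inord_val i).
  by case: i => [[|[|[|[|[|[|[|//]]]]]]] ?].
(* The relations of the statement are [relators] at the seven variables, up to conversion. *)
exact: (gen_Z_presentation hzeta).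
Qed.
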